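(* Let $U\subset(0,\infty)$ be nonempty and $1<p<\infty$. Then there is a constant $c_p>0$ (independent of $U$) such that $$\|\mathcal H^U\|_{L^p\to L^p}\ge c_p\sqrt{\log(\mathfrak N(U))}.$$
   Context: Fix $b>1$ and nonzero reals $c_+,c_-$; $\gamma_b(t)=c_+t^b$ for $t>0$, $\gamma_b(t)=c_-(-t)^b$ for $t<0$. For $u\in\mathbb R$, $H^{(u)}f(x)=\mathrm{p.v.}\int f(x_1-t,x_2-u\gamma_b(t))\frac{dt}t$, and $\mathcal H^Uf=\sup_{u\in U}|H^{(u)}f|$; $\|\mathcal H^U\|_{L^p\to L^p}=\sup\{\|\mathcal H^Uf\|_p:\|f\|_p\le1\}$ (possibly $+\infty$). $\mathfrak N(U)=1+\#\{n\in\mathbb Z:[2^n,2^{n+1}]\cap U\ne\emptyset\}$. *)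

(* Defs.v *)
From HB Require Import structures.
From mathcomp Require Import all_boot all_order all_algebra.
From mathcomp Require Import all_classical all_reals all_analysis.
From mathcomp Require Import finmap.
Set Implicit Arguments. Unset Strict Implicit. Unset Printing Implicit Defensive.
Import Order.TTheory GRing.Theory Num.Theory.
Import numFieldNormedType.Exports.
Local Open Scope classical_set_scope.
Local Open Scope ring_scope.

Section Defs.
Variable R : realType.

Definition leb2 := (@lebesgue_measure R \x @lebesgue_measure R)%E.

Definition gam (b cp cm : R) (t : R) : R :=
  if 0 < t then cp * t `^ b else if t < 0 then cm * (- t) `^ b else 0.

Definition dir (i : bool) : R * R := if i then (1, 0) else (0, 1).

Definition iterD (s : seq bool) (f : R * R -> R) : R * R -> R :=
  foldr (fun i g => 'D_(dir i) g) f s.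

Definition testfun (f : R * R -> R) : Prop :=
  (forall (s : seq bool) (x : R * R) (i : bool), derivable (iterD s f) x (dir i)) /\
  (forall s : seq bool, continuous (iterD s f)) /\
  (exists M : R, forall x : R * R, M < `|x.1| \/ M < `|x.2| -> f x = 0).

Definition Htrunc (b cp cm u : R) (f : R * R -> R) (x : R * R) (eps : R) : R :=
  \int[@lebesgue_measure R]_(t in [set t : R | eps < `|t|])
     (f (x.1 - t, x.2 - u * gam b cp cm t) / t).

Definition Hu (b cp cm u : R) (f : R * R -> R) (x : R * R) : R :=
  lim (Htrunc b cp cm u f x @ 0^'+).

Definition HU (b cp cm : R) (U : set R) (f : R * R -> R) (x : R * R) : \bar R :=
  ereal_sup [set (`|Hu b cp cm u f x|)%:E | u in U].

Definition LpE (p : R) (g : R * R -> \bar R) : \bar R :=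
  ((\int[leb2]_x (g x `^ p)) `^ p^-1)%E.

Definition opnormHU (b cp cm : R) (U : set R) (p : R) : \bar R :=
  ereal_sup [set LpE p (HU b cp cm U f) | f in
     [set f | testfun f /\ (LpE p (fun x => (`|f x|)%:E) <= 1)%E]].

Definition dyadic_set (U : set R) : set int :=
  [set n : int | exists2 u, U u & (2 `^ n%:~R <= u <= 2 `^ (n + 1)%:~R)].

Definition frakN (U : set R) : \bar R :=
  if pselect (finite_set (dyadic_set U))
  then (1 + (#|` fset_set (dyadic_set U)|%fset)%:R)%:E
  else +oo%E.

Definition sqrt_log_times (c : R) (N : \bar R) : \bar R :=
  match N with
  | r%:E => (c * Num.sqrt (ln r))%:E
  | _ => +oo%E
  end.
End Defs.

(* Main.v *)
Require Import Defs.
From HB Require Import structures.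
From mathcomp Require Import all_boot all_order all_algebra.
From mathcomp Require Import all_classical all_reals all_analysis.
From mathcomp Require Import measurable_realfun ring lra.
Set Implicit Arguments. Unset Strict Implicit. Unset Printing Implicit Defensive.
Import Order.TTheory GRing.Theory Num.Theory.
Import numFieldNormedType.Exports.
Local Open Scope classical_set_scope.
Local Open Scope ring_scope.

(* On a plane wave of phase lam x1 + (lam^b / w) x2 cut off to a bump, H^(u)
   acts for large lam through a multiplier of v = u / w alone, which has distinct
   limits for small and for large v.  Hence, if u' is much smaller than w and u''
   much larger, H^(u') - H^(u'') multiplies the amplitude by a constant rho and
   shifts the phase.

   Given lacunary u_0 < ... < u_J with J = 2^m - 1, a binary tree of depth m is
   grown from a bump: each cell chi of the tree owns a dyadic block of indices
   and receives one wave, with w between the two halves of the block; chi is then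
   split according to the sign of the shifted wave, the positive part owning the
   left half of the block and the negative part the right half.  At a point of
   the leaf owning j, H^(u_j) F - H^(u_J) F collects the positive parts of the
   waves along the branch, so that sup_u |H^(u) F| has mean at least a multiple
   of rho m.  The waves oscillate at frequencies chosen one after the other, so
   F behaves like a martingale with bounded quadratic variation per level: its
   exponential moments are those of a Gaussian of variance m, and its L^p norm is
   O(sqrt m).  The quotient is at least a multiple of sqrt m, and U contains 2^m
   lacunary points as soon as it meets a multiple of 2^m dyadic intervals. *)

(** The index J is the last of all, so at every node [u J] lies beyond w. A branch turning right
    sees almost the same multiplier at [u j] and at [u J], and the wave cancels; a branch turning
    left sees the jump rho. The jump cannot vanish, because its sine part is at least a multiple of
    1 - 1/b. The multiplier is known only up to an error d, which is paid once per level; as d is a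
    small fraction of rho, this loss stays below the gain, also linear in m. Test functions must be
    smooth, so cells cannot be split sharply: smoothed indicators lose a fraction kap of the mass at
    each level, and kap = 1/(50 m) saves 49/50 of it. The L^p bound passes through exp(s F - s^2 V),
    where V sums the squared amplitudes. A new wave multiplies this by one factor and, once its
    frequency is large, raises the integrals by at most an arbitrary tolerance; p-th powers do not
    factor in this way. All averages are taken along horizontal lines, uniformly in x2, and so
    reduce to one-variable integrations by parts in the direction of frequency lam. *)

(** * One-variable calculus *)

Section OneVariable.
Variable R : realType.
Implicit Types (f g F : R -> R) (t x y : R).

Definition dr f t d := is_derive t (1 : R) f d.

Lemma dr_eq f t d d' : dr f t d -> d = d' -> dr f t d'.
Proof. by move=> h <-. Qed.

Lemma dr_cst (c t : R) : dr (fun=> c) t 0.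
Proof. exact: is_derive_cst. Qed.

Lemma dr_id t : dr (fun s => s) t 1.
Proof. exact: is_derive_id. Qed.

Lemma drD f g t a b : dr f t a -> dr g t b -> dr (fun s => f s + g s) t (a + b).
Proof. by move=> h1 h2; exact: (is_deriveD h1 h2). Qed.

Lemma drN f t a : dr f t a -> dr (fun s => - f s) t (- a).
Proof. by move=> h1; exact: (is_deriveN h1). Qed.

Lemma drM f g t a b : dr f t a -> dr g t b ->
  dr (fun s => f s * g s) t (a * g t + f t * b).
Proof.
move=> h1 h2; apply: dr_eq; first exact: (is_deriveM h1 h2).
by rewrite addrC /GRing.scale /= [g t * a]mulrC.
Qed.

Lemma dr_comp f g t a b : dr g t b -> dr f (g t) a -> dr (fun s => f (g s)) t (a * b).
Proof.
move=> [d1 e1] [d2 e2].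
have dc : derivable (f \o g) t 1.
  apply: diff_derivable; apply: differentiable_comp; exact/derivable1_diffP.
split; first exact: dc.
by rewrite -derive1E (derive1_comp d1 d2) !derive1E e1 e2.
Qed.

Lemma dr_sin t : dr (@sin R) t (cos t). Proof. exact: is_derive_sin. Qed.
Lemma dr_cos t : dr (@cos R) t (- sin t). Proof. exact: is_derive_cos. Qed.
Lemma dr_exp t : dr (@expR R) t (expR t). Proof. exact: is_derive_expR. Qed.
Lemma dr_ln t : 0 < t -> dr (@ln R) t t^-1. Proof. exact: is_derive1_ln. Qed.
Lemma dr_powR (a : R) t : 0 < t -> dr (fun s => s `^ a) t (a * t `^ (a - 1)).
Proof. exact: is_derive1_powR. Qed.

Lemma drV f t a : dr f t a -> f t != 0 -> dr (fun s => (f s)^-1) t (- a / (f t) ^+ 2).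
Proof.
move=> h1 h0; have [d1 e1] := h1.
apply: DeriveDef; first exact: derivableV.
by rewrite deriveV// e1 /GRing.scale /= mulrC mulNr mulrN.
Qed.

Lemma dr_near f g t a : (\forall s \near t, f s = g s) -> dr f t a -> dr g t a.
Proof. by move=> h1 h2; apply: near_eq_is_derive h2. Qed.

Lemma dr_cont f t a : dr f t a -> {for t, continuous f}.
Proof.
by move=> [d _]; apply: differentiable_continuous; exact/derivable1_diffP.
Qed.

Lemma cont_itv (a b : R) f :
  (forall t, a <= t <= b -> {for t, continuous f}) -> {within `[a, b], continuous f}.
Proof.
by move=> h; apply: continuous_in_subspaceT => t; rewrite inE /= in_itv; exact: h.
Qed.

Lemma cont_integrable (a b : R) f :
  (forall t, a <= t <= b -> {for t, continuous f}) ->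
  (@lebesgue_measure R).-integrable `[a, b] (EFin \o f).
Proof.
move=> h; apply: continuous_compact_integrable; first exact: segment_compact.
exact: cont_itv.
Qed.

Definition itg (a b : R) f := \int[@lebesgue_measure R]_(t in `[a, b]) f t.

Lemma itg_FTC (a b : R) f F : a <= b ->
  (forall t, a <= t <= b -> {for t, continuous f}) ->
  (forall t, a <= t <= b -> dr F t (f t)) -> itg a b f = F b - F a.
Proof.
rewrite le_eqVlt => /orP[/eqP <-|ab] cf dF.
  by rewrite subrr /itg set_itv1 Rintegral_set1.
rewrite /itg /Rintegral (@continuous_FTC2 _ f F)//; first exact: cont_itv.
- split.
  + move=> t; rewrite in_itv /= => /andP[h1 h2].
    by have [] : dr F t (f t) by apply: dF; rewrite (ltW h1) (ltW h2).
  + apply: cvg_at_right_filter; apply: (@dr_cont _ _ (f a)).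
    by apply: dF; rewrite lexx ltW.
  + apply: cvg_at_left_filter; apply: (@dr_cont _ _ (f b)).
    by apply: dF; rewrite lexx ltW.
- move=> t; rewrite in_itv /= => /andP[h1 h2].
  rewrite derive1E; have [_ ->//] : dr F t (f t).
  by apply: dF; rewrite (ltW h1) (ltW h2).
Qed.

Lemma antideriv (a b : R) f : a < b ->
  (forall t, a < t < b -> {for t, continuous f}) ->
  forall a' b', a < a' -> b' < b ->
  exists F, forall t, a' <= t <= b' -> dr F t (f t).
Proof.
move=> ab cf a' b' aa bb.
(* The larger interval makes [a'] and [b'] interior points, so that two-sided derivatives exist
   there. *)
pose a2 := (a + a') / 2; pose b2 := (b + b') / 2.
exists (fun y => itg a2 y f) => t /andP[t1 t2].
have h : (@lebesgue_measure R).-integrable `[a2, b2] (EFin \o f).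
  by apply: cont_integrable => s hs; apply: cf; rewrite /a2 /b2 in hs; lra.
have [] := @continuous_FTC1_closed R f a2 t b2 _ h.
- by rewrite /b2; lra.
- by rewrite /a2; lra.
- by apply: cf; rewrite (lt_le_trans aa)//= (le_lt_trans t2).
by rewrite derive1E => ? ?; split.
Qed.
End OneVariable.

(** * Continuity and integrals over compact intervals *)

Section Integral.
Variable R : realType.
Implicit Types (f g h F : R -> R) (a b c s t x y : R).

Definition ct f t := {for t, continuous f}.

Lemma ct_cst c t : ct (fun=> c) t.
Proof. exact: cvg_cst. Qed.
Lemma ct_id t : ct (fun s => s) t.
Proof. exact: cvg_id. Qed.
Lemma ctD f g t : ct f t -> ct g t -> ct (fun s => f s + g s) t.
Proof. by move=> h1 h2; apply: cvgD. Qed.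
Lemma ctN f t : ct f t -> ct (fun s => - f s) t.
Proof. by move=> h1; apply: cvgN. Qed.
Lemma ctM f g t : ct f t -> ct g t -> ct (fun s => f s * g s) t.
Proof. by move=> h1 h2; apply: cvgM. Qed.
Lemma ctV f t : f t != 0 -> ct f t -> ct (fun s => (f s)^-1) t.
Proof. by move=> h0 h1; apply: cvgV. Qed.
Lemma ct_comp f g t : ct g t -> ct f (g t) -> ct (fun s => f (g s)) t.
Proof. by move=> h1 h2; apply: continuous_comp. Qed.
Lemma ct_norm f t : ct f t -> ct (fun s => `|f s|) t.
Proof. by move=> h1; apply: cvg_norm. Qed.
Lemma ct_dr f t d : dr f t d -> ct f t.
Proof. exact: dr_cont. Qed.

Definition cts a b f := forall t, a <= t <= b -> ct f t.

Lemma itg_ext a b f g : (forall t, a <= t <= b -> f t = g t) -> itg a b f = itg a b g.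
Proof.
by move=> e; apply: eq_Rintegral => t; rewrite inE /= in_itv /= => /e.
Qed.

Lemma itgD a b f g : cts a b f -> cts a b g ->
  itg a b (fun s => f s + g s) = itg a b f + itg a b g.
Proof. by move=> cf cg; apply: RintegralD => //; exact: cont_integrable. Qed.

Lemma itgB a b f g : cts a b f -> cts a b g ->
  itg a b (fun s => f s - g s) = itg a b f - itg a b g.
Proof. by move=> cf cg; apply: RintegralB => //; exact: cont_integrable. Qed.

Lemma itgZ a b c f : cts a b f -> itg a b (fun s => c * f s) = c * itg a b f.
Proof. by move=> cf; apply: RintegralZl => //; exact: cont_integrable. Qed.

Lemma itg_le a b f g : cts a b f -> cts a b g ->
  (forall t, a <= t <= b -> f t <= g t) -> itg a b f <= itg a b g.
Proof.
move=> cf cg fg; apply: le_Rintegral => //; (try exact: cont_integrable) => t /=; rewrite in_itv; exact: fg.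
Qed.

Lemma itg_abs a b f h : cts a b f -> cts a b h ->
  (forall t, a <= t <= b -> `|f t| <= h t) -> `|itg a b f| <= itg a b h.
Proof.
move=> cf ch fh; apply: le_trans (_ : itg a b (fun t => `|f t|) <= _).
  by apply: le_normr_Rintegral => //; exact: cont_integrable.
by apply: itg_le => // t ht; apply: ct_norm; exact: cf.
Qed.

Lemma itg_cst a b c : a <= b -> itg a b (fun=> c) = c * (b - a).
Proof.
move=> ab; rewrite (@itg_FTC _ a b _ (fun s => c * s))//.
- by rewrite mulrBr.
- by move=> t _; exact: ct_cst.
- move=> t _; apply: dr_eq; first by apply: drM; [exact: dr_cst|exact: dr_id].
  by rewrite mul0r add0r mulr1.
Qed.

Lemma itg_split a b c f : a <= c <= b -> cts a b f -> itg a b f = itg a c f + itg c b f.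
Proof.
move=> /andP[ac cb] cf.
rewrite {1}/itg {2}/itg  -[X in _ = _ + X](@Rintegral_itv_obnd_cbnd _ c (BRight b)); last first.
  have := cont_integrable cf; apply: integrableS => //.
  by apply: subset_itv => //; rewrite bnd_simp.
have := @Rintegral_itvB _ f (BLeft a) (BRight b) c (cont_integrable cf).
rewrite !bnd_simp => /(_ ac cb) <-.
by rewrite addrC subrK.
Qed.

(** The measure ds/s is invariant under dilations: if F is a primitive of k(s)/s, then F(r s) is one
    of k(r s)/s. *)
Lemma itg_scale r a b (k : R -> R) : 0 < r -> 0 < a -> a <= b -> (forall t, 0 < t -> ct k t) ->
  itg (r * a) (r * b) (fun s => k s / s) = itg a b (fun s => k (r * s) / s).
Proof.
move=> r0 a0 ab ck.
have ckk t : 0 < t -> ct (fun s => k s / s) t.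
  move=> t0; apply: ctM; first exact: ck.
  by apply: ctV; [rewrite gt_eqF|exact: ct_id].
have [F HF] : exists F, forall t, r * (a / 2) <= t <= r * (b + 1) -> dr F t (k t / t).
  apply: (@antideriv R (r * (a / 3)) (r * (b + 2))); rewrite ?ltr_pM2l//; try lra.
  move=> t /andP[t1 _]; apply: ckk; apply: lt_trans t1.
  by rewrite mulr_gt0//; lra.
rewrite (@itg_FTC _ _ _ _ F).
- rewrite (@itg_FTC _ _ _ _ (fun s => F (r * s)))//.
  + move=> t /andP[t1 t2]; apply: ctM.
      apply: ct_comp; last by apply: ck; rewrite mulr_gt0//; apply: lt_le_trans t1.
      by apply: ctM; [exact: ct_cst|exact: ct_id].
    by apply: ctV; [rewrite gt_eqF//; lra|exact: ct_id].
  + move=> t /andP[t1 t2]; apply: dr_eq.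
      apply: dr_comp; first by apply: drM; [exact: dr_cst|exact: dr_id].
      apply: HF; rewrite !ler_pM2l//; lra.
    have t0 : t != 0 by rewrite gt_eqF//; lra.
    have r0' : r != 0 by rewrite gt_eqF.
    by field; rewrite t0 r0'.
- by rewrite ler_pM2l.
- move=> t /andP[t1 _]; apply: ckk; apply: lt_le_trans t1.
  by rewrite mulr_gt0.
- move=> t /andP[t1 t2]; apply: HF; apply/andP; split.
    by apply: le_trans t1; rewrite ler_pM2l//; lra.
  by apply: le_trans t2 _; rewrite ler_pM2l//; lra.
Qed.

(** Serves the functions [flat n] at the origin, where two different formulas meet. *)
Lemma dr_quad f t C : (forall s, `|f (t + s) - f t| <= C * s ^+ 2) -> dr f t 0.
Proof.
move=> h.
have C0 : 0 <= C.
  by have := h 1; rewrite expr1n mulr1; apply: le_trans.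
have H : (fun s => s^-1 *: ((f \o shift t) (s *: (1 : R)) - f t)) @ 0^' --> (0 : R).
  apply/cvgrPdist_le => /= e e0; near=> s.
  have s0 : s != 0 by near: s; exact: nbhs_dnbhs_neq.
  have sC : `|s| <= e / (C + 1).
    near: s; apply: dnbhs0_le; rewrite divr_gt0//; lra.
  rewrite sub0r normrN /shift /= /GRing.scale /= mulr1 normrM normfV.
  rewrite ler_pdivrMl ?normr_gt0// [s + t]addrC.
  apply: le_trans (h s) _.
  rewrite -real_normK ?num_real// expr2 mulrCA ler_wpM2l//.
  apply: le_trans (ler_wpM2l C0 sC) _.
  rewrite mulrCA ler_piMr ?(ltW e0)// ler_pdivrMr ?ltr_wpDl// mul1r.
  by rewrite lerDl.
split; first by apply/cvg_ex; exists 0.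
exact: cvg_lim H.
Unshelve. all: by end_near. Qed.
End Integral.

(** * A syntax for smooth functions on the plane *)

Section Smooth.
Variable R : realType.
Implicit Types (f g h F : R -> R) (a b c s t x y : R).

Definition flat (n : nat) (y : R) : R := if 0 < y then y^-1 ^+ n * expR (- y^-1) else 0.

Lemma expR_fact (n : nat) (z : R) : 0 <= z -> z ^+ n <= n`!%:R * expR z.
Proof.
move=> z0; case: n => [|n].
  by rewrite expr0 fact0 mul1r -expR0 ler_expR.
rewrite mulrC -ler_pdivrMr ?ltr0n ?fact_gt0//.
by apply: le_trans (expR_ge1Dxn n z0); rewrite lerDr.
Qed.

Lemma flat_ge0 n y : 0 <= flat n y.
Proof.
rewrite /flat; case: ifPn => // y0.
by rewrite mulr_ge0 ?expR_ge0// exprn_ge0// invr_ge0 ltW.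
Qed.

Lemma flat_le n y : flat n y <= n`!%:R.
Proof.
rewrite /flat; case: ifPn => // y0.
rewrite expRN ler_pdivrMr ?expR_gt0//; apply: expR_fact.
by rewrite invr_ge0 ltW.
Qed.

Lemma flat_norm n y : `|flat n y| <= n`!%:R.
Proof. by rewrite ger0_norm ?flat_ge0// flat_le. Qed.

(** Two powers of 1/y are traded for y^2: the bound on [flat n.+2] becomes quadratic vanishing of
    [flat n]. *)
Lemma flat_quad n y : flat n y <= n.+2`!%:R * y ^+ 2.
Proof.
have := flat_le n.+2 y; rewrite {1}/flat; rewrite /flat; case: ifPn => y0 h.
  have -> : y^-1 ^+ n * expR (- y^-1) = y^-1 ^+ n.+2 * expR (- y^-1) * y ^+ 2.
    by rewrite !exprS expr0; field; rewrite gt_eqF.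
  by rewrite ler_wpM2r// sqr_ge0.
by rewrite mulr_ge0// sqr_ge0.
Qed.

Lemma dr_flat n y : dr (flat n) y (flat n.+2 y - n%:R * flat n.+1 y).
Proof.
have [y0|y0|->] := ltgtP y 0.
- apply: (@dr_near _ (fun=> 0)).
    near=> s; rewrite /flat ltNge ltW//.
    by near: s; exact: lt_nbhsl.
  apply: dr_eq; first exact: dr_cst.
  by rewrite /flat ltNge (ltW y0)/= mulr0 subrr.
- apply: (@dr_near _ (fun s => s^-1 ^+ n * expR (- s^-1))).
    near=> s; rewrite /flat ifT//.
    by near: s; exact: lt_nbhsr.
  have yN0 : y != 0 by rewrite gt_eqF.
  have dV : dr (fun s => s^-1) y (- y^-1 ^+ 2).
    by apply: dr_eq; [exact: (drV (dr_id y) yN0)|rewrite exprVn mulN1r].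
  have dX : dr (fun s => s^-1 ^+ n) y (- n%:R * y^-1 ^+ n.+1).
    elim: (n) => [|k IH].
      by apply: dr_eq; [exact: dr_cst|rewrite oppr0 mul0r].
    apply: (@dr_near _ (fun s => s^-1 * s^-1 ^+ k)).
      by near=> s; rewrite exprS.
    apply: dr_eq; first exact: (drM dV IH).
    by rewrite !exprS -[k.+1%:R]natr1; ring.
  apply: dr_eq.
    apply: drM; first exact: dX.
    apply: dr_comp; last exact: dr_exp.
    exact: (drN dV).
  by rewrite /flat y0 !exprS; ring.
- apply: dr_eq.
    apply: (@dr_quad _ _ _ n.+2`!%:R) => s; rewrite add0r.
    rewrite [flat n 0]/flat ltxx subr0 ger0_norm ?flat_ge0//; exact: flat_quad.
  by rewrite /flat ltxx mulr0 subrr.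
Unshelve. all: by end_near. Qed.

(* [EFlat n e] is [flat n] composed with [e]: since the derivative of [flat n]
   combines [flat n.+1] and [flat n.+2], the syntax is closed under [De]. *)
Inductive expr :=
| ECst of R | EFst | ESnd | EAdd of expr & expr | EMul of expr & expr
| ESin of expr | ECos of expr | EExp of expr | EFlat of nat & expr.

Fixpoint ev (e : expr) (x : R * R) : R :=
  match e with
  | ECst c => c | EFst => x.1 | ESnd => x.2
  | EAdd e1 e2 => ev e1 x + ev e2 x
  | EMul e1 e2 => ev e1 x * ev e2 x
  | ESin e1 => sin (ev e1 x) | ECos e1 => cos (ev e1 x) | EExp e1 => expR (ev e1 x)
  | EFlat n e1 => flat n (ev e1 x)
  end.

Fixpoint De (i : bool) (e : expr) : expr :=
  match e with
  | ECst c => ECst 0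
  | EFst => ECst (if i then 1 else 0)
  | ESnd => ECst (if i then 0 else 1)
  | EAdd e1 e2 => EAdd (De i e1) (De i e2)
  | EMul e1 e2 => EAdd (EMul (De i e1) e2) (EMul e1 (De i e2))
  | ESin e1 => EMul (ECos e1) (De i e1)
  | ECos e1 => EMul (EMul (ECst (-1)) (ESin e1)) (De i e1)
  | EExp e1 => EMul (EExp e1) (De i e1)
  | EFlat n e1 => EMul (EAdd (EFlat n.+2 e1) (EMul (ECst (- n%:R)) (EFlat n.+1 e1))) (De i e1)
  end.

Lemma ev_curve e (c1 c2 : R -> R) t d1 d2 : dr c1 t d1 -> dr c2 t d2 ->
  dr (fun s => ev e (c1 s, c2 s)) t
    (ev (De true e) (c1 t, c2 t) * d1 + ev (De false e) (c1 t, c2 t) * d2).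
Proof.
move=> h1 h2; elim: e => [c| | |e1 I1 e2 I2|e1 I1 e2 I2|e1 I1|e1 I1|e1 I1|n e1 I1] /=.
- by apply: dr_eq; [exact: dr_cst|rewrite /=; ring].
- by apply: dr_eq; [exact: h1|rewrite /=; ring].
- by apply: dr_eq; [exact: h2|rewrite /=; ring].
- by apply: dr_eq; [exact: (drD I1 I2)|rewrite /=; ring].
- by apply: dr_eq; [exact: (drM I1 I2)|rewrite /=; ring].
- by apply: dr_eq; [apply: (dr_comp I1); exact: dr_sin|rewrite /=; ring].
- by apply: dr_eq; [apply: (dr_comp I1); exact: dr_cos|rewrite /=; ring].
- by apply: dr_eq; [apply: (dr_comp I1); exact: dr_exp|rewrite /=; ring].
- by apply: dr_eq; [apply: (dr_comp I1); exact: dr_flat|rewrite /=; ring].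
Qed.

Lemma ev_cont e : continuous (ev e).
Proof.
elim: e => [c| | |e1 I1 e2 I2|e1 I1 e2 I2|e1 I1|e1 I1|e1 I1|n e1 I1] /= x.
- exact: cvg_cst.
- exact: cvg_fst.
- exact: cvg_snd.
- by apply: cvgD; [exact: I1|exact: I2].
- by apply: cvgM; [exact: I1|exact: I2].
- by apply: (@continuous_comp _ _ _ (ev e1) sin); [exact: I1|exact: continuous_sin].
- by apply: (@continuous_comp _ _ _ (ev e1) cos); [exact: I1|exact: continuous_cos].
- by apply: (@continuous_comp _ _ _ (ev e1) expR); [exact: I1|exact: continuous_expR].
- by apply: (@continuous_comp _ _ _ (ev e1) (flat n));
    [exact: I1|exact: (dr_cont (dr_flat n _))].
Qed.

Lemma is_derive_line (f : R * R -> R) (x v : R * R) (d : R) :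
  dr (fun h : R => f (h *: v + x)) 0 d -> is_derive x v f d.
Proof.
move=> [h1 h2]; split; first exact/derivable1P.
rewrite -h2 /derive; set g1 := fun h : R => h^-1 *: _; set g2 := fun h : R => h^-1 *: _.
suff -> : g1 = g2 by [].
by rewrite funeqE /g1 /g2 => h /=; rewrite addr0 scale0r add0r [_%:A]mulr1.
Qed.

Lemma ev_dir (e : expr) i (x : R * R) : is_derive x (dir R i) (ev e) (ev (De i e) x).
Proof.
apply: is_derive_line; case: x => x1 x2.
have lin (y d : R) : dr (fun h : R => h * d + y) 0 d.
  apply: dr_eq; first by apply: drD; [apply: drM|]; [exact: dr_id|exact: dr_cst..].
  by rewrite /=; ring.
have := ev_curve e (lin x1 (dir R i).1) (lin x2 (dir R i).2).
rewrite !mul0r !add0r => h; apply: dr_eq; first exact: h.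
by case: i {h lin}; rewrite /=; ring.
Qed.

Lemma ev_iterD (e : expr) (s : seq bool) : exists e' : expr, Defs.iterD s (ev e) = ev e'.
Proof.
elim: s => [|i s [e' IH]]; first by exists e.
exists (De i e'); rewrite /Defs.iterD /= -/(Defs.iterD s (ev e)) IH.
by apply/funext => x; have [_ ->] := ev_dir e' i x.
Qed.

Lemma ev_testfun (e : expr) :
  (exists M : R, forall x : R * R, M < `|x.1| \/ M < `|x.2| -> ev e x = 0) ->
  testfun (ev e).
Proof.
move=> h; split; [|split => //].
- move=> s x i; have [e' ->] := ev_iterD e s.
  by have [] := ev_dir e' i x.
- by move=> s; have [e' ->] := ev_iterD e s; exact: ev_cont.
Qed.

Lemma ev_bound (e : expr) (M : R) : exists2 C : R, 0 < C &
  forall x : R * R, `|x.1| <= M -> `|x.2| <= M -> `|ev e x| <= C.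
Proof.
elim: e => [c| | |e1 [C1 p1 I1] e2 [C2 p2 I2]|e1 [C1 p1 I1] e2 [C2 p2 I2]|e1 [C1 p1 I1]
   |e1 [C1 p1 I1]|e1 [C1 p1 I1]|n e1 [C1 p1 I1]] /=.
- by exists (`|c| + 1); [rewrite ltr_wpDl|move=> x _ _; rewrite lerDl].
- exists (`|M| + 1); first by rewrite ltr_wpDl.
  by move=> x h _; apply: (le_trans h); rewrite (le_trans (ler_norm _))// lerDl.
- exists (`|M| + 1); first by rewrite ltr_wpDl.
  by move=> x _ h; apply: (le_trans h); rewrite (le_trans (ler_norm _))// lerDl.
- exists (C1 + C2); first by rewrite addr_gt0.
  by move=> x h1 h2; apply: (le_trans (ler_normD _ _)); rewrite lerD ?I1 ?I2.
- exists (C1 * C2); first by rewrite mulr_gt0.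
  by move=> x h1 h2; rewrite normrM ler_pM ?I1 ?I2.
- by exists 1 => // x _ _; rewrite ler_norml sin_geN1 sin_le1.
- by exists 1 => // x _ _; rewrite ler_norml cos_geN1 cos_le1.
- exists (expR C1); first exact: expR_gt0.
  move=> x h1 h2; rewrite ger0_norm ?expR_ge0// ler_expR.
  by apply: le_trans (I1 _ h1 h2); exact: ler_norm.
- exists n`!%:R; first by rewrite ltr0n fact_gt0.
  by move=> x _ _; exact: flat_norm.
Qed.
End Smooth.

(** * Oscillatory integrals along the curve *)

Section Osc0.
Variable R : realType.
Implicit Types (f g h F : R -> R) (a b c s t x y : R).

(** Mean value theorem for h - P. Integrations by parts below are done in this form, comparing
    increments of primitives instead of integrating derivatives. *)
Lemma dr_le a b P h p r : a <= b ->
  (forall s, a <= s <= b -> dr P s (p s)) ->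
  (forall s, a <= s <= b -> dr h s (r s)) ->
  (forall s, a <= s <= b -> p s <= r s) -> P b - P a <= h b - h a.
Proof.
move=> ab dP dh pr.
have [] := @MVT_segment R (fun s => h s - P s) (fun s => r s - p s) a b ab.
- move=> s; rewrite in_itv /= => /andP[s1 s2].
  by apply: drD; [apply: dh|apply: drN; apply: dP]; rewrite !ltW.
- apply: cont_itv => s hs; apply: (@ct_dr _ _ _ (r s - p s)).
  by apply: drD; [apply: dh|apply: drN; apply: dP].
move=> c; rewrite in_itv /= => hc E.
have : 0 <= (r c - p c) * (b - a) by rewrite mulr_ge0// subr_ge0// pr.
by rewrite -E; lra.
Qed.

Lemma dr_abs_le a b P h p r : a <= b ->
  (forall s, a <= s <= b -> dr P s (p s)) ->
  (forall s, a <= s <= b -> dr h s (r s)) ->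
  (forall s, a <= s <= b -> `|p s| <= r s) -> `|P b - P a| <= h b - h a.
Proof.
move=> ab dP dh pr; rewrite ler_norml; apply/andP; split; last first.
  by apply: (dr_le ab dP dh) => s hs; apply: le_trans (pr s hs); exact: ler_norm.
have := @dr_le a b (fun s => - P s) h (fun s => - p s) r ab _ dh.
rewrite /= => H; suff : - P b - - P a <= h b - h a by lra.
apply: H => s hs; first by apply: drN; apply: dP.
by apply: le_trans (pr s hs); rewrite -normrN; exact: ler_norm.
Qed.

Lemma lipschitz1 f g : (forall s, dr f s (g s)) -> (forall s, `|g s| <= 1) ->
  forall x y, `|f x - f y| <= `|x - y|.
Proof.
move=> df g1; have H x y : y <= x -> `|f x - f y| <= x - y.
  move=> yx; apply: (@dr_abs_le y x f (fun s => s) g (fun=> 1)) => // s _.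
  exact: dr_id.
move=> x y; have [yx|xy] := leP y x.
  by apply: le_trans (H _ _ yx) _; exact: ler_norm.
by rewrite distrC [leRHS]distrC; apply: le_trans (H _ _ (ltW xy)) _; exact: ler_norm.
Qed.

Lemma antideriv_pos a b f : 0 < a -> (forall t, 0 < t -> ct f t) ->
  exists F, forall t, a <= t <= b -> dr F t (f t).
Proof.
move=> a0 cf; have [ab|ba] := leP a b; last by exists f => t; lra.
apply: (@antideriv R (a / 2) (b + 1)); try lra.
by move=> t /andP[t1 _]; apply: cf; lra.
Qed.

Lemma abs_sin_le1 y : `|sin y| <= 1 :> R.
Proof. by rewrite ler_norml sin_geN1 sin_le1. Qed.
Lemma abs_cos_le1 y : `|cos y| <= 1 :> R.
Proof. by rewrite ler_norml cos_geN1 cos_le1. Qed.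

(* Abstracts sin, cos and their translates. *)
Definition osc f := (exists fh, (forall t, dr fh t (f t)) /\ (forall t, `|fh t| <= 1))
  /\ (exists df, (forall t, dr f t (df t)) /\ (forall t, `|df t| <= 1))
  /\ (forall t, `|f t| <= 1).

Lemma osc_sin : osc (@sin R).
Proof.
split; [exists (fun s => - cos s)|split; [exists (@cos R)|exact: abs_sin_le1]]; split=> t.
- by apply: dr_eq; [apply: drN; exact: dr_cos|rewrite opprK].
- by rewrite normrN abs_cos_le1.
- exact: dr_sin.
- exact: abs_cos_le1.
Qed.

Lemma osc_cos : osc (@cos R).
Proof.
split; [exists (@sin R)|split; [exists (fun s => - sin s)|exact: abs_cos_le1]]; split=> t.
- exact: dr_sin.
- exact: abs_sin_le1.
- exact: dr_cos.
- by rewrite normrN abs_sin_le1.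
Qed.

Lemma osc_shift f c : osc f -> osc (fun y => f (c + y)).
Proof.
have dl t : dr (fun s => c + s) t 1.
  by apply: dr_eq; [apply: drD; [exact: dr_cst|exact: dr_id]|rewrite add0r].
move=> [[fh [h1 h2]] [[df [h3 h4]] h5]]; split; last split => //.
- exists (fun y => fh (c + y)); split=> t //.
  by apply: dr_eq; [apply: (dr_comp (dl t)); exact: h1|rewrite mulr1].
- exists (fun y => df (c + y)); split=> t //.
  by apply: dr_eq; [apply: (dr_comp (dl t)); exact: h3|rewrite mulr1].
Qed.

Lemma osc_lip f : osc f -> forall x y, `|f x - f y| <= `|x - y|.
Proof. by move=> [_ [[df [h3 h4]] _]]; exact: lipschitz1 h4. Qed.

Lemma osc_ct f : osc f -> forall t, ct f t.
Proof. by move=> [_ [[df [h3 h4]] _]] t; exact: ct_dr (h3 t). Qed.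

Variables (b : R) (hb : 1 < b).

(** The phase of a rescaled plane wave along one branch of the curve: p is 1 or -1 according to the
    branch, and q is v times [cp] or [cm]; p = 0 or q = 0 gives a limiting case. *)
Definition phi p q s := p * s + q * s `^ b.

Lemma dr_phi p q s : 0 < s -> dr (phi p q) s (p + q * (b * s `^ (b - 1))).
Proof.
move=> s0; apply: dr_eq.
  apply: drD; apply: drM; [exact: dr_cst|exact: dr_id|exact: dr_cst|exact: dr_powR].
by rewrite /=; ring.
Qed.

Lemma powB1 s : 0 < s -> s * s `^ (b - 1) = s `^ b.
Proof. by move=> s0; apply: mulr_powRB1; [exact: ltW|exact: lt_trans hb]. Qed.

(** First-derivative test. With W = s phi'(s) and [fh] a bounded primitive of f, the function N = a
    fh(phi) / W has derivative a f(phi)/s plus a remainder involving (1/W)' and a'/W. The majorant E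
    dominates 1/|W|, and -E' dominates |(1/W)'|, so the boundary terms E(A) + E(B) and the variation
    E(A) - E(B) add up to 2 E(A), while M accounts for a'. *)
Lemma osc_int f p q A B M (a da E dE : R -> R) : osc f -> 0 < A -> A <= B ->
  (forall s, 0 < s -> dr a s (da s)) ->
  (forall s, A <= s <= B -> dr E s (dE s)) -> 0 <= E B ->
  (forall s, A <= s <= B -> `|a s| <= 1) ->
  (forall s, A <= s <= B -> p * s + q * b * s `^ b != 0) ->
  (forall s, A <= s <= B -> `|(p * s + q * b * s `^ b)^-1| <= E s) ->
  (forall s, A <= s <= B ->
     `|(p + q * b * b * s `^ (b - 1)) / (p * s + q * b * s `^ b) ^+ 2| <= - dE s) ->
  (forall s, A <= s <= B -> `|(p * s + q * b * s `^ b)^-1 * da s| <= M) ->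
  `|itg A B (fun s => a s * f (phi p q s) / s)| <= 2 * E A + M * (B - A).
Proof.
move=> of_ A0 AB dra drE EB a1 W0 GE dGE GM.
pose W s := p * s + q * b * s `^ b.
have sp s : A <= s <= B -> 0 < s by move=> /andP[s1 _]; exact: lt_le_trans s1.
have [[fh [h1 h2]] _] := of_.
have cint t : 0 < t -> ct (fun s => a s * f (phi p q s) / s) t.
  move=> t0; apply: ctM; last by apply: ctV; [rewrite gt_eqF|exact: ct_id].
  apply: ctM; first exact: ct_dr (dra t t0).
  by apply: ct_comp; [exact: ct_dr (dr_phi p q t0)|exact: osc_ct].
have [K dK] := @antideriv_pos A B _ A0 cint.
rewrite (@itg_FTC _ A B _ K AB) //; last by move=> t ht; apply: cint; exact: sp.
pose N s := (W s)^-1 * a s * fh (phi p q s).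
have drW s : 0 < s -> dr W s (p + q * b * b * s `^ (b - 1)).
  move=> s0; apply: dr_eq.
    apply: drD; apply: drM; [exact: dr_cst|exact: dr_id|exact: dr_cst|exact: dr_powR].
  by rewrite /=; ring.
have H : `|(K B - N B) - (K A - N A)| <= (M * B - E B) - (M * A - E A).
  apply: (@dr_abs_le A B (fun s => K s - N s) (fun s => M * s - E s)
     (fun s => ((p + q * b * b * s `^ (b - 1)) / W s ^+ 2 * a s - (W s)^-1 * da s)
        * fh (phi p q s)) (fun s => M - dE s)) => // s hs.
  - have s0 := sp _ hs.
    apply: dr_eq.
      apply: drD; first exact: dK.
      apply: drN; apply: drM; last by apply: dr_comp; [exact: dr_phi|exact: h1].
      by apply: drM; [apply: drV; [exact: drW|exact: W0]|exact: dra].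
    have := W0 _ hs; rewrite -/(W s) => W0s.
    have -> : p + q * (b * s `^ (b - 1)) = W s / s.
      by rewrite /W -powB1//; field; rewrite gt_eqF.
    by rewrite /=; field; rewrite W0s gt_eqF.
  - apply: dr_eq; first by apply: drD; [apply: drM; [exact: dr_cst|exact: dr_id]|
      apply: drN; exact: drE].
    by rewrite /=; ring.
  - rewrite normrM; apply: le_trans (_ : _ * 1 <= _); first exact: ler_wpM2l.
    rewrite mulr1; apply: le_trans (ler_normB _ _) _.
    rewrite addrC lerD//; first exact: GM.
    rewrite normrM; apply: le_trans (dGE _ hs).
    by rewrite ler_piMr// a1.
have HN s : A <= s <= B -> `|N s| <= E s.
  move=> hs; rewrite /N normrM.
  apply: le_trans (_ : _ * 1 <= _); first exact: ler_wpM2l.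
  rewrite mulr1 normrM; apply: le_trans (GE _ hs).
  by rewrite ler_piMr// a1.
have NA := HN A; have NB := HN B.
move: NA NB; rewrite !lexx AB => /(_ isT) NA /(_ isT) NB.
move: H NA NB; rewrite !ler_norml; lra.
Qed.
End Osc0.

(** * First-derivative estimates on two kinds of tails *)

Section Osc1.
Variable R : realType.
Variables (b : R) (hb : 1 < b).
Implicit Types (f g h F : R -> R) (a c s t x y p q A B : R).

Let b0 : 0 < b. Proof. exact: lt_trans hb. Qed.
Let b10 : 0 <= b - 1. Proof. by rewrite subr_ge0 ltW. Qed.

Lemma powR_monol r x y : 0 <= r -> 0 < x -> x <= y -> x `^ r <= y `^ r.
Proof.
by move=> r0 x0 xy; apply: ge0_ler_powR => //; rewrite nnegrE ltW// (lt_le_trans x0).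
Qed.

(** The curved part of the slope is at least twice the linear part, so half of it survives the
    cancellation. *)
Lemma phi_lower p q s : `|p| <= 1 -> 0 < s -> 2 <= `|q| * b * s `^ (b - 1) ->
  `|q| * b * s `^ b / 2 <= `|p * s + q * b * s `^ b|.
Proof.
move=> p1 s0 h; rewrite -(powB1 hb s0).
have -> : p * s + q * b * (s * s `^ (b - 1)) = s * (p + q * b * s `^ (b - 1)) by ring.
rewrite normrM [`|s|]gtr0_norm//.
have -> : `|q| * b * (s * s `^ (b - 1)) / 2 = s * (`|q| * b * s `^ (b - 1) / 2) by ring.
rewrite ler_pM2l//.
have h2 : `|q * b * s `^ (b - 1)| = `|q| * b * s `^ (b - 1).
  by rewrite !normrM [`|b|]gtr0_norm// [`|_ `^ _|]ger0_norm ?powR_ge0.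
have h3 : `|q * b * s `^ (b - 1)| - `|p| <= `|p + q * b * s `^ (b - 1)|.
  by rewrite [p + _]addrC; exact: lerB_normD.
by lra.
Qed.

Lemma tail_curved f p q A B M (a da : R -> R) : osc f -> `|p| <= 1 ->
  0 < A -> A <= B -> 2 <= `|q| * b * A `^ (b - 1) ->
  (forall s, 0 < s -> dr a s (da s)) ->
  (forall s, A <= s <= B -> `|a s| <= 1) ->
  (forall s, A <= s <= B -> `|(p * s + q * b * s `^ b)^-1 * da s| <= M) ->
  `|itg A B (fun s => a s * f (phi b p q s) / s)| <= 12 / (b * `|q| * A `^ b) + M * (B - A).
Proof.
move=> of_ p1 A0 AB hA dra a1 GM.
have q0 : 0 < `|q|.
  rewrite lt_neqAle normr_ge0 andbT; apply/negP => /eqP q0.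
  by move: hA; rewrite -q0 !mul0r; lra.
have sp s : A <= s <= B -> 0 < s by move=> /andP[s1 _]; exact: lt_le_trans s1.
have hs s : A <= s <= B -> 2 <= `|q| * b * s `^ (b - 1).
  move=> /andP[s1 _]; apply: le_trans hA _.
  by rewrite ler_wpM2l ?mulr_ge0 ?(ltW b0)//; apply: powR_monol.
have Wl s : A <= s <= B -> `|q| * b * s `^ b / 2 <= `|p * s + q * b * s `^ b|.
  by move=> h; apply: phi_lower => //; [exact: sp|exact: hs].
have Wp s : A <= s <= B -> 0 < `|q| * b * s `^ b / 2.
  by move=> h; rewrite divr_gt0// !mulr_gt0// powR_gt0// sp.
(* Here |W'| is at most (3/2) |q| b^2 s^(b-1) and |W| at least |q| b s^b / 2, so |W'|/W^2 is at most
   6 / (|q| s^(b+1)), which is the opposite of the derivative of k s^(-b). *)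
pose k := 6 / (b * `|q|).
have k0 : 0 < k by rewrite divr_gt0// mulr_gt0.
have EE s : A <= s <= B -> 0 <= k * s `^ (- b).
  by move=> h; rewrite mulr_ge0 ?powR_ge0 ?(ltW k0).
have := @osc_int R b hb f p q A B M a da (fun s => k * s `^ (- b))
  (fun s => - (6 / `|q| * s `^ (- b - 1))) of_ A0 AB dra.
have -> : 2 * (k * A `^ (- b)) = 12 / (b * `|q| * A `^ b).
  rewrite powRN /k; field.
  by rewrite !gt_eqF// powR_gt0.
apply.
- move=> s h; apply: dr_eq; first by apply: drM; [exact: dr_cst|exact: dr_powR (sp _ h)].
  rewrite /= /k; field; by rewrite !gt_eqF.
- by apply: EE; rewrite AB lexx.
- exact: a1.
- by move=> s h; rewrite -normr_gt0; apply: lt_le_trans (Wl _ h); exact: Wp.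
- move=> s h; rewrite normfV.
  apply: le_trans (_ : (`|q| * b * s `^ b / 2)^-1 <= _).
    by rewrite lef_pV2 ?posrE ?Wl ?Wp// (lt_le_trans (Wp _ h))// Wl.
  rewrite /k powRN.
  have -> : (`|q| * b * s `^ b / 2)^-1 = 2 / (b * `|q|) * (s `^ b)^-1.
    by field; rewrite !gt_eqF// powR_gt0// sp.
  by rewrite ler_wpM2r ?invr_ge0 ?powR_ge0// ler_pM2r ?invr_gt0 ?mulr_gt0//; lra.
- move=> s h; rewrite opprK normrM normfV normrX.
  have s0 := sp _ h; have sb : 0 < s `^ b by rewrite powR_gt0.
  have sb1 : 0 < s `^ (b - 1) by rewrite powR_gt0.
  apply: le_trans (_ : (3 / 2 * `|q| * b * b * s `^ (b - 1))
      / (`|q| * b * s `^ b / 2) ^+ 2 <= _).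
    apply: ler_pM; rewrite ?invr_ge0 ?sqr_ge0//.
    + apply: le_trans (ler_normD _ _) _.
      rewrite !normrM [`|b|]gtr0_norm// [`|_ `^ _|]ger0_norm ?powR_ge0//.
      have := hs _ h.
      have : `|q| * b * s `^ (b - 1) <= `|q| * b * b * s `^ (b - 1).
        by rewrite ler_pM2r// -[leLHS]mulr1 ler_pM2l ?mulr_gt0// ltW.
      by lra.
    + rewrite lef_pV2 ?posrE ?exprn_gt0 ?Wp//; last first.
        by apply: lt_le_trans (Wl _ h); exact: Wp.
      by rewrite lerXn2r ?nnegrE ?normr_ge0 ?Wl// ltW// Wp.
  have -> : - b - 1 = - (b + 1) by ring.
  rewrite powRN (@powRD _ s b 1); last by rewrite (gt_eqF s0) implybT.
  rewrite powRr1 ?(ltW s0)// -(powB1 hb s0).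
  rewrite [leLHS](_ : _ = 6 / `|q| / (s * s `^ (b - 1) * s)) //.
  by field; rewrite !gt_eqF.
- exact: GM.
Qed.

(** The bound is uniform in q. With r = phi'(s) one has W = s r and W' = b r - (b - 1) p, so
    |W'|/W^2 is at most (b/eta + (b - 1)/eta^2)/s^2, hence at most 2b/(eta s)^2. *)
Lemma tail_flat0 f p q A B eta : osc f -> `|p| = 1 -> 0 < eta <= 1 ->
  0 < A -> A <= B ->
  (forall s, A <= s <= B -> eta <= `|p + q * b * s `^ (b - 1)|) ->
  `|itg A B (fun s => f (phi b p q s) / s)| <= 4 * b / (eta ^+ 2 * A).
Proof.
move=> of_ p1 /andP[e0 e1] A0 AB hr.
have sp s : A <= s <= B -> 0 < s by move=> /andP[s1 _]; exact: lt_le_trans s1.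
pose k := 2 * b / eta ^+ 2.
have k0 : 0 < k by rewrite divr_gt0 ?mulr_gt0// exprn_gt0.
have WE s : 0 < s -> p * s + q * b * s `^ b = s * (p + q * b * s `^ (b - 1)).
  by move=> s0; rewrite -(powB1 hb s0); ring.
have := @osc_int R b hb f p q A B 0 (fun=> 1) (fun=> 0) (fun s => k / s)
  (fun s => - (k / s ^+ 2)) of_ A0 AB.
have -> : 2 * (k / A) + 0 * (B - A) = 4 * b / (eta ^+ 2 * A).
  by rewrite /k; field; rewrite !gt_eqF.
rewrite (@itg_ext _ A B _ (fun s => f (phi b p q s) / s)); last by move=> t _; rewrite mul1r.
apply.
- by move=> s _; exact: dr_cst.
- move=> s h; apply: dr_eq.
    by apply: drM; [exact: dr_cst|apply: drV; [exact: dr_id|rewrite gt_eqF// sp]].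
  by rewrite /=; field; rewrite gt_eqF// sp.
- by rewrite divr_ge0 ?ltW//; apply: lt_le_trans AB.
- by move=> s _; rewrite normr1.
- move=> s h; rewrite WE ?sp// mulf_neq0 ?(gt_eqF (sp _ h))//.
  by rewrite -normr_gt0; apply: lt_le_trans (hr _ h).
- move=> s h; have s0 := sp _ h; rewrite WE// normfV normrM [`|s|]gtr0_norm// invfM mulrC.
  rewrite ler_pM2r ?invr_gt0//.
  apply: le_trans (_ : eta^-1 <= _).
    by rewrite lef_pV2 ?posrE ?hr// (lt_le_trans e0)// hr.
  rewrite /k ler_pdivlMr ?exprn_gt0// expr2 mulKf ?gt_eqF//.
  by move: hb e1 => h1 h2; lra.
- move=> s h; have s0 := sp _ h; rewrite opprK WE//.
  set rho := p + _ in hr *.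
  have hrs : eta <= `|p + q * b * s `^ (b - 1)| := hr _ h.
  set rs := p + q * b * s `^ (b - 1) in hrs *.
  have -> : p + q * b * b * s `^ (b - 1) = b * rs - (b - 1) * p by rewrite /rs; ring.
  have rp : 0 < `|rs| := lt_le_trans e0 hrs.
  rewrite normrM normfV normrX normrM exprMn [`|s|]gtr0_norm// invfM mulrA mulrAC.
  rewrite ler_pM2r ?invr_gt0 ?exprn_gt0//.
  rewrite ler_pdivrMr ?exprn_gt0//.
  apply: le_trans (ler_normB _ _) _.
  rewrite !normrM p1 mulr1 [`|b|]gtr0_norm// [`|b - 1|]ger0_norm//.
  rewrite /k mulrAC ler_pdivlMr ?exprn_gt0//.
  set z := `|rs| in hrs rp *.
  have : eta * eta * z <= z * z.
    by rewrite ler_pM2r//; apply: le_trans hrs; rewrite ger_pMr.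
  have : eta * eta <= z * z by rewrite ler_pM// ltW.
  rewrite !expr2 => h1 h2.
  have h3 : b * (eta * eta * z) <= b * (z * z) by rewrite ler_pM2l.
  have h4 : (b - 1) * (eta * eta) <= (b - 1) * (z * z) by rewrite ler_wpM2l.
  have : 0 <= z * z by rewrite mulr_ge0// ltW.
  nra.
- by move=> s h; rewrite mulr0 normr0.
Qed.
End Osc1.

(** * Tail bounds uniform in the coefficient of the curved term *)

Section Osc2.
Variable R : realType.
Variables (b : R) (hb : 1 < b).
Implicit Types (f g h F : R -> R) (a c s t x y p q A B d : R).

Let b0 : 0 < b. Proof. exact: lt_trans hb. Qed.
Let b10 : 0 < b - 1. Proof. by rewrite subr_gt0. Qed.

Lemma itg_point A f : itg A A f = 0.
Proof. by rewrite /itg set_itv1 Rintegral_set1. Qed.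

Lemma ct_osc_phi f p q t : osc f -> 0 < t -> ct (fun s => f (phi b p q s) / s) t.
Proof.
move=> of_ t0; apply: ctM; last by apply: ctV; [rewrite gt_eqF|exact: ct_id].
by apply: ct_comp; [apply: ct_dr; exact: dr_phi|exact: osc_ct].
Qed.

Lemma cts_osc_phi f p q A B : osc f -> 0 < A -> cts A B (fun s => f (phi b p q s) / s).
Proof. by move=> of_ A0 t /andP[h _]; apply: ct_osc_phi => //; exact: lt_le_trans h. Qed.

Lemma itg_inv A B : 0 < A -> A <= B -> itg A B (fun s => s^-1) = ln B - ln A.
Proof.
move=> A0 AB; apply: itg_FTC => // t /andP[h _]; have t0 := lt_le_trans A0 h.
  by apply: ctV; [rewrite gt_eqF|exact: ct_id].
exact: dr_ln.
Qed.

Lemma osc_le_inv f p q A B : osc f -> 0 < A -> A <= B ->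
  `|itg A B (fun s => f (phi b p q s) / s)| <= ln B - ln A.
Proof.
move=> of_ A0 AB; rewrite -itg_inv//.
apply: itg_abs; first exact: cts_osc_phi.
  move=> t /andP[h _]; apply: ctV; last exact: ct_id.
  by rewrite gt_eqF// (lt_le_trans A0).
move=> t /andP[h _]; have t0 := lt_le_trans A0 h.
rewrite normrM normfV [`|t|]gtr0_norm// ler_piMl// ?invr_ge0 ?(ltW t0)//.
by have [_ [_ ->]] := of_.
Qed.

Lemma itg_split_abs f A B c d : A <= c <= B -> cts A B f ->
  `|itg A c f| <= d -> forall d', `|itg c B f| <= d' -> `|itg A B f| <= d + d'.
Proof.
move=> hc cf h1 d' h2; rewrite (itg_split hc cf).
by apply: le_trans (ler_normD _ _) _; exact: lerD.
Qed.

Lemma ln_ratio eta : 0 < eta <= 1 / 2 -> ln (1 + eta) - ln (1 - eta) <= 3 * eta :> R.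
Proof.
move=> /andP[e0 e1].
have h1 : ln (1 + eta) <= eta by apply: le_ln1Dx; lra.
have h2 : - ln (1 - eta) <= 2 * eta.
  rewrite -lnV ?posrE; last by lra.
  have -> : (1 - eta)^-1 = 1 + eta / (1 - eta) by field; lra.
  apply: le_trans (le_ln1Dx _) _.
    by apply: lt_le_trans (divr_ge0 _ _); lra.
  rewrite ler_pdivrMr; last by lra.
  nra.
lra.
Qed.

(** T is independent of q, although for p q < 0 the phase has a stationary point that may lie
    anywhere. Where |q| b s^(b-1) is within eta of 1 the integrand is bounded by 1/s, and this
    interval has logarithmic length at most 3 eta/(b - 1); on both sides of it the slope is at least
    eta and [tail_flat0] applies. *)
Lemma tail_flat d : 0 < d -> exists2 T : R, 0 < T & forall f p q A B, osc f ->
  `|p| = 1 -> T <= A -> A <= B -> `|itg A B (fun s => f (phi b p q s) / s)| <= d.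
Proof.
move=> d0.
pose eta := Num.min (1 / 2) (d * (b - 1) / 12).
have e0 : 0 < eta by rewrite lt_min; apply/andP; split; [lra|rewrite divr_gt0// mulr_gt0].
have e1 : eta <= 1 / 2 by rewrite ge_min lexx.
have e2 : eta <= d * (b - 1) / 12 by rewrite ge_min lexx orbT.
move: eta e0 e1 e2 => eta e0 e1 e2.
pose T := 12 * b / (eta ^+ 2 * d).
have T0 : 0 < T by rewrite divr_gt0 ?mulr_gt0// exprn_gt0.
exists T => // f p q A B of_ p1 TA AB.
have A0 := lt_le_trans T0 TA.
have TE A' : A <= A' -> 4 * b / (eta ^+ 2 * A') <= d / 3.
  move=> AA; apply: le_trans (_ : 4 * b / (eta ^+ 2 * T) <= _).
    rewrite ler_pM2l ?mulr_gt0// lef_pV2 ?posrE ?mulr_gt0 ?invr_gt0 ?mulr_gt0 ?exprn_gt0//.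
      by rewrite ler_pM2l ?exprn_gt0//; apply: le_trans AA.
    by apply: lt_le_trans AA.
  by rewrite /T le_eqVlt; apply/orP; left; apply/eqP; field; rewrite !gt_eqF.
have e01 : 0 < eta <= 1 by rewrite e0/=; lra.
have P A' B' : A <= A' -> A' <= B' ->
   (A' < B' -> forall s, A' <= s <= B' -> eta <= `|p + q * b * s `^ (b - 1)|) ->
   `|itg A' B' (fun s => f (phi b p q s) / s)| <= d / 3.
  move=> AA; rewrite le_eqVlt => /orP[/eqP <- _|AB' h].
    by rewrite itg_point normr0 divr_ge0 ?ltW.
  apply: le_trans (TE _ AA).
  by apply: tail_flat0 => //; [exact: lt_le_trans AA|exact: ltW|exact: h].
have d3 : d / 3 <= d by rewrite ler_pdivrMr//; lra.
have sb s : 0 < s -> 0 < b * s `^ (b - 1) by move=> s0; rewrite mulr_gt0// powR_gt0.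
have sp s : A <= s <= B -> 0 < s by move=> /andP[s1 _]; exact: lt_le_trans s1.
have [pq|pq] := leP 0 (p * q).
  apply: le_trans d3; apply: P => // _ s hs.
  have s0 := sb _ (sp _ hs).
  have pp : p * p = 1 by rewrite -expr2 -real_normK ?num_real// p1 expr1n.
  have -> : p + q * b * s `^ (b - 1) = p * (1 + p * q * (b * s `^ (b - 1))).
    by rewrite mulrDr mulr1 !mulrA pp mul1r.
  rewrite normrM p1 mul1r; apply: le_trans (ler_norm _).
  have : 0 <= p * q * (b * s `^ (b - 1)) by rewrite mulr_ge0// ltW.
  by move: e1; lra.
have qpE : p * q = - `|q|.
  by have := ltr0_norm pq; rewrite normrM p1 mul1r => ->; rewrite opprK.
have q0 : 0 < `|q| by rewrite -oppr_lt0 -qpE.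
have rE s : `|p + q * b * s `^ (b - 1)| = `|1 - `|q| * b * s `^ (b - 1)|.
  have pp : p * p = 1 by rewrite -expr2 -real_normK ?num_real// p1 expr1n.
  have -> : p + q * b * s `^ (b - 1) = p * (1 + p * q * (b * s `^ (b - 1))).
    by rewrite mulrDr mulr1 !mulrA pp mul1r.
  by rewrite normrM p1 mul1r qpE mulNr mulrA.
have qb : 0 < `|q| * b by rewrite mulr_gt0.
(* [S z] is the point where |q| b s^(b-1) equals z; the resonant interval runs from [S (1 - eta)] to
   [S (1 + eta)]. *)
pose S z := (z / (`|q| * b)) `^ (b - 1)^-1.
have SE z : 0 < z -> 0 < S z /\ `|q| * b * S z `^ (b - 1) = z.
  move=> z0; split; first by rewrite powR_gt0// divr_gt0.
  rewrite /S -powRrM mulVf ?gt_eqF// powRr1 ?divr_ge0 ?ltW//.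
  by rewrite mulrC divfK// gt_eqF.
have u1 : 0 < 1 - eta by move: e1; lra.
have u2 : 0 < 1 + eta by move: e0; lra.
have [s10 s1E] := SE _ u1.
have [s20 s2E] := SE _ u2.
set s1 := S _ in s10 s1E; set s2 := S _ in s20 s2E.
have lnS : ln s2 - ln s1 <= d / 3.
  have lS z : 0 < z -> ln (S z) = (ln z - ln (`|q| * b)) / (b - 1).
    by move=> z0; rewrite /S ln_powR ln_div ?posrE// mulrC.
  rewrite /s1 /s2 (lS _ u1) (lS _ u2).
  have -> : (ln (1 + eta) - ln (`|q| * b)) / (b - 1) - (ln (1 - eta) - ln (`|q| * b)) / (b - 1)
     = (ln (1 + eta) - ln (1 - eta)) / (b - 1) by ring.
  rewrite ler_pdivrMr//.
  have := @ln_ratio eta; rewrite e0 e1 => /(_ isT) h; apply: le_trans h _.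
  have : 3 * eta <= 3 * (d * (b - 1) / 12) by rewrite ler_pM2l.
  have : 0 < d * (b - 1) by rewrite mulr_gt0.
  by clear -hb b0 b10; lra.
have s12 : s1 <= s2.
  rewrite /s1 /s2 /S; apply: powR_monol; rewrite ?invr_ge0 ?(ltW b10)//.
    by rewrite divr_gt0//; lra.
  by rewrite ler_pM2r ?invr_gt0//; move: e0; clear -hb b0 b10; lra.
(* Clamping to [A, B] covers every position of the resonant interval; each of the three pieces may
   reduce to a point. *)
pose c1 := Num.min (Num.max A s1) B; pose c2 := Num.min (Num.max A s2) B.
have Ac1 : A <= c1 by rewrite le_min AB le_max lexx.
have c1B : c1 <= B by rewrite ge_min lexx orbT.
have c2B : c2 <= B by rewrite ge_min lexx orbT.
have c12 : c1 <= c2.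
  by rewrite le_min c1B andbT ge_min ge_max !le_max lexx s12 !orbT.
have c10 : 0 < c1 by apply: lt_le_trans Ac1.
have -> : d = d / 3 + (d / 3 + d / 3) by field.
have cf : cts A B (fun s => f (phi b p q s) / s) by exact: cts_osc_phi.
apply: (itg_split_abs (c := c1)) => //; first by rewrite Ac1.
  apply: P => // lt s /andP[sA sc].
  have c1s : c1 <= s1.
    by move: lt; rewrite lt_min lt_max ltxx /= => /andP[h _]; rewrite ge_min ge_max lexx (ltW h).
  have s0 : 0 < s by apply: lt_le_trans sA.
  rewrite rE; apply: le_trans (ler_norm _).
  have : `|q| * b * s `^ (b - 1) <= 1 - eta.
    by rewrite -s1E ler_pM2l//; apply: powR_monol; rewrite ?(ltW b10)// (le_trans sc).
  by clear -hb b0 b10; lra.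
apply: (itg_split_abs (c := c2)) => //; first by rewrite c12.
- by move=> t /andP[h1 h2]; apply: cf; rewrite h2 (le_trans Ac1).
- move: c12; rewrite le_eqVlt => /orP[/eqP <-|c12].
    by rewrite itg_point normr0 divr_ge0 ?ltW.
  apply: le_trans (osc_le_inv _ _ of_ c10 (ltW c12)) _; apply: le_trans lnS.
  have c2s : c2 <= s2.
    rewrite ge_min ge_max lexx andbT; apply/orP; left.
    have : A < c2 by apply: le_lt_trans c12.
    by rewrite lt_min lt_max ltxx /= => /andP[h _]; exact: ltW.
  have c1s : s1 <= c1.
    have : c1 < B by apply: lt_le_trans c2B.
    by rewrite gt_min ltxx orbF => h; rewrite le_min le_max lexx orbT /= (le_trans _ (ltW h))// le_max lexx orbT.
  by rewrite lerB// ler_ln ?posrE// (lt_le_trans c10)// ltW.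
- apply: P => //; first exact: le_trans c12.
  move=> lt s /andP[cs sB].
  have s2c : s2 <= c2.
    by move: lt; rewrite gt_min ltxx orbF => h; rewrite le_min le_max lexx orbT /= (le_trans _ (ltW h))// le_max lexx orbT.
  have : 1 + eta <= `|q| * b * s `^ (b - 1).
    by rewrite -s2E ler_pM2l//; apply: powR_monol; rewrite ?(ltW b10)// (le_trans s2c).
  by rewrite rE distrC => h; apply: le_trans (ler_norm _); move: h; clear -hb b0 b10; lra.
Qed.
End Osc2.

(** * Replacing the phase by its linear or its curved part *)

Section Osc3.
Variable R : realType.
Variables (b : R) (hb : 1 < b).
Implicit Types (f g h F : R -> R) (a c s t x y p q A B d e T : R).

Let b0 : 0 < b. Proof. exact: lt_trans hb. Qed.
Let b10 : 0 < b - 1. Proof. by rewrite subr_gt0. Qed.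

Definition oscint f p q e T := itg e T (fun s => f (phi b p q s) / s).

(** Below s0 the phases differ by at most m s, and since f is 1-Lipschitz the factor 1/s is
    absorbed: the difference is at most m s0. Beyond s0 both tails are at most d. The three
    contributions give 3 d, uniformly in the cutoffs. *)
Lemma cmp_phase f p q p' q' e T s0 m d : osc f -> 0 < e -> e <= T ->
  0 <= m -> m * s0 <= d -> 0 <= d ->
  (forall s, 0 < s <= s0 -> `|phi b p q s - phi b p' q' s| <= m * s) ->
  (forall A B, s0 <= A -> 0 < A -> A <= B -> `|oscint f p q A B| <= d) ->
  (forall A B, s0 <= A -> 0 < A -> A <= B -> `|oscint f p' q' A B| <= d) ->
  `|oscint f p q e T - oscint f p' q' e T| <= 3 * d.
Proof.
move=> of_ e0 eT m0 md d0 h1 h2 h3.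
pose c := Num.min (Num.max e s0) T.
have ec : e <= c by rewrite le_min eT le_max lexx.
have cT : c <= T by rewrite ge_min lexx orbT.
have c0 : 0 < c by apply: lt_le_trans ec.
have cf u v B : cts e B (fun s => f (phi b u v s) / s) by exact: cts_osc_phi.
rewrite /oscint (itg_split (c := c) _ (cf p q T)) ?ec// (itg_split (c := c) _ (cf p' q' T)) ?ec//.
have H1 : `|oscint f p q e c - oscint f p' q' e c| <= d.
  move: ec; rewrite le_eqVlt => /orP[/eqP <-|ec].
    by rewrite /oscint !itg_point subrr normr0.
  have cs : c <= s0.
    by move: ec; rewrite lt_min lt_max ltxx /= => /andP[h _]; rewrite ge_min ge_max lexx (ltW h).
  have s00 : 0 < s0 by apply: lt_le_trans cs.
  rewrite /oscint -itgB; try exact: cts_osc_phi.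
  apply: le_trans (_ : itg e c (fun=> m) <= _).
    apply: itg_abs; last first.
    - move=> s /andP[es sc]; have sp := lt_le_trans e0 es.
      rewrite -mulrBl normrM normfV [`|s|]gtr0_norm// ler_pdivrMr//.
      apply: le_trans (osc_lip of_ _ _) _; apply: h1.
      by rewrite sp (le_trans sc).
    - by move=> s _; exact: ct_cst.
    - move=> s hs; apply: ctD; first exact: (cf _ _ _ _ hs).
      by apply: ctN; exact: (cf _ _ _ _ hs).
  rewrite itg_cst ?(ltW ec)//; apply: le_trans md; rewrite ler_wpM2l//.
  by apply: le_trans cs; rewrite gerBl ltW.
have H2 : `|oscint f p q c T| <= d /\ `|oscint f p' q' c T| <= d.
  move: cT; rewrite le_eqVlt => /orP[/eqP <-|cT].
    by rewrite /oscint !itg_point normr0.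
  have sc : s0 <= c.
    move: cT; rewrite gt_min ltxx orbF => h; rewrite le_min le_max lexx orbT /=.
    by rewrite (le_trans _ (ltW h))// le_max lexx orbT.
  by split; [apply: h2|apply: h3] => //; exact: ltW.
move: H1 H2; rewrite /oscint => H1 [H2 H3].
set x1 := itg _ _ _ in H1 *; set x2 := itg _ _ _ in H2 *; set y1 := itg _ _ _ in H1 *.
set y2 := itg _ _ _ in H3 *.
have -> : x1 + x2 - (y1 + y2) = (x1 - y1) + (x2 - y2) by ring.
apply: le_trans (ler_normD _ _) _.
have := ler_normB x2 y2; move: H1 H2 H3; clear -hb b0 b10; lra.
Qed.

(** The switching point is the T of [tail_flat], which does not depend on q; below it |q| s^b is at
    most |q| T^(b-1) s, which small |q| makes negligible. *)
Lemma small_q d : 0 < d -> exists2 q0 : R, 0 < q0 & forall f p q e T, osc f ->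
  `|p| = 1 -> `|q| <= q0 -> 0 < e -> e <= T -> `|oscint f p q e T - oscint f p 0 e T| <= d.
Proof.
move=> d0; have d3 : 0 < d / 3 by rewrite divr_gt0.
have [T1 T10 H] := tail_flat hb d3.
have Tb : 0 < T1 `^ b by rewrite powR_gt0.
exists (d / 3 / T1 `^ b); first by rewrite divr_gt0.
move=> f p q e T of_ p1 hq e0 eT.
have -> : d = 3 * (d / 3) by field.
apply: (@cmp_phase f p q p 0 e T T1 (`|q| * T1 `^ (b - 1))) => //.
- by rewrite mulr_ge0// powR_ge0.
- by rewrite -mulrA [_ * T1]mulrC (powB1 hb)// -ler_pdivlMr.
- exact: ltW.
- move=> s /andP[s0 sT]; rewrite /phi mul0r addr0 addrAC subrr add0r normrM.
  rewrite [`|_ `^ _|]ger0_norm ?powR_ge0// -(powB1 hb s0) [s * _]mulrC mulrA.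
  by rewrite ler_wpM2r ?(ltW s0)// ler_wpM2l//; apply: powR_monol; rewrite ?(ltW b10).
- by move=> A B h1 _ h2; apply: H.
- by move=> A B h1 _ h2; apply: H.
Qed.

Lemma tail_bounded f p q A B : osc f -> `|p| <= 1 -> 0 < A -> A <= B ->
  2 <= `|q| * b * A `^ (b - 1) -> `|oscint f p q A B| <= 12 / (b * `|q| * A `^ b).
Proof.
move=> of_ p1 A0 AB h.
have := @tail_curved R b hb f p q A B 0 (fun=> 1) (fun=> 0) of_ p1 A0 AB h.
rewrite mul0r addr0 (@itg_ext _ A B _ (fun s => f (phi b p q s) / s)); last by move=> t _; rewrite mul1r.
apply.
- by move=> s _; exact: dr_cst.
- by move=> s _; rewrite normr1.
- by move=> s _; rewrite mulr0 normr0.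
Qed.

(** The dropped term is p s, so the switching point s0 must be at most d/3. It is defined by |q|
    s0^b = L: for large |q| it is small, while L is large enough for the tail bound 12/(b L). *)
Lemma large_q d : 0 < d -> exists2 q1 : R, 0 < q1 & forall f p q e T, osc f ->
  `|p| = 1 -> q1 <= `|q| -> 0 < e -> e <= T -> `|oscint f p q e T - oscint f 0 q e T| <= d.
Proof.
move=> d0; have d3 : 0 < d / 3 by rewrite divr_gt0.
pose L := 12 / b / (d / 3) + 1.
have L0 : 0 < L by rewrite ltr_wpDl// !divr_ge0// ltW.
have bn : 0 < b^-1 by rewrite invr_gt0.
(* The first entry gives s0 <= d/3, the second that the curved part dominates from s0 on, as
   [tail_bounded] requires. *)
pose q1 := Num.max (L * (d / 3) `^ (- b)) ((2 / (b * L `^ ((b - 1) / b))) `^ b).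
exists q1.
  by rewrite lt_max mulr_gt0// powR_gt0.
move=> f p q e T of_ p1 hq e0 eT.
have q10 : 0 < q1 by rewrite lt_max mulr_gt0// powR_gt0.
have q0 : 0 < `|q| by exact: lt_le_trans hq.
pose s0 := (L / `|q|) `^ b^-1.
have Lq : 0 < L / `|q| by rewrite divr_gt0.
have s00 : 0 < s0 by rewrite powR_gt0.
have s0b : s0 `^ b = L / `|q| by rewrite /s0 -powRrM mulVf ?gt_eqF// powRr1// ltW.
have s0d : s0 <= d / 3.
  have h : L * (d / 3) `^ (- b) <= `|q| by apply: le_trans hq; rewrite le_max lexx.
  have h' : L / `|q| <= (d / 3) `^ b.
    rewrite ler_pdivrMr// mulrC -ler_pdivrMr ?powR_gt0//.
    by move: h; rewrite powRN.
  have : s0 <= ((d / 3) `^ b) `^ b^-1.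
    by rewrite /s0; apply: powR_monol => //; exact: ltW.
  by rewrite -powRrM mulfV ?gt_eqF// powRr1// ltW.
have s02 : 2 <= `|q| * b * s0 `^ (b - 1).
  have h : (2 / (b * L `^ ((b - 1) / b))) `^ b <= `|q| by apply: le_trans hq; rewrite le_max lexx orbT.
  have Lp : 0 < L `^ ((b - 1) / b) by rewrite powR_gt0.
  have E : `|q| * b * s0 `^ (b - 1) = (b * L `^ ((b - 1) / b)) * `|q| `^ b^-1.
    rewrite -[`|q| * b * _]mulrA [in LHS]mulrCA -mulrA; congr (_ * _).
    have -> : s0 `^ (b - 1) = L `^ ((b - 1) / b) * (`|q| `^ ((b - 1) / b))^-1.
      rewrite /s0 -powRrM [b^-1 * _]mulrC powRM ?invr_ge0 ?(ltW L0) ?(ltW q0)//.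
      by rewrite -powRN -[`|q|^-1]powR_inv1 ?(ltW q0)// -powRrM mulN1r.
    rewrite mulrCA; congr (_ * _).
    have Eq : `|q| = `|q| `^ b^-1 * `|q| `^ ((b - 1) / b).
      rewrite -powRD ?(gt_eqF q0) ?implybT//.
      have -> : b^-1 + (b - 1) / b = 1 by field; rewrite gt_eqF.
      by rewrite powRr1// ltW.
    by rewrite {1}Eq mulfK// gt_eqF// powR_gt0.
  rewrite E mulrC -ler_pdivrMr ?mulr_gt0//.
  have : ((2 / (b * L `^ ((b - 1) / b))) `^ b) `^ b^-1 <= `|q| `^ b^-1.
    by apply: powR_monol; [exact: ltW|rewrite powR_gt0// divr_gt0// mulr_gt0|exact: h].
  by rewrite -powRrM mulfV ?gt_eqF// powRr1// divr_ge0// mulr_ge0// ltW.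
have tail pp A B : `|pp| <= 1 -> s0 <= A -> 0 < A -> A <= B -> `|oscint f pp q A B| <= d / 3.
  move=> hp sA A0 AB; apply: le_trans (tail_bounded of_ hp A0 AB _) _.
    by apply: le_trans s02 _; rewrite ler_pM2l ?mulr_gt0//; apply: powR_monol; rewrite ?(ltW b10).
  have h : L <= `|q| * A `^ b.
    rewrite mulrC -ler_pdivrMr// -s0b; apply: powR_monol => //; exact: ltW.
  rewrite ler_pdivrMr ?mulr_gt0 ?powR_gt0//.
  have : 12 / b / (d / 3) <= `|q| * A `^ b by apply: le_trans h; rewrite /L lerDl.
  by rewrite ler_pdivrMr// ler_pdivrMr// => h2; apply: le_trans h2 _; rewrite le_eqVlt; apply/orP; left; apply/eqP; ring.
have -> : d = 3 * (d / 3) by field.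
apply: (@cmp_phase f p q 0 q e T s0 1) => //.
- by rewrite mul1r.
- exact: ltW.
- move=> s /andP[sp _]; rewrite /phi mul0r add0r addrK normrM p1 mul1r gtr0_norm//.
  by rewrite mul1r.
- by move=> A B; apply: tail; rewrite p1.
- by move=> A B; apply: tail; rewrite normr0.
Qed.
End Osc3.

(** * Sine and cosine integrals *)

Section Values.
Variable R : realType.
Variables (b : R) (hb : 1 < b).
Implicit Types (f g h F : R -> R) (a c s t x y p q A B d e T : R).

Let b0 : 0 < b. Proof. exact: lt_trans hb. Qed.
Let b10 : 0 < b - 1. Proof. by rewrite subr_gt0. Qed.

Lemma itg_opp A B f : cts A B f -> itg A B (fun s => - f s) = - itg A B f.
Proof.
move=> cf; rewrite -[RHS]mulN1r -itgZ//; apply: itg_ext => t _; by rewrite mulN1r.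
Qed.

(** The substitution y = q s^b gives dy/y = b ds/s; this is the origin of the factor 1/b in the
    limit for large v. *)
Lemma itg_pow q e T (k : R -> R) : 0 < q -> 0 < e -> e <= T -> (forall t, ct k t) ->
  itg e T (fun s => k (q * s `^ b) / s) =
  b^-1 * itg (q * e `^ b) (q * T `^ b) (fun y => k y / y).
Proof.
move=> q0 e0 eT ck.
have qe s : 0 < s -> 0 < q * s `^ b by move=> s0; rewrite mulr_gt0// powR_gt0.
have mono x y : 0 < x -> x <= y -> q * x `^ b <= q * y `^ b.
  by move=> x0 xy; rewrite ler_pM2l//; apply: powR_monol => //; exact: ltW.
have ckk t : 0 < t -> ct (fun y => k y / y) t.
  move=> t0; apply: ctM; first exact: ck.
  by apply: ctV; [rewrite gt_eqF|exact: ct_id].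
have [F HF] := antideriv_pos (q * T `^ b) (qe _ e0) ckk.
rewrite [in RHS](@itg_FTC _ _ _ _ F)//; last 2 first.
- exact: mono.
- by move=> t /andP[h _]; apply: ckk; apply: lt_le_trans h; exact: qe.
rewrite (@itg_FTC _ _ _ _ (fun s => b^-1 * F (q * s `^ b)))//.
- by rewrite mulrBr.
- move=> t /andP[h _]; have t0 := lt_le_trans e0 h; apply: ctM.
    apply: ct_comp; last exact: ck.
    by apply: ct_dr; apply: drM; [exact: dr_cst|exact: dr_powR].
  by apply: ctV; [rewrite gt_eqF|exact: ct_id].
- move=> t /andP[h h']; have t0 := lt_le_trans e0 h; apply: dr_eq.
    apply: drM; first exact: dr_cst.
    apply: dr_comp; last by apply: HF; rewrite !mono.
    by apply: drM; [exact: dr_cst|exact: dr_powR].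
  have tb : t `^ (b - 1) != 0 by rewrite gt_eqF// powR_gt0.
  by rewrite /= -(powB1 hb t0); field; rewrite tb !gt_eqF.
Qed.

Definition sinint e T := itg e T (fun s => sin s / s).
Definition cosint e T := itg e T (fun s => cos s / s).

Lemma cts_sinc A B : 0 < A -> cts A B (fun s => sin s / s).
Proof.
move=> A0 t /andP[h _]; apply: ctM; first exact: ct_dr (dr_sin t).
by apply: ctV; [rewrite gt_eqF// (lt_le_trans A0)|exact: ct_id].
Qed.

Lemma cts_cosc A B : 0 < A -> cts A B (fun s => cos s / s).
Proof.
move=> A0 t /andP[h _]; apply: ctM; first exact: ct_dr (dr_cos t).
by apply: ctV; [rewrite gt_eqF// (lt_le_trans A0)|exact: ct_id].
Qed.

Lemma oscint_sin1 e T : oscint b (@sin R) 1 0 e T = sinint e T.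
Proof. by apply: itg_ext => t _; rewrite /phi mul1r mul0r addr0. Qed.

Lemma oscint_sinN1 e T : 0 < e -> oscint b (@sin R) (-1) 0 e T = - sinint e T.
Proof.
move=> e0; rewrite /sinint -itg_opp; last exact: cts_sinc.
by apply: itg_ext => t _; rewrite /phi mulN1r mul0r addr0 sinN mulNr.
Qed.

Lemma oscint_cos1 e T : oscint b (@cos R) 1 0 e T = cosint e T.
Proof. by apply: itg_ext => t _; rewrite /phi mul1r mul0r addr0. Qed.

Lemma oscint_cosN1 e T : oscint b (@cos R) (-1) 0 e T = cosint e T.
Proof. by apply: itg_ext => t _; rewrite /phi mulN1r mul0r addr0 cosN. Qed.

Lemma oscint_sin0 q e T : q != 0 -> 0 < e -> e <= T ->
  oscint b (@sin R) 0 q e T = Num.sg q * b^-1 * sinint (`|q| * e `^ b) (`|q| * T `^ b).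
Proof.
move=> q0 e0 eT; have qp : 0 < `|q| by rewrite normr_gt0.
rewrite -mulrA -(@itg_pow `|q| e T sin)//; last by move=> t; exact: ct_dr (dr_sin t).
rewrite -itgZ; last first.
  move=> t /andP[h _]; have t0 := lt_le_trans e0 h; apply: ctM.
    apply: ct_comp; last exact: ct_dr (dr_sin _).
    by apply: ct_dr; apply: drM; [exact: dr_cst|exact: dr_powR].
  by apply: ctV; [rewrite gt_eqF|exact: ct_id].
apply: itg_ext => t _; rewrite /phi mul0r add0r mulrA; congr (_ / _).
have -> : q * t `^ b = Num.sg q * (`|q| * t `^ b) by rewrite mulrA -numEsg.
case: sgrP q0 => //= _ _; first by rewrite !mul1r.
by rewrite !mulN1r sinN.
Qed.

Lemma oscint_cos0 q e T : q != 0 -> 0 < e -> e <= T ->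
  oscint b (@cos R) 0 q e T = b^-1 * cosint (`|q| * e `^ b) (`|q| * T `^ b).
Proof.
move=> q0 e0 eT; have qp : 0 < `|q| by rewrite normr_gt0.
rewrite -(@itg_pow `|q| e T cos)//; last by move=> t; exact: ct_dr (dr_cos t).
apply: itg_ext => t _; rewrite /phi mul0r add0r; congr (_ / _).
have -> : q * t `^ b = Num.sg q * (`|q| * t `^ b) by rewrite mulrA -numEsg.
case: sgrP q0 => //= _ _; first by rewrite !mul1r.
by rewrite !mulN1r cosN.
Qed.

Lemma sin_abs_le s : `|sin s| <= `|s| :> R.
Proof. by have := osc_lip (@osc_sin R) s 0; rewrite sin0 !subr0. Qed.

Lemma sinint_cauchy d : 0 < d -> exists e1 T1 : R, [/\ 0 < e1, e1 <= 1, 1 <= T1 &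
  forall e T, 0 < e -> e <= e1 -> T1 <= T -> `|sinint e T - sinint e1 T1| <= d].
Proof.
move=> d0; have d2 : 0 < d / 2 by rewrite divr_gt0.
have [T0 T00 HT] := tail_flat hb d2.
pose T1 := Num.max 1 T0; pose e1 := Num.min 1 (d / 2).
have e10 : 0 < e1 by rewrite lt_min ltr01 d2.
have e11 : e1 <= 1 by rewrite ge_min lexx.
have T11 : 1 <= T1 by rewrite le_max lexx.
exists e1, T1; split => // e T e0 ee TT.
have eT1 : e1 <= T1 by apply: le_trans T11.
rewrite {1}/sinint (@itg_split _ e T e1)//; last exact: cts_sinc.
2: by rewrite ee (le_trans eT1).
rewrite (@itg_split _ e1 T T1)//; last exact: cts_sinc.
2: by rewrite eT1.
rewrite -/(sinint e1 T1).
have -> : itg e e1 (fun s => sin s / s) + (sinint e1 T1 + itg T1 T (fun s => sin s / s)) - sinint e1 T1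
   = itg e e1 (fun s => sin s / s) + itg T1 T (fun s => sin s / s) by ring.
apply: le_trans (ler_normD _ _) _.
have -> : d = d / 2 + d / 2 by field.
apply: lerD.
  apply: le_trans (_ : itg e e1 (fun=> 1) <= _).
    apply: itg_abs; first exact: cts_sinc.
      by move=> s _; exact: ct_cst.
    move=> s /andP[h _]; have s0 := lt_le_trans e0 h.
    by rewrite normrM normfV ler_pdivrMr ?normr_gt0 ?gt_eqF// mul1r sin_abs_le.
  rewrite itg_cst// mul1r; apply: le_trans (_ : e1 <= _); first by rewrite gerBl ltW.
  by rewrite ge_min lexx orbT.
have := HT sin 1 0 T1 T (@osc_sin R) (normr1 _) _ TT.
rewrite (@itg_ext _ _ _ _ (fun s => sin s / s)); first by apply; rewrite le_max lexx orbT.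
by move=> t _; rewrite /phi mul1r mul0r addr0.
Qed.

(** Integration by parts with the primitive 1 - cos replaces sin s / s by (1 - cos s)/s^2, which is
    nonnegative. On [pi/2, pi] it is at least 1/pi^2 and contributes 1/(2 pi); the boundary term at
    e costs at most e, hence at most half of that. *)
Lemma sinint_lower e T : 0 < e -> e <= (4 * pi)^-1 -> pi <= T -> (4 * pi)^-1 <= sinint e T.
Proof.
move=> e0 e1 piT.
have pi0 : 0 < pi :> R := pi_gt0 R.
have pi2 : 2 <= pi :> R := pi_ge2 R.
have eh : e <= pi / 2.
  apply: le_trans e1 _; apply: le_trans (_ : 1 <= _); last by rewrite ler_pdivlMr// mul1r.
  by rewrite invf_le1 ?mulr_gt0//; move: pi2; lra.
have eT : e <= T.
  by apply: le_trans eh _; apply: le_trans piT; rewrite ler_pdivrMr//; move: pi0; lra.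
have cX t : 0 < t -> ct (fun s => sin s / s) t.
  by move=> t0; apply: (@cts_sinc t t) => //; rewrite lexx.
have [F HF] := antideriv_pos T e0 cX.
rewrite /sinint (@itg_FTC _ _ _ _ F)//; last exact: cts_sinc.
pose N s : R := (1 - cos s) / s.
pose D s := sin s / s - (sin s / s - (1 - cos s) / s ^+ 2).
have dFN s : e <= s <= T -> dr (fun s => F s - N s) s ((1 - cos s) / s ^+ 2).
  move=> hs; have s0 : 0 < s by move/andP: hs => [h _]; exact: lt_le_trans h.
  apply: dr_eq.
    apply: drD; first exact: HF.
    apply: drN; apply: drM.
      by apply: drD; [exact: dr_cst|apply: drN; exact: dr_cos].
    by apply: drV; [exact: dr_id|rewrite gt_eqF].
  by rewrite /=; field; rewrite gt_eqF.
have nn (s : R) : 0 <= (1 - cos s) / s ^+ 2.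
  by rewrite divr_ge0 ?sqr_ge0// subr_ge0 cos_le1.
have inc x y : e <= x -> x <= y -> y <= T -> F x - N x <= F y - N y.
  move=> ex xy yT; rewrite -subr_ge0.
  have := @dr_le R x y (fun=> 0) (fun s => F s - N s) (fun=> 0) (fun s => (1 - cos s) / s ^+ 2) xy.
  rewrite subrr; apply.
  - by move=> s _; exact: dr_cst.
  - by move=> s /andP[h1 h2]; apply: dFN; rewrite (le_trans ex)//= (le_trans h2).
  - by move=> s _; exact: nn.
have hp : pi / 2 <= pi :> R by rewrite ler_pdivrMr//; move: pi0; lra.
have mid : (2 * pi)^-1 <= (F pi - N pi) - (F (pi / 2) - N (pi / 2)).
  have := @dr_le R (pi / 2) pi (fun s => s / pi ^+ 2) (fun s => F s - N s)
    (fun=> 1 / pi ^+ 2) (fun s => (1 - cos s) / s ^+ 2) hp.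
  have -> : pi / pi ^+ 2 - pi / 2 / pi ^+ 2 = (2 * pi)^-1 :> R.
    by move: (pi : R) pi0 => P P0; field; rewrite gt_eqF.
  apply.
  - move=> s _; apply: dr_eq; first by apply: drM; [exact: dr_id|exact: dr_cst].
    by rewrite /=; ring.
  - by move=> s /andP[h1 h2]; apply: dFN; rewrite (le_trans eh)//= (le_trans h2).
  - move=> s /andP[h1 h2].
    have s0 : 0 < s by apply: lt_le_trans h1; rewrite divr_gt0.
    have cs : cos s <= 0.
      have -> : s = (s - pi / 2) + pi / 2 by ring.
      rewrite cosDpihalf oppr_le0; apply: sin_ge0_pi.
      by rewrite subr_ge0 h1 lerBlDr (le_trans h2)// lerDl divr_ge0// ltW.
    apply: ler_pM; rewrite ?invr_ge0 ?sqr_ge0//; first by move: cs; lra.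
    by rewrite lef_pV2 ?posrE ?exprn_gt0// lerXn2r ?nnegrE ?(ltW s0) ?(ltW pi0).
have i1 := inc _ _ (lexx e) eh (le_trans hp piT).
have i2 := inc _ _ (le_trans eh hp) piT (lexx T).
have NT : 0 <= N T.
  by rewrite divr_ge0 ?subr_ge0 ?cos_le1// (le_trans (ltW e0)).
have Ne : N e <= e.
  rewrite ler_pdivrMr// -expr2.
  have := @dr_le R 0 e (fun s => 1 - cos s) (fun s => s ^+ 2)
    (fun s => sin s) (fun s => 2 * s) (ltW e0).
  rewrite cos0 subrr expr0n /= !subr0; apply.
  - move=> s _; apply: dr_eq; first by apply: drD; [exact: dr_cst|apply: drN; exact: dr_cos].
    by rewrite /= add0r opprK.
  - move=> s _; apply: (@dr_near _ (fun s => s * s)); first by near=> z; rewrite expr2.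
    by apply: dr_eq; [apply: drM; exact: dr_id|rewrite /=; ring].
  - move=> s /andP[h _]; have := ler_norm (sin s); have := sin_abs_le s.
    by rewrite (ger0_norm h); move: h; lra.
have E : (2 * pi)^-1 = 2 * (4 * pi)^-1 :> R.
  by move: (pi : R) pi0 => P P0; field; rewrite gt_eqF.
rewrite E in mid.
set z := (4 * pi)^-1 in e1 mid *.
move: i1 i2 NT Ne mid e1; lra.
Unshelve. all: by end_near. Qed.

(** A Frullani integral. The integral of cos s / s diverges logarithmically at 0, but two rescaled
    copies differ by the integral of 1/s between al e and be e, up to small errors at both ends. *)
Lemma cosint_ratio al be d : 0 < al -> 0 < be -> 0 < d -> exists e1 T1 : R,
  [/\ 0 < e1, e1 <= 1, 1 <= T1 & forall e T, 0 < e -> e <= e1 -> T1 <= T ->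
   `|cosint (al * e) (al * T) - cosint (be * e) (be * T) - (ln be - ln al)| <= d].
Proof.
wlog ab : al be / al <= be => [W al0 be0 d0|al0 be0 d0].
  have [ab|ba] := leP al be; first exact: W.
  have [e1 [T1 [h1 h2 h3 h4]]] := W be al (ltW ba) be0 al0 d0.
  exists e1, T1; split => // e T e0 ee TT.
  have := h4 _ _ e0 ee TT; rewrite -normrN.
  by congr (`|_| <= _); ring.
have d2 : 0 < d / 2 by rewrite divr_gt0.
have [T0 T00 HT] := tail_flat hb d2.
pose T1 := Num.max 1 (T0 / al); pose e1 := Num.min 1 (d / 2 / be).
have e10 : 0 < e1 by rewrite lt_min ltr01 divr_gt0.
have e11 : e1 <= 1 by rewrite ge_min lexx.
have T11 : 1 <= T1 by rewrite le_max lexx.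
exists e1, T1; split => // e T e0 ee TT.
have eT : e <= T by apply: le_trans ee _; apply: le_trans e11 _; apply: le_trans T11 _.
have T0p : 0 < T by apply: lt_le_trans eT.
have ae0 : 0 < al * e by rewrite mulr_gt0.
have cY t : 0 < t -> ct (fun s => cos s / s) t.
  by move=> t0; apply: (@cts_cosc t t) => //; rewrite lexx.
have [F HF] := antideriv_pos (be * T) ae0 cY.
have aebe : al * e <= be * e by rewrite ler_pM2r.
have aTbT : al * T <= be * T by rewrite ler_pM2r.
have aeaT : al * e <= al * T by rewrite ler_pM2l.
have beT : be * e <= be * T by rewrite ler_pM2l.
have IF x y : al * e <= x -> x <= y -> y <= be * T -> cosint x y = F y - F x.
  move=> h1 h2 h3; apply: itg_FTC => //.
    by apply: cts_cosc; apply: lt_le_trans h1.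
  by move=> t /andP[h4 h5]; apply: HF; rewrite (le_trans h1)//= (le_trans h5).
rewrite (IF (al * e) (al * T))// (IF (be * e) (be * T))//.
have small : `|(F (be * e) - ln (be * e)) - (F (al * e) - ln (al * e))| <= be * e - al * e.
  apply: (@dr_abs_le R (al * e) (be * e) (fun s => F s - ln s) (fun s => s)
    (fun s => cos s / s - s^-1) (fun=> 1)) => // s /andP[h1 h2].
  - apply: drD; first by apply: HF; rewrite h1 (le_trans h2).
    by apply: drN; apply: dr_ln; apply: lt_le_trans h1.
  - exact: dr_id.
  - have s0 : 0 < s by apply: lt_le_trans h1.
    have -> : cos s / s - s^-1 = (cos s - cos 0) / s by rewrite cos0; field; rewrite gt_eqF.
    rewrite normrM normfV ler_pdivrMr ?normr_gt0 ?gt_eqF// mul1r.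
    by have := osc_lip (@osc_cos R) s 0; rewrite subr0.
have large : `|F (be * T) - F (al * T)| <= d / 2.
  rewrite -IF//.
  have aT0 : T0 <= al * T.
    rewrite mulrC -ler_pdivrMr//; apply: le_trans TT; by rewrite le_max lexx orbT.
  have := HT cos 1 0 _ _ (@osc_cos R) (normr1 _) aT0 aTbT.
  rewrite (@itg_ext _ _ _ _ (fun s => cos s / s))//.
  by move=> t _; rewrite /phi mul1r mul0r addr0.
have E : ln (be * e) - ln (al * e) = ln be - ln al.
  by rewrite !lnM ?posrE//; ring.
have sm : be * e - al * e <= d / 2.
  apply: le_trans (_ : be * e <= _); first by rewrite gerBl ltW.
  rewrite mulrC -ler_pdivlMr//; apply: le_trans ee _; by rewrite ge_min lexx orbT.
have -> : F (al * T) - F (al * e) - (F (be * T) - F (be * e)) - (ln be - ln al)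
  = (F (be * e) - ln (be * e) - (F (al * e) - ln (al * e))) - (F (be * T) - F (al * T)).
  by rewrite -E; ring.
apply: le_trans (ler_normB _ _) _.
have -> : d = d / 2 + d / 2 by field.
by apply: lerD => //; apply: le_trans sm.
Qed.
End Values.

(** * Limits of the multiplier *)

Section Multiplier.
Variable R : realType.
Variables (b : R) (hb : 1 < b) (cp cm : R) (hcp : cp != 0) (hcm : cm != 0).
Implicit Types (f g h F : R -> R) (a c s t x y p q A B d e T v : R).

Let b0 : 0 < b. Proof. exact: lt_trans hb. Qed.

(** [Sv] and [Cv] are the coefficients of the sine and of the cosine of the phase in the truncated
    transform of a plane wave with v = u/w. The minus sign is that of 1/t on the negative
    half-line. *)
Definition Sv v e T := oscint b (@sin R) 1 (v * cp) e T - oscint b (@sin R) (-1) (v * cm) e T.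
Definition Cv v e T := oscint b (@cos R) 1 (v * cp) e T - oscint b (@cos R) (-1) (v * cm) e T.

Lemma powR_root s : 0 < s -> (s `^ b^-1) `^ b = s.
Proof. by move=> s0; rewrite -powRrM mulVf ?gt_eqF// powRr1// ltW. Qed.

(* The witnesses are the limits of [Sv] and [Cv].  With [X1] close to the integral
   of sin s / s over (0, +oo), [As = 2 X1]; for large [v] the phase is dominated by
   s^b, the substitution s^b = t brings a factor 1 / b, and
   [As - Bs >= 2 X1 (1 - 1 / b)] is positive because [b > 1]. *)
Lemma multiplier (tau : R) : 0 < tau -> exists As Bs Bc K d : R,
  [/\ 0 < d, 1 < K, 0 < As, d <= tau * (As - Bs) & d <= tau * As] /\
   (forall v, 0 < v -> v * K <= 1 -> exists e0 T0 : R, 0 < e0 /\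
     forall e T, 0 < e -> e <= e0 -> T0 <= T -> `|Sv v e T - As| <= d /\ `|Cv v e T| <= d) /\
   (forall v, K <= v -> exists e0 T0 : R, 0 < e0 /\
     forall e T, 0 < e -> e <= e0 -> T0 <= T ->
       `|Sv v e T - Bs| <= d /\ `|Cv v e T - Bc| <= d).
Proof.
move=> tau0.
pose c0 : R := (4 * pi)^-1.
have c00 : 0 < c0 by rewrite invr_gt0 mulr_gt0// pi_gt0.
have b1 : b^-1 < 1 by rewrite invf_lt1.
have bn0 : 0 < b^-1 by rewrite invr_gt0.
pose d := tau * (2 * c0 * (1 - b^-1)).
have d0 : 0 < d by rewrite !mulr_gt0// subr_gt0.
pose d' := d / 16.
have d'0 : 0 < d' by rewrite divr_gt0.
have dE : d = 16 * d' by rewrite /d' mulrCA mulfV ?mulr1// pnatr_eq0.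
have [q0 q00 Hq0] := small_q hb d'0.
have [q1 q10 Hq1] := large_q hb d'0.
have [e1 [T1 [e10 e11 T11 HX]]] := sinint_cauchy hb d'0.
pose e2 := Num.min e1 c0; pose T2 := Num.max T1 pi.
have e20 : 0 < e2 by rewrite lt_min e10 c00.
have e21 : e2 <= e1 by rewrite ge_min lexx.
have T12 : T1 <= T2 by rewrite le_max lexx.
have T20 : 0 < T2 by apply: lt_le_trans T12; apply: lt_le_trans T11.
have e2T2 : e2 <= T2 by apply: le_trans e21 _; apply: le_trans e11 _; apply: le_trans T11 _.
pose X1 := sinint e2 T2.
have X1l : c0 <= X1.
  by apply: sinint_lower => //; rewrite ?ge_min ?le_max lexx orbT.
have HX1 e T : 0 < e -> e <= e2 -> T2 <= T -> `|sinint e T - X1| <= 2 * d'.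
  move=> h1 h2 h3.
  have := HX e T h1 (le_trans h2 e21) (le_trans T12 h3).
  have := HX e2 T2 e20 e21 T12; rewrite -/X1.
  rewrite !ler_norml; move: (sinint e T) (sinint e1 T1) (X1) => x y z; clear -hb b0 hcp hcm; lra.
have acp : 0 < `|cp| by rewrite normr_gt0.
have acm : 0 < `|cm| by rewrite normr_gt0.
(* With this K, v K <= 1 puts both v |cp| and v |cm| below q0, and K <= v puts both above q1. *)
pose K := 1 + (`|cp| / q0 + `|cm| / q0) + (q1 / `|cp| + q1 / `|cm|).
have k1 : 0 < `|cp| / q0 by rewrite divr_gt0.
have k2 : 0 < `|cm| / q0 by rewrite divr_gt0.
have k3 : 0 < q1 / `|cp| by rewrite divr_gt0.
have k4 : 0 < q1 / `|cm| by rewrite divr_gt0.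
have K1 : 1 < K by rewrite /K; move: k1 k2 k3 k4; clear -hb b0 hcp hcm; lra.
have Kp : `|cp| / q0 <= K by rewrite /K; move: k1 k2 k3 k4; clear -hb b0 hcp hcm; lra.
have Km : `|cm| / q0 <= K by rewrite /K; move: k1 k2 k3 k4; clear -hb b0 hcp hcm; lra.
have Kp' : q1 / `|cp| <= K by rewrite /K; move: k1 k2 k3 k4; clear -hb b0 hcp hcm; lra.
have Km' : q1 / `|cm| <= K by rewrite /K; move: k1 k2 k3 k4; clear -hb b0 hcp hcm; lra.
exists (2 * X1), (b^-1 * X1 * (Num.sg cp - Num.sg cm)),
  (b^-1 * (ln `|cm| - ln `|cp|)), K, d; split; [split => //|split].
- by rewrite mulr_gt0//; apply: lt_le_trans X1l.
- rewrite /d ler_pM2l//.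
  have sg2 : Num.sg cp - Num.sg cm <= 2.
    have s1 : `|Num.sg cp| <= 1 by rewrite normr_sg; case: (_ != 0).
    have s2 : `|Num.sg cm| <= 1 by rewrite normr_sg; case: (_ != 0).
    move: s1 s2; rewrite !ler_norml; clear -hb b0 hcp hcm; lra.
  apply: le_trans (_ : 2 * X1 * (1 - b^-1) <= _).
    by rewrite ler_pM2r ?subr_gt0// ler_pM2l.
  have : b^-1 * X1 * (Num.sg cp - Num.sg cm) <= b^-1 * X1 * 2.
    by rewrite ler_pM2l// mulr_gt0//; apply: lt_le_trans X1l.
  have -> : 2 * X1 * (1 - b^-1) = 2 * X1 - b^-1 * X1 * 2 by ring.
  move: (b^-1 * X1 * _) (b^-1 * X1 * _) (2 * X1) => z z' z2; clear -hb b0 hcp hcm; lra.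
- rewrite /d ler_pM2l//; apply: le_trans (_ : 2 * c0 <= _); last by rewrite ler_pM2l.
  by rewrite ger_pMr ?mulr_gt0// gerBl ltW.
- move=> v v0 vK; exists e2, T2; split => // e T e0 ee TT.
  have eT : e <= T by apply: le_trans ee _; apply: le_trans TT.
  have hv c : 0 < `|c| -> `|c| / q0 <= K -> `|v * c| <= q0.
    move=> c0' cK; rewrite normrM (gtr0_norm v0).
    have : v * (`|c| / q0) <= 1 by apply: le_trans vK; rewrite ler_pM2l.
    by rewrite mulrA ler_pdivrMr// mul1r.
  have vp := hv _ acp Kp; have vm := hv _ acm Km.
  have N1 : `|-1 : R| = 1 by rewrite normrN normr1.
  have s1 := Hq0 _ _ _ _ _ (@osc_sin R) (normr1 R) vp e0 eT.
  have s2 := Hq0 _ _ _ _ _ (@osc_sin R) N1 vm e0 eT.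
  have s3 := Hq0 _ _ _ _ _ (@osc_cos R) (normr1 R) vp e0 eT.
  have s4 := Hq0 _ _ _ _ _ (@osc_cos R) N1 vm e0 eT.
  have s5 := HX1 _ _ e0 ee TT.
  rewrite oscint_sin1 in s1; rewrite oscint_sinN1// in s2; rewrite oscint_cos1 in s3; rewrite oscint_cosN1 in s4.
  rewrite /Sv /Cv dE.
  move: s1 s2 s3 s4 s5 d'0; rewrite !ler_norml.
  move: (oscint _ _ _ _ _ _) (oscint _ _ _ _ _ _) (oscint _ _ _ _ _ _) (oscint _ _ _ _ _ _) (sinint _ _) (cosint _ _).
  move: (X1) (d') => z d'' u1 u2 u3 u4 u5 u6; clear -hb b0 hcp hcm.
  by move=> *; split; lra.
- move=> v Kv; have v0 : 0 < v by apply: lt_le_trans Kv; apply: lt_trans K1.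
  have al0 : 0 < v * `|cp| by rewrite mulr_gt0.
  have be0 : 0 < v * `|cm| by rewrite mulr_gt0.
  have [e3 [T3 [e30 e31 T31 HY]]] := cosint_ratio hb al0 be0 d'0.
  (* The substitution turns the cutoffs into v |c| e^b and v |c| T^b, so the thresholds [E] and [TE]
     concern e^b and T^b. *)
  pose E := Num.min e3 (Num.min (e2 / (v * `|cp|)) (e2 / (v * `|cm|))).
  pose TE := Num.max T3 (Num.max (T2 / (v * `|cp|)) (T2 / (v * `|cm|))).
  have E0 : 0 < E by rewrite !lt_min e30 !divr_gt0.
  have TE0 : 0 < TE by rewrite !lt_max !divr_gt0// !orbT.
  have ETE : E <= TE.
    apply: le_trans (_ : e3 <= _); first by rewrite ge_min lexx.
    apply: le_trans e31 _; apply: le_trans T31 _; by rewrite le_max lexx.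
  exists (E `^ b^-1), (TE `^ b^-1); split; first by rewrite powR_gt0.
  move=> e T e0 ee TT.
  have T0 : 0 < T by apply: lt_le_trans TT; rewrite powR_gt0.
  have eb : e `^ b <= E by rewrite -[leRHS]powR_root//; apply: powR_monol => //; exact: ltW.
  have Tb : TE <= T `^ b.
    rewrite -[leLHS]powR_root//; apply: powR_monol => //; first exact: ltW.
    by rewrite powR_gt0.
  have eb0 : 0 < e `^ b by rewrite powR_gt0.
  have eT : e <= T.
    apply: le_trans ee _; apply: le_trans TT; apply: powR_monol => //; exact: ltW.
  have hv c : 0 < `|c| -> q1 / `|c| <= K -> q1 <= `|v * c|.
    move=> c0' cK; rewrite normrM (gtr0_norm v0).
    by rewrite -ler_pdivrMr//; apply: le_trans Kv.
  have vp := hv _ acp Kp'; have vm := hv _ acm Km'.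
  have N1 : `|-1 : R| = 1 by rewrite normrN normr1.
  have s1 := Hq1 _ _ _ _ _ (@osc_sin R) (normr1 R) vp e0 eT.
  have s2 := Hq1 _ _ _ _ _ (@osc_sin R) N1 vm e0 eT.
  have s3 := Hq1 _ _ _ _ _ (@osc_cos R) (normr1 R) vp e0 eT.
  have s4 := Hq1 _ _ _ _ _ (@osc_cos R) N1 vm e0 eT.
  have vcp : v * cp != 0 by rewrite mulf_neq0// gt_eqF.
  have vcm : v * cm != 0 by rewrite mulf_neq0// gt_eqF.
  rewrite oscint_sin0// in s1; rewrite oscint_sin0// in s2; rewrite oscint_cos0// in s3; rewrite oscint_cos0// in s4.
  rewrite !normrM !(gtr0_norm v0) !sgrM !(gtr0_sg v0) !mul1r in s1 s2 s3 s4.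
  have x1 : `|sinint (v * `|cp| * e `^ b) (v * `|cp| * T `^ b) - X1| <= 2 * d'.
    apply: HX1; first by rewrite mulr_gt0.
      rewrite mulrC -ler_pdivlMr//; apply: le_trans eb _.
      by rewrite !ge_min lexx orbT.
    rewrite mulrC -ler_pdivrMr//; apply: le_trans Tb.
    by rewrite !le_max lexx orbT.
  have x2 : `|sinint (v * `|cm| * e `^ b) (v * `|cm| * T `^ b) - X1| <= 2 * d'.
    apply: HX1; first by rewrite mulr_gt0.
      rewrite mulrC -ler_pdivlMr//; apply: le_trans eb _.
      by rewrite !ge_min lexx !orbT.
    rewrite mulrC -ler_pdivrMr//; apply: le_trans Tb.
    by rewrite !le_max lexx !orbT.
  have y1 := HY (e `^ b) (T `^ b) eb0.
  have {}y1 : `|cosint (v * `|cp| * e `^ b) (v * `|cp| * T `^ b)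
      - cosint (v * `|cm| * e `^ b) (v * `|cm| * T `^ b) - (ln `|cm| - ln `|cp|)| <= d'.
    have <- : ln (v * `|cm|) - ln (v * `|cp|) = ln `|cm| - ln `|cp|.
      by rewrite !lnM ?posrE//; ring.
    apply: y1; first by apply: le_trans eb _; rewrite ge_min lexx.
    by apply: le_trans Tb; rewrite le_max lexx.
  have sb c x : c != 0 -> `|Num.sg c * b^-1 * x - Num.sg c * b^-1 * X1| <= `|x - X1|.
    move=> c0'; rewrite -mulrBr !normrM normr_sg c0' mul1r gtr0_norm//.
    by rewrite ler_piMl// ltW.
  have x1' := le_trans (sb cp _ hcp) x1; have x2' := le_trans (sb cm _ hcm) x2.
  have y1' := y1.
  have {y1'}y2 : `|b^-1 * (cosint (v * `|cp| * e `^ b) (v * `|cp| * T `^ b)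
      - cosint (v * `|cm| * e `^ b) (v * `|cm| * T `^ b) - (ln `|cm| - ln `|cp|))| <= d'.
    by apply: le_trans y1; rewrite normrM gtr0_norm// ler_piMl// ltW.
  rewrite mulrBr mulrBr in y2.
  rewrite /Sv /Cv dE.
  have -> : b^-1 * X1 * (Num.sg cp - Num.sg cm) =
    Num.sg cp * b^-1 * X1 - Num.sg cm * b^-1 * X1 by ring.
  move: s1 s2 s3 s4 x1' x2' y2 d'0.
  set a1 := Num.sg cp * b^-1 * X1; set a2 := Num.sg cm * b^-1 * X1.
  set a3 := Num.sg cp * b^-1 * _; set a4 := Num.sg cm * b^-1 * _.
  set a5 := b^-1 * (ln _ - _); set a6 := b^-1 * _; set a7 := b^-1 * _.
  move: (oscint _ _ _ _ _ _) (oscint _ _ _ _ _ _) (oscint _ _ _ _ _ _) (oscint _ _ _ _ _ _).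
  move: (d') (a1) (a2) (a3) (a4) (a5) (a6) (a7) => d'' g1 g2 g3 g4 g5 g6 g7 z1 z2 z3 z4; clear -hb b0 hcp hcm.
  by rewrite !ler_norml => *; split; lra.
Qed.
End Multiplier.

(** * The transform of a function supported in the unit square *)

Section Hilbert.
Variable R : realType.
Variables (b : R) (hb : 1 < b) (cp cm : R).
Implicit Types (f g h F : R -> R) (a c s t y p q A B d T v : R) (e : expr R) (x : R * R).

Let b0 : 0 < b. Proof. exact: lt_trans hb. Qed.
Let b10 : 0 < b - 1. Proof. by rewrite subr_gt0. Qed.

Definition inQ x := (0 <= x.1 <= 1) && (0 <= x.2 <= 1).
Definition suppQ e := forall x, ~~ inQ x -> ev e x = 0.

Definition rayp e u x s := ev e (x.1 - s, x.2 - u * (cp * s `^ b)).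
Definition raym e u x s := ev e (x.1 + s, x.2 - u * (cm * s `^ b)).

(** k is the direction of the branch and r a dilation: r = 1 for the transform itself, r = 1/lam
    after rescaling to the wavelength. *)
Lemma dr_ray e (x1 x2 k m r : R) s : 0 < s -> 0 < r ->
  dr (fun s => ev e (x1 + k * (r * s), x2 - m * (r * s) `^ b)) s
   (ev (De true e) (x1 + k * (r * s), x2 - m * (r * s) `^ b) * (k * r) +
    ev (De false e) (x1 + k * (r * s), x2 - m * (r * s) `^ b)
       * (- (m * (b * (r * s) `^ (b - 1) * r)))).
Proof.
move=> s0 r0; have rs0 : 0 < r * s by rewrite mulr_gt0.
have drs : dr (fun s => r * s) s r.
  by apply: dr_eq; [apply: drM; [exact: dr_cst|exact: dr_id]|rewrite mul0r add0r mulr1].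
apply: (@ev_curve R e (fun s => x1 + k * (r * s)) (fun s => x2 - m * (r * s) `^ b)).
  apply: dr_eq; first by apply: drD; [exact: dr_cst|apply: drM; [exact: dr_cst|exact: drs]].
  by rewrite /=; ring.
apply: dr_eq.
  apply: drD; first exact: dr_cst.
  apply: drN; apply: drM; first exact: dr_cst.
  exact: (dr_comp drs (dr_powR b rs0)).
by rewrite /=; ring.
Qed.

Lemma rayp_ct e u x s : 0 < s -> ct (rayp e u x) s.
Proof.
move=> s0; have -> : rayp e u x =
    fun r => ev e (x.1 + -1 * (1 * r), x.2 - (u * cp) * (1 * r) `^ b).
  by apply/funext => r; rewrite /rayp mul1r mulN1r mulrA.
exact: ct_dr (@dr_ray e x.1 x.2 (-1) (u * cp) 1 s s0 ltr01).
Qed.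

Lemma raym_ct e u x s : 0 < s -> ct (raym e u x) s.
Proof.
move=> s0; have -> : raym e u x =
    fun r => ev e (x.1 + 1 * (1 * r), x.2 - (u * cm) * (1 * r) `^ b).
  by apply/funext => r; rewrite /raym !mul1r mulrA.
exact: ct_dr (@dr_ray e x.1 x.2 1 (u * cm) 1 s s0 ltr01).
Qed.

Lemma cts_div A B f : 0 < A -> (forall s, 0 < s -> ct f s) -> cts A B (fun s => f s / s).
Proof.
move=> A0 cf t /andP[h _]; have t0 := lt_le_trans A0 h.
by apply: ctM; [exact: cf|apply: ctV; [rewrite gt_eqF|exact: ct_id]].
Qed.

(** From a point of the unit square the curve leaves the square once |t| > 1, so cutting at 2 loses
    nothing. The half-line t < 0 is folded onto t > 0, where 1/t changes sign. *)
Lemma Htrunc_I e u x eps : suppQ e -> inQ x -> 0 < eps -> eps <= 2 ->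
  Htrunc b cp cm u (ev e) x eps =
   itg eps 2 (fun s => rayp e u x s / s) - itg eps 2 (fun s => raym e u x s / s).
Proof.
move=> sQ /andP[/andP[x10 x11] x2] e0 e2.
pose g t := ev e (x.1 - t, x.2 - u * gam b cp cm t) / t.
have gam_p t : 0 < t -> gam b cp cm t = cp * t `^ b by rewrite /gam => ->.
have gam_m t : t < 0 -> gam b cp cm t = cm * (- t) `^ b.
  by move=> t0; rewrite /gam t0 ltNge (ltW t0).
have out t : 2 < `|t| -> g t = 0.
  move=> ht; rewrite /g sQ ?mul0r//= negb_and; apply/orP; left.
  rewrite negb_and -!ltNge /=; have [t0|t0] := ltP 0 t.
    by move: ht; rewrite gtr0_norm// => ht; apply/orP; left; move: x11 ht; clear -hb b0 b10; lra.
  by move: ht; rewrite ler0_norm// => ht; apply/orP; right; move: x10 ht; clear -hb b0 b10; lra.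
rewrite /Htrunc -/(g _).
have pos : itg eps 2 g = itg eps 2 (fun s => rayp e u x s / s).
  by apply: itg_ext => t /andP[h _]; rewrite /g /rayp gam_p// (lt_le_trans e0).
pose gm s := ev e (x.1 - s, x.2 - u * (cm * (- s) `^ b)) / s.
have cm' t : t < 0 -> ct gm t.
  move=> t0; have nt : 0 < - t by rewrite oppr_gt0.
  have h : ct (fun s => raym e u x (- s) / s) t.
    apply: ctM; last by apply: ctV; [rewrite lt_eqF|exact: ct_id].
    apply: (@ct_comp R (raym e u x) (fun s => - s)); last exact: raym_ct.
    by apply: ctN; exact: ct_id.
  by move: h; rewrite /raym /gm.
have neg : itg (-2) (- eps) g = - itg eps 2 (fun s => raym e u x s / s).
  have -> : itg (-2) (- eps) g = itg (-2) (- eps) gm.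
    apply: itg_ext => t /andP[_ h]; rewrite /g /gm gam_m//.
    by apply: le_lt_trans h _; rewrite oppr_lt0.
  rewrite /itg /Rintegral integration_by_substitution_oppr//; last first.
    apply: cont_itv => t /andP[_ h]; apply: cm'.
    by apply: le_lt_trans h _; rewrite oppr_lt0.
  rewrite -[LHS]/(itg eps 2 (gm \o -%R)) -itg_opp; last first.
    by apply: cts_div => // s; exact: raym_ct.
  apply: itg_ext => t _; rewrite /gm /raym /= !opprK invrN mulrN.
  by [].
have igp : (@lebesgue_measure R).-integrable `]eps, 2] (EFin \o g).
  have : (@lebesgue_measure R).-integrable `[eps, 2] (EFin \o (fun s => rayp e u x s / s)).
    by apply: cont_integrable; apply: cts_div => // s; exact: rayp_ct.
  move=> H.
  have {}H : (@lebesgue_measure R).-integrable `]eps, 2] (EFin \o (fun s => rayp e u x s / s)).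
    by apply: integrableS H => //; apply: subset_itv; rewrite bnd_simp.
  apply: eq_integrable H => //.
    move=> t; rewrite inE /= in_itv /= => /andP[h _].
    by rewrite /g /rayp gam_p// (lt_trans e0).
have igm : (@lebesgue_measure R).-integrable `[-2, - eps[ (EFin \o g).
  have : (@lebesgue_measure R).-integrable `[-2, - eps] (EFin \o gm).
    apply: cont_integrable => t /andP[_ h]; apply: cm'.
    by apply: le_lt_trans h _; rewrite oppr_lt0.
  move=> H.
  have {}H : (@lebesgue_measure R).-integrable `[-2, - eps[ (EFin \o gm).
    by apply: integrableS H => //; apply: subset_itv; rewrite bnd_simp.
  apply: eq_integrable H => //.
    move=> t; rewrite inE /= in_itv /= => /andP[_ h].
    by rewrite /g /gm gam_m// (lt_trans h)// oppr_lt0.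
rewrite -pos -[- _]neg /itg -Rintegral_itv_obnd_cbnd//.
rewrite -[X in _ + X]Rintegral_itv_bndo_bndc//.
rewrite Rintegral_mkcond [X in _ = X + _]Rintegral_mkcond [X in _ = _ + X]Rintegral_mkcond.
rewrite -RintegralD//; last 2 first.
- rewrite -restrict_EFin; apply/integrable_restrict => //=; rewrite setTI; exact: igp.
- rewrite -restrict_EFin; apply/integrable_restrict => //=; rewrite setTI; exact: igm.
apply: eq_Rintegral => t _; rewrite /patch !mem_setE !in_itv /=.
rewrite -[RHS]/((if eps < t <= 2 then g t else 0) + (if -2 <= t < - eps then g t else 0)).
rewrite -[LHS]/(if eps < `|t| then g t else 0).
have [t2|t2] := ltP 2 `|t|; first by rewrite (out _ t2) !if_same addr0.
have [tp|tm] := ltP 0 t.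
  rewrite gtr0_norm// in t2 *; rewrite t2 andbT.
  have -> : (-2 <= t < - eps) = false.
    by apply/negP => /andP[_ h]; move: (lt_trans tp h); rewrite oppr_gt0 ltNge ltW.
  by rewrite addr0.
rewrite ler0_norm// in t2 *.
have -> : (eps < t <= 2) = false.
  by apply/negP => /andP[h _]; move: (lt_trans e0 h); rewrite ltNge tm.
by rewrite ltrNr lerNl t2 add0r.
Qed.
End Hilbert.

(** * Existence and linearity of the principal value *)

Section HilbertLimit.
Variable R : realType.
Variables (b : R) (hb : 1 < b) (cp cm : R).
Implicit Types (f g h F : R -> R) (a c s t p q A B d T v u : R) (e : expr R) (x : R * R).

Let b0 : 0 < b. Proof. exact: lt_trans hb. Qed.
Let b10 : 0 < b - 1. Proof. by rewrite subr_gt0. Qed.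

Lemma ev_lip e (M : R) : exists2 L : R, 0 < L & forall y1 y2 z1 z2 : R,
  `|y1| <= M -> `|y2| <= M -> `|z1| <= M -> `|z2| <= M ->
  `|ev e (y1, y2) - ev e (z1, z2)| <= L * (`|y1 - z1| + `|y2 - z2|).
Proof.
have [L1 p1 h1] := ev_bound (De true e) M.
have [L2 p2 h2] := ev_bound (De false e) M.
exists (L1 + L2); first by rewrite addr_gt0.
move=> y1 y2 z1 z2 Y1 Y2 Z1 Z2.
have lin (y z : R) s : dr (fun s => z + s * (y - z)) s (y - z).
  apply: dr_eq; first by apply: drD; [exact: dr_cst|apply: drM; [exact: dr_id|exact: dr_cst]].
  by rewrite /=; ring.
have bd (y z : R) s : `|y| <= M -> `|z| <= M -> 0 <= s <= 1 -> `|z + s * (y - z)| <= M.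
  move=> Y Z /andP[s0 s1].
  have -> : z + s * (y - z) = (1 - s) * z + s * y by ring.
  apply: le_trans (ler_normD _ _) _; rewrite !normrM (ger0_norm s0) ger0_norm ?subr_ge0//.
  have : (1 - s) * `|z| <= (1 - s) * M by rewrite ler_wpM2l// subr_ge0.
  have : s * `|y| <= s * M by rewrite ler_wpM2l.
  by move: (s * _) (_ * `|z|) => *; nra.
have := @dr_abs_le R 0 1 (fun s => ev e (z1 + s * (y1 - z1), z2 + s * (y2 - z2)))
  (fun s => ((L1 + L2) * (`|y1 - z1| + `|y2 - z2|)) * s) _
  (fun=> ((L1 + L2) * (`|y1 - z1| + `|y2 - z2|))) ler01
  (fun s _ => ev_curve e (lin y1 z1 s) (lin y2 z2 s)).
rewrite !mul0r !addr0 !mul1r !subrKC mulr1 mulr0 subr0; apply.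
- move=> s _; apply: dr_eq; first by apply: drM; [exact: dr_cst|exact: dr_id].
  by rewrite /=; ring.
- move=> s hs; apply: le_trans (ler_normD _ _) _; rewrite !normrM.
  have k1 := h1 (z1 + s * (y1 - z1), z2 + s * (y2 - z2)) (bd _ _ _ Y1 Z1 hs) (bd _ _ _ Y2 Z2 hs).
  have k2 := h2 (z1 + s * (y1 - z1), z2 + s * (y2 - z2)) (bd _ _ _ Y1 Z1 hs) (bd _ _ _ Y2 Z2 hs).
  rewrite [leRHS]mulrDr; apply: lerD; apply: ler_wpM2r => //.
    by apply: le_trans k1 _; rewrite lerDl ltW.
  by apply: le_trans k2 _; rewrite lerDr ltW.
Qed.

Lemma curve_le s c : 0 < s -> s <= 2 -> `|c * s `^ b| <= `|c| * 2 `^ (b - 1) * s.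
Proof.
move=> s0 s2; rewrite normrM -mulrA ler_wpM2l// ger0_norm ?powR_ge0//.
rewrite -(powB1 hb s0) mulrC ler_pM2r//; apply: powR_monol => //; exact: ltW.
Qed.

(** Since b > 1, s^b is at most 2^(b-1) s for s <= 2: the curve moves away from x at linear speed at
    most, and C is uniform in x. *)
Lemma ray_bound e u : exists2 C : R, 0 < C & forall x s, inQ x -> 0 < s -> s <= 2 ->
  `|rayp b cp e u x s - ev e x| <= C * s /\ `|raym b cm e u x s - ev e x| <= C * s.
Proof.
pose P : R := 2 `^ (b - 1); pose k := `|u * cp| + `|u * cm|.
have P0 : 0 < P by rewrite powR_gt0.
have k0 : 0 <= k by rewrite addr_ge0.
have [L L0 H] := ev_lip e (3 + k * P * 2).
exists (L * (1 + k * P)); first by rewrite mulr_gt0// ltr_wpDr// mulr_ge0// ltW.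
move=> [x1 x2] s /andP[/= /andP[x10 x11] /andP[x20 x21]] s0 s2.
have kP : 0 <= k * P * 2 by rewrite !mulr_ge0// ltW.
have X1 : `|x1| <= 3 + k * P * 2.
  by rewrite ger0_norm//; move: x11 kP; clear -hb b0 b10; lra.
have X2 : `|x2| <= 3 + k * P * 2.
  by rewrite ger0_norm//; move: x21 kP; clear -hb b0 b10; lra.
have G c : `|u * c| <= k -> `|u * (c * s `^ b)| <= k * P * s /\
    `|x2 - u * (c * s `^ b)| <= 3 + k * P * 2.
  move=> kc; have h : `|u * (c * s `^ b)| <= k * P * s.
    rewrite mulrA; apply: le_trans (curve_le _ s0 s2) _.
    by rewrite ler_pM2r// ler_pM2r.
  split => //; apply: le_trans (ler_normB _ _) _; rewrite (ger0_norm x20).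
  have : k * P * s <= k * P * 2 by rewrite ler_wpM2l// mulr_ge0// ltW.
  by move: h x21; clear -hb b0 b10; lra.
have Xp : `|x1 - s| <= 3 + k * P * 2.
  by rewrite ler_norml; move: x10 x11 kP s0 s2; clear -hb b0 b10; lra.
have Xm : `|x1 + s| <= 3 + k * P * 2.
  by rewrite ler_norml; move: x10 x11 kP s0 s2; clear -hb b0 b10; lra.
have [g1 g2] := G cp ltac:(by rewrite lerDl).
have [g3 g4] := G cm ltac:(by rewrite lerDr).
have E : L * (1 + k * P) * s = L * (s + k * P * s) by ring.
split; rewrite E.
- apply: le_trans (H _ _ _ _ Xp g2 X1 X2) _; rewrite ler_pM2l//.
  rewrite addrAC subrr add0r normrN (gtr0_norm s0) lerD2l.
  by rewrite addrAC subrr add0r normrN.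
- apply: le_trans (H _ _ _ _ Xm g4 X1 X2) _; rewrite ler_pM2l//.
  rewrite addrAC subrr add0r (gtr0_norm s0) lerD2l.
  by rewrite addrAC subrr add0r normrN.
Qed.

Definition Htr e u x := fun eps : R => Htrunc b cp cm u (ev e) x eps.

(** The values on the two branches both differ from that at x by O(s); their difference divided by s
    is bounded, and the truncation is Lipschitz in the cutoff. *)
Lemma Htr_diff e u x : suppQ e -> inQ x -> exists2 C : R, 0 < C &
  forall p q, 0 < p -> p <= q -> q <= 2 -> `|Htr e u x p - Htr e u x q| <= C * (q - p).
Proof.
move=> sQ xQ; have [C C0 H] := ray_bound e u.
exists (2 * C); first by rewrite mulr_gt0.
move=> p q p0 pq q2; rewrite /Htr !Htrunc_I//; last 2 first.
- exact: lt_le_trans pq.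
- exact: le_trans q2.
have cp' s : 0 < s -> ct (rayp b cp e u x) s by move=> s0; exact: rayp_ct.
have cm' s : 0 < s -> ct (raym b cm e u x) s by move=> s0; exact: raym_ct.
rewrite (@itg_split _ p 2 q (fun s => rayp b cp e u x s / s)) ?pq//; last exact: cts_div.
rewrite (@itg_split _ p 2 q (fun s => raym b cm e u x s / s)) ?pq//; last exact: cts_div.
set i1 := itg p q _; set i2 := itg q 2 _; set i3 := itg p q _; set i4 := itg q 2 _.
have -> : i1 + i2 - (i3 + i4) - (i2 - i4) = i1 - i3 by ring.
rewrite /i1 /i3 -itgB; try exact: cts_div.
rewrite -itg_cst//; apply: itg_abs.
- move=> t ht; apply: ctD; first exact: (cts_div p0 cp' ht).
  by apply: ctN; exact: (cts_div p0 cm' ht).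
- by move=> t _; exact: ct_cst.
- move=> s /andP[ps sq]; have s0 := lt_le_trans p0 ps.
  have [h1 h2] := H x s xQ s0 (le_trans sq q2).
  rewrite -mulrBl normrM normfV (gtr0_norm s0) ler_pdivrMr//.
  have -> : rayp b cp e u x s - raym b cm e u x s =
     (rayp b cp e u x s - ev e x) - (raym b cm e u x s - ev e x) by ring.
  apply: le_trans (ler_normB _ _) _.
  by apply: le_trans (lerD h1 h2) _; rewrite -mulrA mulr_natl mulr2n.
Qed.

(** Adding C r to a C-Lipschitz function of r makes it nondecreasing; being also bounded below, it
    converges as r decreases to 0. *)
Lemma Htr_cvg e u x : suppQ e -> inQ x -> cvg (Htr e u x @ 0^'+).
Proof.
move=> sQ xQ; have [C C0 H] := Htr_diff u sQ xQ.
have h1 : cvg ((fun r => Htr e u x r + C * r) @ 0^'+).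
  apply: nondecreasing_at_right_is_cvgr.
    near=> z => p q; rewrite !in_itv /= => /andP[p0 pz] /andP[q0 qz] pq.
    have z2 : z <= 2 by near: z; exact: nbhs_right_le.
    have := H p q p0 pq (le_trans (ltW qz) z2).
    rewrite ler_norml => /andP[_]; rewrite lerBlDr => h.
    by rewrite -subr_ge0; move: h; clear; lra.
  near=> z; exists (Htr e u x 2 - C * 2) => _ /= [p + <-].
  rewrite in_itv /= => /andP[p0 pz].
  have z2 : z <= 2 by near: z; exact: nbhs_right_le.
  have p2 := le_trans (ltW pz) z2.
  have := H p 2 p0 p2 (lexx _).
  rewrite ler_norml => /andP[h _].
  have : 0 <= C * p by rewrite mulr_ge0// ltW.
  by move: h; rewrite mulrBr; move: (C * p) => *; lra.
have h2 : (fun r : R => C * r) @ 0^'+ --> C * 0.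
  by apply: cvg_at_right_filter; apply: cvgM; [exact: cvg_cst|exact: cvg_id].
have -> : Htr e u x = (fun r => (Htr e u x r + C * r) - C * r).
  by apply/funext => r; rewrite addrK.
by apply: is_cvgB => //; apply: cvgP h2.
Unshelve. all: by end_near. Qed.

Definition He e u x := Hu b cp cm u (ev e) x.

Lemma He_cvg e u x : suppQ e -> inQ x -> Htr e u x @ 0^'+ --> He e u x.
Proof. by move=> sQ xQ; exact: Htr_cvg. Qed.

Lemma He_close e u x l d eps0 : suppQ e -> inQ x -> 0 < eps0 ->
  (forall eps, 0 < eps -> eps <= eps0 -> `|Htr e u x eps - l| <= d) -> `|He e u x - l| <= d.
Proof.
move=> sQ xQ e0 h.
have c : (fun r => `|Htr e u x r - l|) @ 0^'+ --> `|He e u x - l|.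
  by apply: cvg_norm; apply: cvgB; [exact: He_cvg|exact: cvg_cst].
apply: (cvgr_to_le c); near=> r; apply: h; near: r.
  exact: nbhs_right_gt.
exact: nbhs_right_le.
Unshelve. all: by end_near. Qed.

Lemma HeD e1 e2 u x : suppQ e1 -> suppQ e2 -> inQ x ->
  He (EAdd e1 e2) u x = He e1 u x + He e2 u x.
Proof.
move=> s1 s2 xQ.
have s12 : suppQ (EAdd e1 e2) by move=> y hy /=; rewrite s1// s2// addr0.
have C : (fun r => Htr e1 u x r + Htr e2 u x r) @ 0^'+ --> He e1 u x + He e2 u x.
  by apply: cvgD; exact: He_cvg.
apply: cvg_lim; first exact: Rhausdorff.
apply: cvg_trans C; apply: near_eq_cvg; near=> r.
have r0 : 0 < r by near: r; exact: nbhs_right_gt.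
have r2 : r <= 2 by near: r; exact: nbhs_right_le.
rewrite /Htr -[in RHS]/(Htrunc b cp cm u (ev (EAdd e1 e2)) x r) !Htrunc_I//.
have E1 : itg r 2 (fun s => rayp b cp (EAdd e1 e2) u x s / s) =
   itg r 2 (fun s => rayp b cp e1 u x s / s) + itg r 2 (fun s => rayp b cp e2 u x s / s).
  rewrite -itgD; try by apply: cts_div => // s s0; exact: rayp_ct.
  by apply: itg_ext => t _; rewrite /rayp /= mulrDl.
have E2 : itg r 2 (fun s => raym b cm (EAdd e1 e2) u x s / s) =
   itg r 2 (fun s => raym b cm e1 u x s / s) + itg r 2 (fun s => raym b cm e2 u x s / s).
  rewrite -itgD; try by apply: cts_div => // s s0; exact: raym_ct.
  by apply: itg_ext => t _; rewrite /raym /= mulrDl.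
by rewrite E1 E2; ring.
Unshelve. all: by end_near. Qed.

Lemma HeZ c e u x : suppQ e -> inQ x -> He (EMul (ECst c) e) u x = c * He e u x.
Proof.
move=> s1 xQ.
have s12 : suppQ (EMul (ECst c) e) by move=> y hy /=; rewrite s1// mulr0.
have C : (fun r => c * Htr e u x r) @ 0^'+ --> c * He e u x.
  by apply: cvgM; [exact: cvg_cst|exact: He_cvg].
apply: cvg_lim; first exact: Rhausdorff.
apply: cvg_trans C; apply: near_eq_cvg; near=> r.
have r0 : 0 < r by near: r; exact: nbhs_right_gt.
have r2 : r <= 2 by near: r; exact: nbhs_right_le.
rewrite /Htr -[in RHS]/(Htrunc b cp cm u (ev (EMul (ECst c) e)) x r) !Htrunc_I//.
rewrite mulrBr -!itgZ; try (by apply: cts_div => // s s0; exact: rayp_ct);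
  try (by apply: cts_div => // s s0; exact: raym_ct).
by congr (_ - _); apply: itg_ext => t _; rewrite /rayp /raym /= mulrA.
Unshelve. all: by end_near. Qed.
End HilbertLimit.

(** * The transform of a wave of high frequency *)

Section Asymptotics.
Variable R : realType.
Variables (b : R) (hb : 1 < b) (cp cm : R).
Implicit Types (f g h F : R -> R) (a c s t p q A B d T v u w : R) (e chi : expr R) (x : R * R).

Let b0 : 0 < b. Proof. exact: lt_trans hb. Qed.
Let b10 : 0 < b - 1. Proof. by rewrite subr_gt0. Qed.

(** The amplitude varies on the scale lam. On [e, T] it is frozen at its value [chi0], at the cost C
    T/lam; on [T, 2 lam] the oscillation of the curved phase makes the integral small, whatever
    lam. *)
Lemma one_side f p q (al da : R -> R) (chi0 C D lam e T : R) :
  osc f -> `|p| <= 1 -> 0 < e -> e <= T -> T <= 2 * lam -> 0 < lam -> 0 < D -> 0 < C ->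
  2 <= `|q| * b * T `^ (b - 1) ->
  (forall s, 0 < s -> dr al s (da s)) ->
  (forall s, 0 < s -> s <= 2 * lam -> `|al s| <= 1) ->
  (forall s, 0 < s -> s <= 2 * lam -> `|al s - chi0| <= C / lam * s) ->
  (forall s, 0 < s -> s <= 2 * lam -> `|da s| <= D / lam) ->
  `|itg e (2 * lam) (fun s => al s * f (phi b p q s) / s) - chi0 * oscint b f p q e T| <=
    C * T / lam + (12 + 4 * D) / (b * `|q| * T `^ b).
Proof.
move=> of_ p1 e0 eT Tl l0 D0 C0 hT dal al1 alC daD.
have T0 : 0 < T by apply: lt_le_trans eT.
have q0 : 0 < `|q|.
  rewrite lt_neqAle normr_ge0 andbT; apply/negP => /eqP q0.
  by move: hT; rewrite -q0 !mul0r; clear -hb b0 b10 cp cm; lra.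
have cf t : 0 < t -> ct (fun s => f (phi b p q s) / s) t by move=> t0; exact: ct_osc_phi.
have cal t : 0 < t -> ct (fun s => al s * f (phi b p q s) / s) t.
  move=> t0; rewrite (_ : (fun s => _) = (fun s => al s * (f (phi b p q s) / s))).
    by apply: ctM; [exact: ct_dr (dal t t0)|exact: cf].
  by apply/funext => s; rewrite mulrA.
have cts' (A B : R) g : 0 < A -> (forall t, 0 < t -> ct g t) -> cts A B g.
  by move=> A0 h t /andP[h1 _]; apply: h; exact: lt_le_trans h1.
rewrite (@itg_split _ e (2 * lam) T)//; [|by rewrite eT|exact: cts'].
set i1 := itg e T _; set i2 := itg T _ _.
have -> : i1 + i2 - chi0 * oscint b f p q e T = (i1 - chi0 * oscint b f p q e T) + i2 by ring.
apply: le_trans (ler_normD _ _) _; apply: lerD.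
  rewrite /i1 /oscint -itgZ; last exact: cts'.
  rewrite -itgB; last 2 first.
  - exact: cts'.
  - apply: cts' => // t t0; apply: ctM; [exact: ct_cst|exact: cf].
  apply: le_trans (_ : itg e T (fun=> C / lam) <= _).
    apply: itg_abs.
    + apply: cts' => // t t0; apply: ctD; first exact: cal.
      by apply: ctN; apply: ctM; [exact: ct_cst|exact: cf].
    + by move=> t _; exact: ct_cst.
    + move=> s /andP[es sT]; have s0 := lt_le_trans e0 es.
      have -> : al s * f (phi b p q s) / s - chi0 * (f (phi b p q s) / s)
         = (al s - chi0) * f (phi b p q s) / s by ring.
      rewrite normrM normfV (gtr0_norm s0) ler_pdivrMr// normrM.
      apply: le_trans (alC s s0 (le_trans sT Tl)).
      by rewrite ler_piMr//; have [_ [_ ->]] := of_.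
  rewrite itg_cst// mulrAC ler_pM2r ?invr_gt0// ler_pM2l//.
  by rewrite gerBl ltW.
have Tb0 : 0 < T `^ b by rewrite powR_gt0.
(* The derivative of the amplitude is O(1/lam) and the interval has length at most 2 lam, so the
   contribution of M does not depend on lam. *)
pose M := D / lam * (2 / (`|q| * b * T `^ b)).
have -> : (12 + 4 * D) / (b * `|q| * T `^ b) =
   12 / (b * `|q| * T `^ b) + M * (2 * lam).
  by rewrite /M; field; rewrite !gt_eqF.
have M0 : 0 < M by rewrite /M !(mulr_gt0, invr_gt0).
apply: le_trans (_ : 12 / (b * `|q| * T `^ b) + M * (2 * lam - T) <= _); last first.
  by rewrite lerD2l ler_pM2l// gerBl ltW.
apply: (tail_curved hb of_ p1 T0 Tl hT dal).
- by move=> s /andP[h1 h2]; apply: al1 => //; exact: lt_le_trans h1.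
- move=> s /andP[h1 h2]; have s0 := lt_le_trans T0 h1.
  rewrite normrM mulrC /M normfV; apply: ler_pM => //.
    exact: daD.
  have hs : 2 <= `|q| * b * s `^ (b - 1).
    apply: le_trans hT _; rewrite ler_pM2l ?mulr_gt0//.
    by apply: powR_monol => //; exact: ltW.
  have -> : 2 / (`|q| * b * T `^ b) = (`|q| * b * T `^ b / 2)^-1.
    by rewrite invf_div.
  have Wp : 0 < `|q| * b * T `^ b / 2 by rewrite !(mulr_gt0, invr_gt0).
  have WW : `|q| * b * T `^ b / 2 <= `|p * s + q * b * s `^ b|.
    apply: le_trans (phi_lower hb p1 s0 hs).
    rewrite ler_pM2r ?invr_gt0// ler_pM2l ?mulr_gt0//.
    by apply: powR_monol => //; exact: ltW.
  by rewrite lef_pV2 ?posrE//; apply: lt_le_trans WW.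
Qed.

Definition phase (lam w : R) : expr R :=
  EAdd (EMul (ECst lam) (EFst R)) (EMul (ECst (lam `^ b / w)) (ESnd R)).
Definition wave chi (lam w : R) : expr R := EMul chi (ECos (phase lam w)).

Lemma oscint_shift (th p q e T : R) : 0 < e ->
  oscint b (fun y => cos (- th + y)) p q e T =
  cos th * oscint b (@cos R) p q e T + sin th * oscint b (@sin R) p q e T.
Proof.
move=> e0; have cc := @cts_osc_phi R b (@cos R) p q e T (@osc_cos R) e0.
have cs := @cts_osc_phi R b (@sin R) p q e T (@osc_sin R) e0.
rewrite /oscint -!itgZ// -itgD.
- by apply: itg_ext => t _; rewrite cosD cosN sinN; ring.
- by move=> t ht; apply: ctM; [exact: ct_cst|exact: cc].
- by move=> t ht; apply: ctM; [exact: ct_cst|exact: cs].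
Qed.

Lemma exists_cutoff (T0 A1 A2 : R) : exists2 T : R, 1 <= T /\ T0 <= T &
  A1 <= T `^ (b - 1) /\ A2 <= T `^ b.
Proof.
pose T := Num.max (Num.max 1 T0) (Num.max (`|A1| `^ (b - 1)^-1) A2).
have T1 : 1 <= T by rewrite !le_max lexx.
have T0' : 0 < T by apply: lt_le_trans T1.
exists T; first by split=> //; rewrite !le_max lexx orbT.
split.
  apply: le_trans (ler_norm _) _.
  have [->|a0] := eqVneq A1 0; first by rewrite normr0 powR_ge0.
  have -> : `|A1| = (`|A1| `^ (b - 1)^-1) `^ (b - 1).
    by rewrite -powRrM mulVf ?gt_eqF// powRr1.
  apply: powR_monol; [exact: ltW|by rewrite powR_gt0// normr_gt0|].
  by rewrite !le_max lexx !orbT.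
apply: le_trans (_ : T <= _); first by rewrite !le_max lexx !orbT.
by apply: le1r_powR => //; exact: ltW.
Qed.

(** Dilating by lam turns the phase along the branches into -th + s + v cp s^b and -th - s + v cm
    s^b, up to parity of the cosine: only v = u/w remains, because the second frequency is lam^b /
    w. The cutoff T is fixed first, from [tol], and lam is then taken large compared with it. The
    error in the multiplier keeps the factor chi, so that outside the cell only [tol] is left. *)
Lemma He_wave chi u w a c d (e0 T0 tol : R) : cp != 0 -> cm != 0 ->
  suppQ chi -> (forall x, 0 <= ev chi x <= 1) -> 0 < u -> 0 < w -> 0 < tol -> 0 < e0 ->
  (forall e T : R, 0 < e -> e <= e0 -> T0 <= T ->
     `|Sv b cp cm (u / w) e T - a| <= d /\ `|Cv b cp cm (u / w) e T - c| <= d) ->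
  exists2 lam0 : R, 0 < lam0 & forall lam, lam0 <= lam -> forall x, inQ x ->
   `|He b cp cm (wave chi lam w) u x -
      ev chi x * (a * sin (ev (phase lam w) x) + c * cos (ev (phase lam w) x))|
     <= 2 * d * ev chi x + tol.
Proof.
move=> hcp hcm sQ chi01 u0 w0 tol0 e00 SC.
pose v := u / w.
have v0 : 0 < v by rewrite divr_gt0.
have [C C0 HC] := ray_bound hb cp cm chi u.
pose P : R := 2 `^ (b - 1); pose k := `|u * cp| + `|u * cm|.
have P0 : 0 < P by rewrite powR_gt0.
have k0 : 0 <= k by rewrite addr_ge0.
have [D1 D10 HD1] := ev_bound (De true chi) (3 + k * P * 2).
have [D2 D20 HD2] := ev_bound (De false chi) (3 + k * P * 2).
pose D := D1 + D2 * (k * b * P).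
have kbP : 0 <= k * b * P by rewrite !mulr_ge0// ltW.
have D0 : 0 < D by rewrite ltr_wpDr// mulr_ge0// ltW.
pose qp := v * cp; pose qm := v * cm.
have qp0 : 0 < `|qp| by rewrite normr_gt0 mulf_neq0// gt_eqF.
have qm0 : 0 < `|qm| by rewrite normr_gt0 mulf_neq0// gt_eqF.
pose A1 := 2 / (`|qp| * b) + 2 / (`|qm| * b).
pose A2 := (12 + 4 * D) / (b * `|qp| * (tol / 4)) + (12 + 4 * D) / (b * `|qm| * (tol / 4)).
have [T [T1 TT0] [TA1 TA2]] := exists_cutoff T0 A1 A2.
have Tp : 0 < T by apply: lt_le_trans T1.
have Tb0 : 0 < T `^ b by rewrite powR_gt0.
have pos12 : 0 < 12 + 4 * D by rewrite addr_gt0// mulr_gt0.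
have cut q : 0 < `|q| -> 2 / (`|q| * b) <= A1 ->
    (12 + 4 * D) / (b * `|q| * (tol / 4)) <= A2 ->
    2 <= `|q| * b * T `^ (b - 1) /\ (12 + 4 * D) / (b * `|q| * T `^ b) <= tol / 4.
  move=> q0 h1 h2; split.
    by rewrite mulrC -ler_pdivrMr ?mulr_gt0//; apply: le_trans TA1.
  have := le_trans h2 TA2.
  rewrite !ler_pdivrMr ?mulr_gt0 ?invr_gt0 ?mulr_gt0//.
  by move=> h; apply: le_trans h _; rewrite le_eqVlt; apply/orP; left; apply/eqP; ring.
have [cutp1 cutp2] : 2 <= `|qp| * b * T `^ (b - 1) /\ (12 + 4 * D) / (b * `|qp| * T `^ b) <= tol / 4.
  by apply: cut => //; rewrite lerDl ltW// !(mulr_gt0, invr_gt0).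
have [cutm1 cutm2] : 2 <= `|qm| * b * T `^ (b - 1) /\ (12 + 4 * D) / (b * `|qm| * T `^ b) <= tol / 4.
  by apply: cut => //; rewrite lerDr ltW// !(mulr_gt0, invr_gt0).
exists (Num.max T (C * T * 4 / tol)); first by rewrite lt_max Tp.
move=> lam; rewrite ge_max => /andP[Tl Cl] x xQ.
have l0 : 0 < lam by apply: lt_le_trans Tl.
have CTl : C * T / lam <= tol / 4.
  rewrite ler_pdivrMr// [tol / 4 * lam]mulrC mulrA ler_pdivlMr//.
  by rewrite -ler_pdivrMr.
have T2l : T <= 2 * lam by rewrite mulr_natl mulr2n; apply: le_trans Tl _; rewrite lerDl ltW.
set th := ev (phase lam w) x.
pose e1 := Num.min e0 T.
have e10 : 0 < e1 by rewrite lt_min e00.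
have sQw : suppQ (wave chi lam w) by move=> y hy /=; rewrite sQ// mul0r.
apply: (@He_close R b hb cp cm (wave chi lam w) u x _ _ (e1 / lam)) => //.
  by rewrite divr_gt0.
move=> eps ep epsl.
have le1 : lam * eps <= e1 by rewrite mulrC -ler_pdivlMr.
have le0 : 0 < lam * eps by rewrite mulr_gt0.
have leT : lam * eps <= T by apply: le_trans le1 _; rewrite ge_min lexx orbT.
have lee0 : lam * eps <= e0 by apply: le_trans le1 _; rewrite ge_min lexx.
have eps2 : eps <= 2.
  by rewrite -(ler_pM2l l0); apply: le_trans leT _; rewrite [lam * 2]mulrC.
rewrite /Htr Htrunc_I//.
pose f y : R := cos (- th + y).
have of_ : osc f by apply: osc_shift; exact: osc_cos.
have rl0 : 0 < lam^-1 by rewrite invr_gt0.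
have thE : th = lam * x.1 + lam `^ b / w * x.2 by [].
pose alp s := ev chi (x.1 + -1 * (lam^-1 * s), x.2 - (u * cp) * (lam^-1 * s) `^ b).
pose alm s := ev chi (x.1 + 1 * (lam^-1 * s), x.2 - (u * cm) * (lam^-1 * s) `^ b).
have powl s : 0 < s -> (lam * s) `^ b = lam `^ b * s `^ b.
  by move=> s0; rewrite powRM ?ltW.
have Ip : itg eps 2 (fun s => rayp b cp (wave chi lam w) u x s / s) =
    itg (lam * eps) (2 * lam) (fun s => alp s * f (phi b 1 qp s) / s).
  rewrite [2 * lam]mulrC (@itg_scale R lam eps 2 (fun s => alp s * f (phi b 1 qp s)) l0 ep eps2).
    apply: itg_ext => s /andP[es _]; have s0 := lt_le_trans ep es.
    congr (_ / _); rewrite /rayp /wave /= /alp mulKf ?gt_eqF// mulN1r !mulrA.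
    congr (_ * _); rewrite /f -cosN; congr cos.
    by rewrite thE /phi powl// /qp /v; ring.
  move=> t t0; apply: ctM; first exact: ct_dr (dr_ray b chi x.1 x.2 (-1) (u * cp) t0 rl0).
  by apply: ct_comp; [apply: ct_dr; exact: dr_phi|exact: osc_ct].
have Im : itg eps 2 (fun s => raym b cm (wave chi lam w) u x s / s) =
    itg (lam * eps) (2 * lam) (fun s => alm s * f (phi b (-1) qm s) / s).
  rewrite [2 * lam]mulrC (@itg_scale R lam eps 2 (fun s => alm s * f (phi b (-1) qm s)) l0 ep eps2).
    apply: itg_ext => s /andP[es _]; have s0 := lt_le_trans ep es.
    congr (_ / _); rewrite /raym /wave /= /alm mulKf ?gt_eqF// mul1r !mulrA.
    congr (_ * _); rewrite /f -cosN; congr cos.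
    by rewrite thE /phi powl// /qm /v; ring.
  move=> t t0; apply: ctM; first exact: ct_dr (dr_ray b chi x.1 x.2 1 (u * cm) t0 rl0).
  by apply: ct_comp; [apply: ct_dr; exact: dr_phi|exact: osc_ct].
rewrite Ip Im.
have N1 : `|-1 : R| <= 1 by rewrite normrN normr1.
have P1 : `|1 : R| <= 1 by rewrite normr1.
have ls2 s : 0 < s -> s <= 2 * lam -> 0 < lam^-1 * s /\ lam^-1 * s <= 2.
  move=> s0 s2; split; first by rewrite mulr_gt0.
  by rewrite mulrC ler_pdivrMr.
have chi1 y : `|ev chi y| <= 1.
  by have /andP[h1 h2] := chi01 y; rewrite ger0_norm.
have xb1 : 0 <= x.1 <= 1 by move: xQ => /andP[].
have xb2 : 0 <= x.2 <= 1 by move: xQ => /andP[].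
have kP2 : 0 <= k * P * 2 by rewrite !mulr_ge0// ltW.
have dbound (kk m s : R) : `|kk| <= 1 -> `|m| <= k -> 0 < s -> s <= 2 * lam ->
   `|ev (De true chi) (x.1 + kk * (lam^-1 * s), x.2 - m * (lam^-1 * s) `^ b) * (kk * lam^-1) +
    ev (De false chi) (x.1 + kk * (lam^-1 * s), x.2 - m * (lam^-1 * s) `^ b)
       * (- (m * (b * (lam^-1 * s) `^ (b - 1) * lam^-1)))| <= D / lam.
  move=> kk1 mk s0 s2; have [r0 r2] := ls2 s s0 s2; set r := lam^-1 * s in r0 r2 *.
  have X1 : `|x.1 + kk * r| <= 3 + k * P * 2.
    have h : `|kk * r| <= 2.
      rewrite normrM (gtr0_norm r0); apply: le_trans r2.
      by rewrite ler_piMl// ltW.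
    apply: le_trans (ler_normD _ _) _; rewrite ger0_norm; last by case/andP: xb1.
    by move: h xb1 kP2; clear -hb b0 b10 cp cm; lra.
  have X2 : `|x.2 - m * r `^ b| <= 3 + k * P * 2.
    have h : `|m * r `^ b| <= k * P * 2.
      apply: le_trans (curve_le hb m r0 r2) _.
      apply: le_trans (_ : k * P * r <= _).
        by rewrite ler_pM2r// ler_pM2r.
      by rewrite ler_wpM2l// mulr_ge0// ltW.
    apply: le_trans (ler_normB _ _) _; rewrite ger0_norm; last by case/andP: xb2.
    by move: h xb2; clear -hb b0 b10 cp cm; lra.
  have rP : `|r `^ (b - 1)| <= P.
    by rewrite ger0_norm ?powR_ge0//; apply: powR_monol => //; exact: ltW.
  apply: le_trans (ler_normD _ _) _; rewrite /D mulrDl.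
  have E : D2 * (k * b * P) / lam = D2 * (k * (b * P * lam^-1)) by ring.
  rewrite E; apply: lerD; rewrite normrM.
    rewrite -[D1 / lam]mulr1 -mulrA; apply: ler_pM => //; first exact: HD1.
    by rewrite normrM mulrC (gtr0_norm rl0) ler_pM2l.
  rewrite normrN; apply: ler_pM => //; first exact: HD2.
  rewrite normrM; apply: ler_pM => //.
  rewrite normrM (gtr0_norm rl0) ler_pM2r// normrM (gtr0_norm b0) ler_pM2l//.
have Kp : `|u * cp| <= k by rewrite /k lerDl.
have Km : `|u * cm| <= k by rewrite /k lerDr.
have hp : `|itg (lam * eps) (2 * lam) (fun s => alp s * f (phi b 1 qp s) / s)
    - ev chi x * oscint b f 1 qp (lam * eps) T| <= tol / 4 + tol / 4.
  apply: le_trans (_ : C * T / lam + (12 + 4 * D) / (b * `|qp| * T `^ b) <= _); last exact: lerD.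
  apply: (one_side of_ P1 le0 leT T2l l0 D0 C0 cutp1).
  - by move=> s s0; exact: (dr_ray b chi x.1 x.2 (-1) (u * cp) s0 rl0).
  - by move=> s _ _; exact: chi1.
  - move=> s s0 s2; have [r0 r2] := ls2 s s0 s2; have [h _] := HC x _ xQ r0 r2.
    move: h; rewrite /rayp /alp mulN1r -[u * cp * _]mulrA => h.
    by apply: le_trans h _; rewrite mulrA.
  - by move=> s s0 s2; exact: dbound.
have hm : `|itg (lam * eps) (2 * lam) (fun s => alm s * f (phi b (-1) qm s) / s)
    - ev chi x * oscint b f (-1) qm (lam * eps) T| <= tol / 4 + tol / 4.
  apply: le_trans (_ : C * T / lam + (12 + 4 * D) / (b * `|qm| * T `^ b) <= _); last exact: lerD.
  apply: (one_side of_ N1 le0 leT T2l l0 D0 C0 cutm1).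
  - by move=> s s0; exact: (dr_ray b chi x.1 x.2 1 (u * cm) s0 rl0).
  - by move=> s _ _; exact: chi1.
  - move=> s s0 s2; have [r0 r2] := ls2 s s0 s2; have [_ h] := HC x _ xQ r0 r2.
    move: h; rewrite /raym /alm mul1r -[u * cm * _]mulrA => h.
    by apply: le_trans h _; rewrite mulrA.
  - by move=> s s0 s2; exact: dbound.
have [hS hC] := SC _ _ le0 lee0 TT0.
rewrite !oscint_shift// in hp hm.
have /andP[c0 _] := chi01 x.
set Ap := itg _ _ _ in hp *; set Am := itg _ _ _ in hm *.
set chx := ev chi x in hp hm c0 *.
pose S := Sv b cp cm (u / w) (lam * eps) T; pose CC := Cv b cp cm (u / w) (lam * eps) T.
pose Y1 := cos th * oscint b (@cos R) 1 qp (lam * eps) T + sin th * oscint b (@sin R) 1 qp (lam * eps) T.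
pose Y2 := cos th * oscint b (@cos R) (-1) qm (lam * eps) T + sin th * oscint b (@sin R) (-1) qm (lam * eps) T.
have E : Ap - Am - chx * (a * sin th + c * cos th) =
  (Ap - chx * Y1) - (Am - chx * Y2) + chx * ((S - a) * sin th + (CC - c) * cos th).
  by rewrite /Y1 /Y2 /S /CC /Sv /Cv -/v -/qp -/qm; ring.
rewrite E; apply: le_trans (ler_normD _ _) _; rewrite addrC; apply: lerD.
  rewrite normrM (ger0_norm c0) mulrC ler_wpM2r//.
  apply: le_trans (ler_normD _ _) _; rewrite mulr_natl mulr2n.
  have st (z t : R) : `|t| <= 1 -> `|z| <= d -> `|z * t| <= d.
    by move=> ht hz; rewrite normrM; apply: le_trans hz; rewrite ler_piMr.
  by apply: lerD; [apply: (st _ _ (abs_sin_le1 _) hS)|apply: (st _ _ (abs_cos_le1 _) hC)].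
apply: le_trans (ler_normB _ _) _.
apply: le_trans (lerD hp hm) _; rewrite -!mulrDr.
by rewrite le_eqVlt; apply/orP; left; apply/eqP; field.
Qed.
End Asymptotics.

(** * Averages of oscillating factors *)

Section Oscillation.
Variable R : realType.
Implicit Types (e g chi : expr R) (s t : R).

Definition rowint e (x2 : R) := itg 0 1 (fun x1 => ev e (x1, x2)).

Lemma dr_line e (x1 x2 : R) : dr (fun y => ev e (y, x2)) x1 (ev (De true e) (x1, x2)).
Proof.
apply: dr_eq; first exact: (ev_curve e (dr_id x1) (dr_cst x2 x1)).
by rewrite mulr1 mulr0 addr0.
Qed.

Lemma rowint_cts e (x2 : R) : cts 0 1 (fun x1 => ev e (x1, x2)).
Proof. by move=> t _; exact: ct_dr (dr_line e t x2). Qed.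

Lemma rowintD e1 e2 x2 : rowint (EAdd e1 e2) x2 = rowint e1 x2 + rowint e2 x2.
Proof. by rewrite /rowint -itgD//; exact: rowint_cts. Qed.

Lemma rowintZ c e x2 : rowint (EMul (ECst c) e) x2 = c * rowint e x2.
Proof. by rewrite /rowint -itgZ//; exact: rowint_cts. Qed.

Lemma rowint_le e1 e2 x2 : (forall x, ev e1 x <= ev e2 x) -> rowint e1 x2 <= rowint e2 x2.
Proof. by move=> h; apply: itg_le; [exact: rowint_cts|exact: rowint_cts|move=> t _; exact: h]. Qed.

Lemma rowint_ge0 e x2 : (forall x, 0 <= ev e x) -> 0 <= rowint e x2.
Proof. by move=> h; apply: Rintegral_ge0 => t _; exact: h. Qed.

(* One integration by parts. *)
Lemma riemann_lebesgue e (k K : R -> R) (B tol : R) : (forall t, dr K t (k t)) ->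
  (forall t, ct k t) -> (forall t, `|K t| <= B) -> 0 < tol ->
  exists2 lam0 : R, 0 < lam0 & forall lam, lam0 <= lam -> forall c x2 : R, 0 <= x2 <= 1 ->
   `|itg 0 1 (fun x1 => ev e (x1, x2) * k (lam * x1 + c))| <= tol.
Proof.
move=> dK ck KB tol0.
have B0 : 0 <= B by apply: le_trans (KB 0).
have [C0 C00 H0] := ev_bound e 1.
have [C1 C10 H1] := ev_bound (De true e) 1.
have B1 : 0 < B + 1 by rewrite ltr_wpDl.
have z0 : 0 < C0 + C0 + C1 by rewrite !addr_gt0.
exists ((C0 + C0 + C1) * (B + 1) / tol); first by rewrite divr_gt0// mulr_gt0.
move=> lam hl c x2 /andP[x20 x21].
have l0 : 0 < lam by apply: lt_le_trans hl; rewrite divr_gt0// mulr_gt0.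
have X2 : `|x2| <= 1 by rewrite ger0_norm.
have dlin t : dr (fun x1 => lam * x1 + c) t lam.
  apply: dr_eq; first by apply: drD; [apply: drM; [exact: dr_cst|exact: dr_id]|exact: dr_cst].
  by rewrite /=; ring.
pose N x1 := ev e (x1, x2) * K (lam * x1 + c) / lam.
pose n1 x1 := ev e (x1, x2) * k (lam * x1 + c).
pose n2 x1 := ev (De true e) (x1, x2) * K (lam * x1 + c) / lam.
have dN t : dr N t (n1 t + n2 t).
  apply: dr_eq.
    apply: drM; last exact: dr_cst.
    apply: drM; first exact: dr_line.
    by apply: (dr_comp (dlin t)); exact: dK.
  by rewrite /n1 /n2 /=; field; rewrite gt_eqF.
have c1 t : ct n1 t.
  apply: ctM; first exact: ct_dr (dr_line e t x2).
  by apply: ct_comp; [exact: ct_dr (dlin t)|exact: ck].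
have c2 t : ct n2 t.
  apply: ctM; last exact: ct_cst.
  apply: ctM; first exact: ct_dr (dr_line _ t x2).
  by apply: ct_comp; [exact: ct_dr (dlin t)|exact: ct_dr (dK _)].
have E1 : itg 0 1 n1 = (N 1 - N 0) - itg 0 1 n2.
  rewrite -(@itg_FTC _ 0 1 (fun t => n1 t + n2 t) N ler01); last 2 first.
  - by move=> t _; apply: ctD.
  - by move=> t _; exact: dN.
  by rewrite itgD ?addrK//; move=> t _.
rewrite -/n1 E1.
have bN t : 0 <= t <= 1 -> `|N t| <= C0 * B / lam.
  move=> /andP[t0 t1]; rewrite /N !normrM normfV (gtr0_norm l0) ler_pM2r ?invr_gt0//.
  by apply: ler_pM => //; apply: H0; rewrite //= ger0_norm.
have b2 : `|itg 0 1 n2| <= C1 * B / lam.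
  have -> : C1 * B / lam = itg 0 1 (fun=> C1 * B / lam) by rewrite itg_cst// subr0 mulr1.
  apply: itg_abs; [by move=> t _|by move=> t _; exact: ct_cst|].
  move=> t /andP[t0 t1]; rewrite /n2 !normrM normfV (gtr0_norm l0) ler_pM2r ?invr_gt0//.
  by apply: ler_pM => //; apply: H1; rewrite //= ger0_norm.
apply: le_trans (_ : C0 * B / lam + C0 * B / lam + C1 * B / lam <= _).
  apply: le_trans (ler_normB _ _) _; apply: lerD => //.
  by apply: le_trans (ler_normB _ _) _; apply: lerD; apply: bN; rewrite lexx ler01.
rewrite -!mulrDl ler_pdivrMr//.
rewrite ler_pdivrMr// in hl; rewrite [tol * lam]mulrC; apply: le_trans hl.
by rewrite ler_pM2l// lerDl.
Qed.

Variables (p1 p2 : R) (hp : p1 ^+ 2 + p2 ^+ 2 = 1).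
(** With rho p1 = As - Bs and rho p2 = Bc, rho [zt] is the difference between the two limiting
    responses to a cosine wave: a sine with shifted phase. [zc] is its derivative. *)
Definition zt t := p1 * sin t - p2 * cos t.
Definition zc t := p1 * cos t + p2 * sin t.

Lemma dr_zt t : dr zt t (zc t).
Proof.
apply: dr_eq.
  apply: drD; first by apply: drM; [exact: dr_cst|exact: dr_sin].
  by apply: drN; apply: drM; [exact: dr_cst|exact: dr_cos].
by rewrite /zc /=; ring.
Qed.

Lemma dr_zc t : dr zc t (- zt t).
Proof.
apply: dr_eq.
  apply: drD; first by apply: drM; [exact: dr_cst|exact: dr_cos].
  by apply: drM; [exact: dr_cst|exact: dr_sin].
by rewrite /zt /=; ring.
Qed.

Lemma ztc t : zt t ^+ 2 + zc t ^+ 2 = 1.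
Proof.
have := cos2Dsin2 t; rewrite /zt /zc => h.
have -> : (p1 * sin t - p2 * cos t) ^+ 2 + (p1 * cos t + p2 * sin t) ^+ 2 =
  (p1 ^+ 2 + p2 ^+ 2) * (cos t ^+ 2 + sin t ^+ 2) by ring.
by rewrite hp h mulr1.
Qed.

Lemma zt_abs t : `|zt t| <= 1.
Proof.
rewrite -(@expr_le1 _ 2)// real_normK ?num_real// -(ztc t) lerDl; exact: sqr_ge0.
Qed.

Lemma zc_abs t : `|zc t| <= 1.
Proof.
rewrite -(@expr_le1 _ 2)// real_normK ?num_real// -(ztc t) lerDr; exact: sqr_ge0.
Qed.

Lemma drX (f : R -> R) t a n : dr f t a -> dr (fun y => f y ^+ n.+1) t (n.+1%:R * f t ^+ n * a).
Proof.
move=> h; elim: n => [|n IH].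
  apply: (@dr_near _ f); first by near=> y; rewrite expr1.
  by apply: dr_eq; [exact: h|rewrite expr0 !mul1r].
apply: (@dr_near _ (fun y => f y * f y ^+ n.+1)); first by near=> y; rewrite [in RHS]exprS.
apply: dr_eq; first exact: (drM h IH).
by rewrite -[n.+2%:R]natr1 !exprS; ring.
Unshelve. all: by end_near. Qed.

(** M is the mean of zc^(2n), and it decays like the inverse square root of n. The recursion comes
    from the derivative of zt zc^(2n+1), namely (2n+2) zc^(2n+2) - (2n+1) zc^(2n); it also yields
    the bounded primitive K. *)
Lemma wallis n : exists M (K : R -> R) (B : R), [/\ 0 < M, M ^+ 2 * (2 * n%:R + 1) <= 1,
  forall t, dr K t (zc t ^+ n.*2 - M) & forall t, `|K t| <= B].
Proof.
elim: n => [|n [M [K [B [M0 M1 dK KB]]]]].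
  exists 1, (fun=> 0), 0; split=> //.
  - by move=> t; apply: dr_eq; [exact: dr_cst|rewrite /= expr0 subrr].
  - by move=> t; rewrite normr0.
have n0 : 0 <= n%:R :> R by [].
have d0 : 0 < 2 * n%:R + 2 :> R by rewrite ltr_wpDl// mulr_ge0.
have d1 : 0 < 2 * n%:R + 1 :> R by rewrite ltr_wpDl// mulr_ge0.
exists (M * ((2 * n%:R + 1) / (2 * n%:R + 2))),
  (fun t => (zt t * zc t ^+ n.*2.+1 + (2 * n%:R + 1) * K t) / (2 * n%:R + 2)),
  ((1 + (2 * n%:R + 1) * B) / (2 * n%:R + 2)); split.
- by rewrite mulr_gt0// divr_gt0.
- rewrite exprMn -[n.+1%:R]natr1.
  set z : R := n%:R in n0 d0 d1 M1 *.
  have -> : M ^+ 2 * ((2 * z + 1) / (2 * z + 2)) ^+ 2 * (2 * (z + 1) + 1) =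
    (M ^+ 2 * (2 * z + 1)) * ((2 * z + 1) * (2 * z + 3) / (2 * z + 2) ^+ 2).
    by field; rewrite gt_eqF.
  have z3 : 0 <= 2 * z + 3 by move: n0; clear -p1 p2 hp; lra.
  apply: mulr_ile1 => //.
  + by apply: mulr_ge0; [exact: sqr_ge0|exact: ltW].
  + by apply: divr_ge0; [apply: mulr_ge0 => //; exact: ltW|exact: sqr_ge0].
  + rewrite ler_pdivrMr ?exprn_gt0// mul1r; move: (z) n0 => y; clear -p1 p2 hp; nra.
- move=> t; apply: dr_eq.
    apply: drM; last exact: dr_cst.
    apply: drD.
      by apply: drM; [exact: dr_zt|exact: (drX _ (dr_zc t))].
    by apply: drM; [exact: dr_cst|exact: dK].
  rewrite doubleS -[n.*2.+1%:R]natr1 -mul2n natrM !exprS.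
  have h : zt t * zt t = 1 - zc t * zc t by rewrite -(ztc t) !expr2; ring.
  set c := zc t ^+ (2 * n); set y := zt t in h *; set x := zc t in h *; set z : R := n%:R in d0 *.
  rewrite /= mulr0 addr0.
  have -> : y * ((2 * z + 1) * c * - y) = - ((2 * z + 1) * c * (y * y)) by ring.
  by rewrite h; field; rewrite gt_eqF.
- move=> t; rewrite normrM normfV (gtr0_norm d0) ler_pM2r ?invr_gt0//.
  apply: le_trans (ler_normD _ _) _; apply: lerD.
    rewrite normrM normrX; apply: mulr_ile1 => //; first exact: zt_abs.
    by apply: exprn_ile1 => //; exact: zc_abs.
  by rewrite normrM (gtr0_norm d1) ler_pM2l.
Qed.

Lemma bernoulli (y : R) n : 0 <= y <= 1 -> 1 - n%:R * y <= (1 - y) ^+ n.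
Proof.
move=> /andP[y0 y1]; elim: n => [|n IH]; first by rewrite mul0r subr0 expr0.
rewrite exprS -[n.+1%:R]natr1; apply: le_trans (_ : (1 - y) * (1 - n%:R * y) <= _).
  have : 0 <= n%:R * (y * y) by rewrite !mulr_ge0.
  by move: (n%:R : R) => z; clear -p1 p2 hp; nra.
by rewrite ler_wpM2l// subr_ge0.
Qed.

Lemma flat0_sum (y : R) : y != 0 -> 1 - `|y|^-1 <= flat 0 y + flat 0 (- y).
Proof.
move=> y0.
have -> : flat 0 y + flat 0 (- y) = expR (- `|y|^-1).
  rewrite /flat !expr0 !mul1r; case: (ltgtP y 0) y0 => // h _.
    by rewrite oppr_gt0 h add0r ltr0_norm.
  by rewrite oppr_gt0 ltNge (ltW h) /= addr0 gtr0_norm.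
exact: expR_ge1Dx.
Qed.

(** The two smoothed indicators add up to exp(-eta/|z|), which is far from 1 only for small |z|. A
    high even power of zc is close to 1 there and has small mean: it majorises the loss and, unlike
    an indicator, has an explicit bounded oscillating primitive. *)
Lemma split_loss (kap : R) : 0 < kap -> kap <= 1 -> exists (eta M : R) n (K : R -> R) (B : R),
  [/\ 0 < eta, M <= kap / 2, forall t, dr K t (zc t ^+ n.*2 - M), forall t, `|K t| <= B &
   forall t, 1 - (flat 0 (eta^-1 * zt t) + flat 0 (- eta^-1 * zt t)) <= kap / 2 + zc t ^+ n.*2].
Proof.
move=> k0 k1; have k20 : 0 < kap / 2 by rewrite divr_gt0.
have [n hn] : exists n, ((kap / 2) ^+ 2)^-1 <= n.+1%:R.
  exists (Num.truncn ((kap / 2) ^+ 2)^-1); apply: ltW; apply: truncnS_gt.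
have [M [K [B [M0 M1 dK KB]]]] := wallis n.+1.
have n10 : 0 < n.+1%:R :> R by [].
(* Below y0, Bernoulli's inequality gives zc^(2(n+1)) >= 1 - (n+1) y0 = 1 - kap/2; above y0, eta/|z|
   is at most kap/2 because eta = (kap/2) y0. *)
pose y0 := kap / 2 / n.+1%:R.
have y00 : 0 < y0 by rewrite divr_gt0.
have y01 : y0 <= 1.
  rewrite /y0 ler_pdivrMr// mul1r; apply: le_trans (_ : 1 <= _); last by rewrite ler1n.
  by move: k1; clear -p1 p2 hp; lra.
have Mk : M <= kap / 2.
  rewrite leNgt; apply/negP => h.
  have h1 : (kap / 2) * (kap / 2) < M * M by apply: ltr_pM => //; exact: ltW.
  have h2 : 1 <= n.+1%:R * ((kap / 2) * (kap / 2)).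
    by rewrite -expr2 -ler_pdivrMr ?exprn_gt0// div1r.
  move: M1; rewrite expr2 leNgt => /negP; apply.
  apply: le_lt_trans h2 _; apply: lt_le_trans (_ : n.+1%:R * (M * M) <= _).
    by rewrite ltr_pM2l.
  rewrite mulrC ler_wpM2l// ?mulr_ge0 ?(ltW M0)//.
  by move: (n.+1%:R : R) n10 => z; clear -p1 p2 hp; lra.
exists (kap / 2 * y0), M, n.+1, K, B; split => //.
  by rewrite mulr_gt0.
move=> t; set eta := kap / 2 * y0.
have eta0 : 0 < eta by rewrite mulr_gt0.
have zc2 : zc t ^+ n.+1.*2 = (1 - zt t ^+ 2) ^+ n.+1.
  by rewrite -(ztc t) addrC addKr -exprM mul2n.
have z21 : 0 <= zt t ^+ 2 <= 1.
  by rewrite sqr_ge0 -real_normK ?num_real// expr_le1// zt_abs.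
have [yz|zy] := leP y0 `|zt t|.
  have z0 : 0 < `|zt t| by apply: lt_le_trans yz.
  have zn0 : eta^-1 * zt t != 0.
    by apply: mulf_neq0; [rewrite invr_eq0 gt_eqF|rewrite -normr_gt0].
  have := flat0_sum zn0; rewrite mulNr => h.
  have : `|eta^-1 * zt t|^-1 <= kap / 2.
    rewrite normrM invfM normfV invrK (gtr0_norm eta0) ler_pdivrMr//.
    by rewrite /eta ler_pM2l.
  have : 0 <= zc t ^+ n.+1.*2 by rewrite zc2 exprn_ge0// subr_ge0; case/andP: z21.
  by move: h; clear -p1 p2 hp; lra.
have h : 1 - n.+1%:R * zt t ^+ 2 <= zc t ^+ n.+1.*2 by rewrite zc2 bernoulli.
have h2 : n.+1%:R * zt t ^+ 2 <= kap / 2.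
  have h3 : `|zt t| * `|zt t| <= y0 * 1.
    by apply: ler_pM => //; [exact: ltW|exact: zt_abs].
  rewrite -real_normK ?num_real// expr2; apply: le_trans (_ : n.+1%:R * y0 <= _).
    by rewrite ler_pM2l//; move: h3; rewrite mulr1.
  by rewrite /y0 mulrC divfK// gt_eqF.
have f1 := flat_ge0 0 (eta^-1 * zt t); have f2 := flat_ge0 0 (- eta^-1 * zt t).
by move: h h2 f1 f2; clear -p1 p2 hp; lra.
Qed.

(** Square the bound e^(z/2) <= 1/(1 - z/2); the product (1 + z + z^2)(1 - z/2)^2 exceeds 1 by z^2
    (1 - 3z + z^2)/4. *)
Lemma expR_quad (z : R) : `|z| <= 1 / 4 -> expR z <= 1 + z + z ^+ 2.
Proof.
move=> hz; have /andP[z1 z2] : - (1 / 4) <= z <= 1 / 4 by rewrite -ler_norml.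
have h2 : 0 < 1 - z / 2 by move: z2; clear -p1 p2 hp; lra.
have h : expR (z / 2) <= (1 - z / 2)^-1.
  rewrite -[z / 2]opprK expRN lef_pV2 ?posrE ?expR_gt0//; last by rewrite opprK.
  by rewrite opprK; apply: le_trans (expR_ge1Dx _); rewrite lexx.
have -> : expR z = expR (z / 2) * expR (z / 2).
  by rewrite -expRD; congr expR; field.
apply: le_trans (_ : (1 - z / 2)^-1 * (1 - z / 2)^-1 <= _).
  by apply: ler_pM => //; exact: expR_ge0.
rewrite -invfM -[leLHS]div1r ler_pdivrMr ?mulr_gt0//.
move: z1 z2; clear -p1 p2 hp => z1 z2.
have -> : (1 + z + z ^+ 2) * ((1 - z / 2) * (1 - z / 2)) =
  1 + z ^+ 2 / 4 * (1 - 3 * z + z ^+ 2) by field.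
rewrite lerDl mulr_ge0// ?divr_ge0 ?sqr_ge0//.
have := sqr_ge0 z; lra.
Qed.
End Oscillation.

(** * Largeness conditions and the arithmetic of one level of the tree *)

Section Eventually.
Variable R : realType.

Definition evtl (P : R -> Prop) := exists2 l0 : R, 0 < l0 & forall lam, l0 <= lam -> P lam.

Lemma evtl_and (P P' : R -> Prop) : evtl P -> evtl P' -> evtl (fun l => P l /\ P' l).
Proof.
move=> [l1 p1 h1] [l2 p2 h2]; exists (Num.max l1 l2); first by rewrite lt_max p1.
by move=> l; rewrite ge_max => /andP[k1 k2]; split; [exact: h1|exact: h2].
Qed.

Lemma evtl_imp (P P' : R -> Prop) : (forall l, P l -> P' l) -> evtl P -> evtl P'.
Proof. by move=> h [l1 p1 h1]; exists l1 => // l hl; apply: h; exact: h1. Qed.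

Lemma evtl_all n (P : nat -> R -> Prop) : (forall j, evtl (P j)) ->
  evtl (fun l => forall j, (j <= n)%N -> P j l).
Proof.
move=> h; elim: n => [|n IH].
  by apply: evtl_imp (h 0%N) => l hl j; rewrite leqn0 => /eqP ->.
apply: evtl_imp (evtl_and IH (h n.+1)) => l [h1 h2] j.
by rewrite leq_eqVlt => /orP[/eqP -> //|]; exact: h1.
Qed.

Lemma half_add (k m y : R) : m <= k / 2 -> 0 <= y -> (k / 2 + m) * y <= k * y.
Proof. by move=> h y0; rewrite ler_wpM2r//; lra. Qed.

Lemma deficit (k y z v dev tol : R) : y - z <= v + dev -> v <= k * y -> dev <= tol ->
  (1 - k) * y <= z + tol.
Proof. by move=> h1 h2 h3; rewrite mulrBl mul1r; move: (k * y) h2 => w h2; lra. Qed.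

Lemma gain_arith (i1 i2 y tol : R) : `|i1| <= tol / 2 -> `|i2| <= tol / 2 ->
  y / 4 <= 1 / 2 * i1 + (1 / 2 * i2 + 1 / 4 * y) + tol.
Proof. by rewrite !ler_norml => *; lra. Qed.

Lemma compose3 (t1 t2 t3 y1 y2 y3 y4 : R) : y2 <= y1 + t1 -> y3 <= y2 + t2 -> y4 <= y3 + t3 ->
  y4 <= y1 + (t1 + t2 + t3).
Proof. by move=> *; lra. Qed.

Lemma mass_arith (k P y yl yr ol or_ t : R) : 0 <= P -> P <= 1 -> 0 <= t ->
  (1 - k) * y <= yl + yr + t -> P * yl <= ol + t -> P * yr <= or_ + t ->
  (1 - k) * P * y <= ol + or_ + (t + t + t).
Proof.
move=> P0 P1 t0 h1 h2 h3.
have h4 : P * ((1 - k) * y) <= P * (yl + yr + t) by rewrite ler_wpM2l.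
have h5 : P * t <= t by rewrite ler_piMl.
have -> : (1 - k) * P * y = P * ((1 - k) * y) by ring.
move: h4; rewrite !mulrDr; move: (P * _) (P * yl) (P * yr) (P * t) h2 h3 h5 => *; lra.
Qed.

Lemma gain_sum_arith (n k P y yl yr tl tr g t : R) : 0 <= n -> 0 <= k -> k <= 1 ->
  0 <= P -> P <= 1 -> 0 <= t -> 0 <= y ->
  (1 - k) * y <= yl + yr + t -> y / 4 <= g + t ->
  n / 4 * P * yl <= tl + t -> n / 4 * P * yr <= tr + t ->
  (n + 1) / 4 * ((1 - k) * P) * y <= g + tl + tr + (t + t + t + n * t).
Proof.
move=> n0 k0 k1 P0 P1 t0 y0 h1 h2 h3 h4.
have nP : 0 <= n / 4 * P by rewrite mulr_ge0// divr_ge0.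
have h5 : n / 4 * P * ((1 - k) * y) <= n / 4 * P * (yl + yr + t) by rewrite ler_wpM2l.
have h6 : n / 4 * P * t <= n * t.
  by rewrite ler_wpM2r//; apply: le_trans (_ : n / 4 <= _); [rewrite ler_piMr// divr_ge0|lra].
have h7 : (1 - k) * P * y <= y.
  by rewrite -[leRHS]mul1r ler_wpM2r//; apply: mulr_ile1 => //; lra.
have -> : (n + 1) / 4 * ((1 - k) * P) * y = n / 4 * P * ((1 - k) * y) + (1 - k) * P * y / 4.
  by field.
move: h5; rewrite !mulrDr => h5.
move: (n / 4 * P * ((1 - k) * y)) (n / 4 * P * yl) (n / 4 * P * yr) (n / 4 * P * t)
  ((1 - k) * P * y) h3 h4 h5 h6 h7 => *; lra.
Qed.

(** At a point of the left child the responses at [u j] and [u J] differ by r c z, which dominates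
    the gain since z^2 <= z. The two multiplier errors cost 4 d, and the right child contributes
    only tolerances. *)
Lemma on_left_arith (r z c As Bs Bc p1 p2 sn cs d t t1 n tl wj wJ lj lJ rj rJ : R) :
  0 < r -> 0 <= c -> c <= 1 -> 0 <= d -> 0 < z -> z <= 1 -> 0 <= t ->
  r * p1 = As - Bs -> r * p2 = Bc -> z = p1 * sn - p2 * cs ->
  `|wj - c * (As * sn)| <= 2 * d * c + t ->
  `|wJ - c * (Bs * sn + Bc * cs)| <= 2 * d * c + t ->
  r * tl - 4 * d * n - t <= lj - lJ -> `|rj| <= t -> `|rJ| <= t -> 5 * t <= t1 ->
  r * (1 / 2 * (c * (z + z * z)) + tl + 0) - 4 * d * (n + 1) - t1 <=
    wj + lj + rj - (wJ + lJ + rJ).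
Proof.
move=> r0 c0 c1 d0 z0 z1 t0 e1 e2 ez h1 h2 h3 h4 h5 h6.
have E : c * (As * sn) - c * (Bs * sn + Bc * cs) = r * (c * z).
  have eA : As = r * p1 + Bs by rewrite e1 subrK.
  by rewrite ez -e2 eA; ring.
have h7 : r * (1 / 2 * (c * (z + z * z))) <= r * (c * z).
  have hz : z * z <= z by rewrite ler_piMr// ltW.
  by rewrite ler_pM2l// mulrCA ler_wpM2l//; lra.
have h8 : d * c <= d by rewrite ler_piMr.
set X := r * (1 / 2 * _) in h7; set P := c * (As * sn) in h1 E.
set P' := c * (Bs * sn + _) in h2 E; set Y := r * (c * z) in h7 E.
have -> : r * (1 / 2 * (c * (z + z * z)) + tl + 0) = X + r * tl by rewrite /X; ring.
have -> : 4 * d * (n + 1) = 4 * (d * n) + 4 * d by ring.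
have e3 : 4 * d * n = 4 * (d * n) by ring.
have e4 : 2 * d * c = 2 * (d * c) by ring.
rewrite e3 in h3; rewrite e4 in h1 h2.
move: h1 h2 h3 h4 h5 h6 h7 h8 E; rewrite !ler_norml.
move: X P P' Y (r * tl) (d * n) (d * c) => X P P' Y Z1 Z2 Z3; clear.
move=> /andP[a1 a2] /andP[a3 a4] a5 /andP[a6 a7] /andP[a8 a9] *; lra.
Qed.

(** At a point of the right child both responses are close to the same X and cancel, and the gain is
    not positive, as z + z^2 <= 0 on [-1, 0]. *)
Lemma on_right_arith (r z c X d t t1 n tr wj wJ lj lJ rj rJ : R) :
  0 < r -> 0 <= c -> c <= 1 -> 0 <= d -> z <= 0 -> -1 <= z -> 0 <= t ->
  `|wj - X| <= 2 * d * c + t -> `|wJ - X| <= 2 * d * c + t ->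
  r * tr - 4 * d * n - t <= rj - rJ -> `|lj| <= t -> `|lJ| <= t -> 5 * t <= t1 ->
  r * (1 / 2 * (c * (z + z * z)) + 0 + tr) - 4 * d * (n + 1) - t1 <=
    wj + lj + rj - (wJ + lJ + rJ).
Proof.
move=> r0 c0 c1 d0 z0 z1 t0 h1 h2 h3 h4 h5 h6.
have h7 : r * (1 / 2 * (c * (z + z * z))) <= 0.
  have hz : 0 <= - z * (1 + z) by apply: mulr_ge0; lra.
  have : 0 <= r * (1 / 2 * (c * (- z * (1 + z)))).
    by apply: mulr_ge0; [exact: ltW|apply: mulr_ge0 => //; exact: mulr_ge0].
  have -> : - z * (1 + z) = - (z + z * z) by ring.
  by rewrite !mulrN oppr_ge0.
have h8 : d * c <= d by rewrite ler_piMr.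
set Y := r * (1 / 2 * _) in h7.
have -> : r * (1 / 2 * (c * (z + z * z)) + 0 + tr) = Y + r * tr by rewrite /Y; ring.
have -> : 4 * d * (n + 1) = 4 * (d * n) + 4 * d by ring.
have e3 : 4 * d * n = 4 * (d * n) by ring.
have e4 : 2 * d * c = 2 * (d * c) by ring.
rewrite e3 in h3; rewrite e4 in h1 h2.
move: h1 h2 h3 h4 h5 h6 h7 h8; rewrite !ler_norml.
move: Y (r * tr) (d * n) (d * c) => Y Z1 Z2 Z3; clear.
move=> /andP[a1 a2] /andP[a3 a4] a5 /andP[a6 a7] /andP[a8 a9] *; lra.
Qed.

Lemma tol_arith (t n tol : R) : 0 < t -> 0 <= n -> t * (8 * (n + 1)) = tol ->
  [/\ t + t + t <= tol, 5 * t <= tol & t + t + t + n * t <= tol].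
Proof.
move=> t0 n0 <-; have h : 0 <= n * t by rewrite mulr_ge0// ltW.
have -> : t * (8 * (n + 1)) = 8 * (n * t) + 8 * t by ring.
by split; lra.
Qed.

Lemma half_arith (z : R) : -1 <= z -> z <= 1 -> 1 / 2 * (z + z * z) <= 1.
Proof. by move=> z1 z2; nra. Qed.

End Eventually.

(** * The tree of waves *)

Section Tree.
Variable R : realType.
Variables (b : R) (hb : 1 < b) (cp cm : R) (hcp : cp != 0) (hcm : cm != 0).
Variables (As Bs Bc K d rho p1 p2 : R).
Hypotheses (d0 : 0 < d) (K1 : 1 < K) (rho0 : 0 < rho) (hp : p1 ^+ 2 + p2 ^+ 2 = 1)
  (rp1 : rho * p1 = As - Bs) (rp2 : rho * p2 = Bc).
Hypothesis hS : forall v, 0 < v -> v * K <= 1 -> exists e0 T0 : R, 0 < e0 /\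
     forall e T, 0 < e -> e <= e0 -> T0 <= T ->
       `|Sv b cp cm v e T - As| <= d /\ `|Cv b cp cm v e T| <= d.
Hypothesis hL : forall v, K <= v -> exists e0 T0 : R, 0 < e0 /\
     forall e T, 0 < e -> e <= e0 -> T0 <= T ->
       `|Sv b cp cm v e T - Bs| <= d /\ `|Cv b cp cm v e T - Bc| <= d.
Variables (kap eta M : R) (nn : nat) (Kf : R -> R) (Bf : R).
Hypotheses (kap0 : 0 < kap) (kap1 : kap <= 1) (eta0 : 0 < eta) (Mk : M <= kap / 2)
  (dKf : forall t, dr Kf t (zc p1 p2 t ^+ nn.*2 - M)) (KfB : forall t, `|Kf t| <= Bf)
  (hloss : forall t, 1 - (flat 0 (eta^-1 * zt p1 p2 t) + flat 0 (- eta^-1 * zt p1 p2 t))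
      <= kap / 2 + zc p1 p2 t ^+ nn.*2).
Variable u : nat -> R.
Hypotheses (u0 : forall j, 0 < u j) (uK : forall j, u j * K ^+ 2 <= u j.+1).
Implicit Types (g chi F V T O : expr R) (s tol lam w : R).

Definition zE lam w : expr R :=
  EAdd (EMul (ECst p1) (ESin (phase b lam w))) (EMul (ECst (- p2)) (ECos (phase b lam w))).
(* [flat 0 (z / eta)] and [flat 0 (- z / eta)] are smooth substitutes for the
   indicators of z > 0 and z < 0. *)
Definition chL chi lam w := EMul chi (EFlat 0 (EMul (ECst eta^-1) (zE lam w))).
Definition chR chi lam w := EMul chi (EFlat 0 (EMul (ECst (- eta^-1)) (zE lam w))).
(** The exponential supermartingale: the term in V compensates the quadratic variation, and tilts of
    sums are products of tilts. *)
Definition tilt s F V : expr R := EExp (EAdd (EMul (ECst s) F) (EMul (ECst (- s ^+ 2)) V)).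
(* (z + z^2) / 2 is at most the positive part of z when |z| <= 1, yet for a
   sinusoid z it has mean 1/4. *)
Definition gain chi lam w : expr R :=
  EMul (ECst (1 / 2)) (EMul chi (EAdd (zE lam w) (EMul (zE lam w) (zE lam w)))).

Lemma zE_ev lam w x : ev (zE lam w) x = zt p1 p2 (ev (phase b lam w) x).
Proof. by rewrite /= /zt mulNr. Qed.

Lemma rowint_eq (e1 e2 : expr R) (x2 : R) : (forall x, ev e1 x = ev e2 x) -> @rowint R e1 x2 = rowint e2 x2.
Proof. by move=> h; apply: itg_ext => t _; exact: h. Qed.

(* e^z <= 1 + z + z^2 for small z, and the linear term averages out. *)
Lemma tilt_evtl chi g s tol w : (forall x, 0 <= ev chi x <= 1) -> (forall x, 0 <= ev g x) ->
  `|s| <= 1 / 4 -> 0 < tol ->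
  evtl (fun lam => forall x2 : R, 0 <= x2 <= 1 ->
    rowint (EMul g (tilt s (wave b chi lam w) (EMul chi chi))) x2 <= rowint g x2 + tol).
Proof.
move=> chi01 g0 s4 tol0.
pose a := EMul g (EMul chi (EExp (EMul (ECst (- s ^+ 2)) (EMul chi chi)))).
have [l0 l00 H] := @riemann_lebesgue R a (@cos R) (@sin R) 1 tol (@dr_sin R)
  (fun t => ct_dr (dr_cos t)) (@abs_sin_le1 R) tol0.
exists l0 => // lam hl x2 hx2.
pose aw := EMul a (ECos (phase b lam w)).
apply: le_trans (_ : rowint (EAdd g (EMul (ECst s) aw)) x2 <= _).
  apply: rowint_le => x /=.
  set c := cos _; set ch := ev chi x; set gg := ev g x.
  have /andP[ch0 ch1] : 0 <= ch <= 1 := chi01 x.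
  have c1 : `|c| <= 1 := abs_cos_le1 _.
  set q := s ^+ 2 * (ch * ch); set z := s * (ch * c).
  have zq : z ^+ 2 <= q.
    rewrite /z /q; have -> : (s * (ch * c)) ^+ 2 = s ^+ 2 * (ch * ch) * (c ^+ 2) by ring.
    rewrite ler_piMr//; first by apply: mulr_ge0; [exact: sqr_ge0|exact: mulr_ge0].
    by rewrite -real_normK ?num_real// expr_le1.
  have z4 : `|z| <= 1 / 4.
    apply: le_trans s4; rewrite /z normrM ler_piMr// normrM mulr_ile1//.
    by rewrite ger0_norm.
  rewrite expRD mulNr -/q.
  have eq0 := expR_gt0 (- q).
  have h1 : expR (- q) * (1 + q) <= 1.
    rewrite expRN mulrC ler_pdivrMr ?expR_gt0// mul1r; exact: expR_ge1Dx.
  have h2 := expR_quad z4.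
  have -> : gg + s * (gg * (ch * expR (- q)) * c) = gg * (1 + z * expR (- q)).
    by rewrite /z; ring.
  rewrite ler_wpM2l ?g0//.
  apply: le_trans (_ : (1 + z + q) * expR (- q) <= _).
    rewrite ler_pM2r//; apply: le_trans h2 _; by rewrite lerD2l.
  have -> : (1 + z + q) * expR (- q) = expR (- q) * (1 + q) + z * expR (- q) by ring.
  by rewrite lerD2r.
rewrite rowintD rowintZ lerD2l.
have h := H lam hl (lam `^ b / w * x2) x2 hx2.
apply: le_trans (ler_norm _) _; rewrite normrM.
apply: le_trans (_ : 1 * `|rowint aw x2| <= _); last by rewrite mul1r.
by rewrite ler_wpM2r//; apply: le_trans s4 _; rewrite ler_pdivrMr// mul1r ler1n.
Qed.

(** By [split_loss] the missing mass is at most that of chi times kap/2 + zc^(2n); M <= kap/2 bounds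
    the mean of the power, and the oscillation around M integrates to at most [tol]. *)
Lemma split_evtl chi tol w : (forall x, 0 <= ev chi x <= 1) -> 0 < tol ->
  evtl (fun lam => forall x2 : R, 0 <= x2 <= 1 ->
    (1 - kap) * rowint chi x2 <= rowint (chL chi lam w) x2 + rowint (chR chi lam w) x2 + tol).
Proof.
move=> chi01 tol0.
have cont t : ct (fun t => zc p1 p2 t ^+ nn.*2 - M) t.
  apply: ctD; last exact: ct_cst.
  case: (nn) => [|n]; first by rewrite /ct /= ; exact: cvg_cst.
  by apply: (@ct_dr _ _ _ _); rewrite doubleS; exact: (drX _ (dr_zc p1 p2 t)).
have [l0 l00 H] := @riemann_lebesgue R chi _ Kf Bf tol dKf cont KfB tol0.
exists l0 => // lam hl x2 hx2.
have h := H lam hl (lam `^ b / w * x2) x2 hx2.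
set dev := itg _ _ _ in h.
have cd : cts 0 1 (fun y : R => ev chi (y, x2) * (zc p1 p2 (lam * y + lam `^ b / w * x2) ^+ nn.*2 - M)).
  move=> t ht; apply: ctM; first exact: (@rowint_cts R chi x2 t ht).
  apply: (@ct_comp R (fun t => zc p1 p2 t ^+ nn.*2 - M)); last exact: cont.
  by apply: ctD; [apply: ctM; [exact: ct_cst|exact: ct_id]|exact: ct_cst].
have H1 : rowint chi x2 - (rowint (chL chi lam w) x2 + rowint (chR chi lam w) x2) <=
    (kap / 2 + M) * rowint chi x2 + dev.
  rewrite -rowintD /dev -itgZ; last exact: rowint_cts.
  rewrite -itgD//; last first.
    by move=> t ht; apply: ctM; [exact: ct_cst|exact: (@rowint_cts R chi x2 t ht)].
  rewrite -itgB; [|exact: rowint_cts|exact: rowint_cts].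
  apply: itg_le.
  - by move=> t ht; apply: ctD; [exact: (@rowint_cts R chi x2 t ht)|apply: ctN; exact: (@rowint_cts R (EAdd _ _) x2 t ht)].
  - by move=> t ht; apply: ctD; [apply: ctM; [exact: ct_cst|exact: (@rowint_cts R chi x2 t ht)]|exact: cd].
  - move=> t _; set th := lam * t + _.
    have := hloss th; have /andP[c0 _] := chi01 (t, x2).
    have zz : p1 * sin th + - p2 * cos th = zt p1 p2 th by rewrite /zt mulNr.
    rewrite /= -/th zz.
    set c := ev chi _ in c0 *; set a1 := flat 0 _; set a2 := flat 0 _; set a3 := _ ^+ _.
    move=> hl'; have := ler_wpM2l c0 hl'.
    have -> : c - (c * a1 + c * a2) = c * (1 - (a1 + a2)) by ring.
    move=> h'; apply: le_trans h' _; rewrite le_eqVlt; apply/orP; left; apply/eqP; ring.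
have cE : 0 <= rowint chi x2 by apply: rowint_ge0 => x; case/andP: (chi01 x).
have h2 : dev <= tol by apply: le_trans h; exact: ler_norm.
exact: deficit H1 (half_add Mk cE) h2.
Qed.

Lemma gain_evtl chi tol w : (forall x, 0 <= ev chi x <= 1) -> 0 < tol ->
  evtl (fun lam => forall x2 : R, 0 <= x2 <= 1 ->
    rowint chi x2 / 4 <= rowint (gain chi lam w) x2 + tol).
Proof.
move=> chi01 tol0; have tol2 : 0 < tol / 2 by rewrite divr_gt0.
have dK1 t : dr (fun t => - zc p1 p2 t) t (zt p1 p2 t).
  by apply: dr_eq; [apply: drN; exact: dr_zc|rewrite opprK].
have dK2 t : dr (fun t => - 1 / 2 * (zt p1 p2 t * zc p1 p2 t)) t (zt p1 p2 t ^+ 2 - 1 / 2).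
  apply: dr_eq.
    by apply: drM; [exact: dr_cst|exact: (drM (dr_zt p1 p2 t) (dr_zc p1 p2 t))].
  have := ztc hp t; rewrite /=; set y := zt _ _ _; set z := zc _ _ _ => h.
  have -> : z * z = 1 - y ^+ 2 by rewrite -h; ring.
  by field.
have c1 t : ct (zt p1 p2) t by exact: ct_dr (dr_zt p1 p2 t).
have c2 t : ct (fun t => zt p1 p2 t ^+ 2 - 1 / 2) t.
  apply: ctD; last exact: ct_cst.
  exact: ct_dr (drX 1 (dr_zt p1 p2 t)).
have B1 t : `|- zc p1 p2 t| <= 1 by rewrite normrN zc_abs.
have B2 t : `|- 1 / 2 * (zt p1 p2 t * zc p1 p2 t)| <= 1.
  rewrite normrM; apply: mulr_ile1 => //.
    by rewrite mulNr normrN ger0_norm ?divr_ge0// ler_pdivrMr// mul1r ler1n.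
  by rewrite normrM; apply: mulr_ile1 => //; [exact: zt_abs|exact: zc_abs].
have [l1 l10 H1] := @riemann_lebesgue R chi _ _ _ (tol / 2) dK1 c1 B1 tol2.
have [l2 l20 H2] := @riemann_lebesgue R chi _ _ _ (tol / 2) dK2 c2 B2 tol2.
exists (Num.max l1 l2); first by rewrite lt_max l10.
move=> lam; rewrite ge_max => /andP[hl1 hl2] x2 hx2.
have h1 := H1 lam hl1 (lam `^ b / w * x2) x2 hx2.
have h2 := H2 lam hl2 (lam `^ b / w * x2) x2 hx2.
have cl (f : R -> R) (t : R) : (forall y, ct f y) ->
    ct (fun y : R => f (lam * y + lam `^ b / w * x2)) t.
  move=> cf; apply: ct_comp; last exact: cf.
  by apply: ctD; [apply: ctM; [exact: ct_cst|exact: ct_id]|exact: ct_cst].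
have C (f : R -> R) : (forall y, ct f y) ->
    cts 0 1 (fun y : R => ev chi (y, x2) * f (lam * y + lam `^ b / w * x2)).
  by move=> cf t ht; apply: ctM; [exact: (@rowint_cts R chi x2 t ht)|exact: cl].
have EG : rowint (gain chi lam w) x2 = 1 / 2 * itg 0 1 (fun y : R => ev chi (y, x2) *
      zt p1 p2 (lam * y + lam `^ b / w * x2)) +
   (1 / 2 * itg 0 1 (fun y : R => ev chi (y, x2) *
      (zt p1 p2 (lam * y + lam `^ b / w * x2) ^+ 2 - 1 / 2)) + 1 / 4 * rowint chi x2).
  have cE := @rowint_cts R chi x2.
  rewrite /rowint -!itgZ//; try exact: cE; try exact: (C _ c1); try exact: (C _ c2).
  have z1 : cts 0 1 (fun s => 1 / 2 * (ev chi (s, x2) * zt p1 p2 (lam * s + lam `^ b / w * x2))).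
    by move=> t ht; apply: ctM; [exact: ct_cst|exact: (C _ c1 t ht)].
  have z2 : cts 0 1 (fun s => 1 / 2 * (ev chi (s, x2) * (zt p1 p2 (lam * s + lam `^ b / w * x2) ^+ 2 - 1 / 2))).
    by move=> t ht; apply: ctM; [exact: ct_cst|exact: (C _ c2 t ht)].
  have z3 : cts 0 1 (fun s => 1 / 4 * ev chi (s, x2)).
    by move=> t ht; apply: ctM; [exact: ct_cst|exact: cE].
  rewrite -(itgD z2 z3) -itgD//; last by move=> t ht; apply: ctD; [exact: z2|exact: z3].
  apply: itg_ext => t _; rewrite /gain.
  rewrite -[LHS]/(1 / 2 * (ev chi (t, x2) * (ev (zE lam w) (t, x2) + ev (zE lam w) (t, x2) * ev (zE lam w) (t, x2)))).
  rewrite zE_ev -[ev (phase _ _ _) _]/(lam * t + lam `^ b / w * x2).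
  set z := zt _ _ _; set c := ev _ _; by field.
by rewrite EG; exact: gain_arith.
Qed.

Lemma wave_evtl chi tol w j : suppQ chi -> (forall x, 0 <= ev chi x <= 1) -> 0 < tol -> 0 < w ->
  evtl (fun lam => forall x, inQ x ->
    (u j * K <= w -> `|He b cp cm (wave b chi lam w) (u j) x -
       ev chi x * (As * sin (ev (phase b lam w) x))| <= 2 * d * ev chi x + tol) /\
    (w * K <= u j -> `|He b cp cm (wave b chi lam w) (u j) x -
       ev chi x * (Bs * sin (ev (phase b lam w) x) + Bc * cos (ev (phase b lam w) x))|
          <= 2 * d * ev chi x + tol)).
Proof.
move=> sQ chi01 tol0 w0.
have v0 : 0 < u j / w by rewrite divr_gt0.
have S : evtl (fun lam => forall x, inQ x -> u j * K <= w ->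
   `|He b cp cm (wave b chi lam w) (u j) x -
       ev chi x * (As * sin (ev (phase b lam w) x))| <= 2 * d * ev chi x + tol).
  (* Outside this regime the implication is vacuous and any frequency will do. *)
  have [hk|hk] := leP (u j * K) w; last first.
    by exists 1 => // lam _ x _ h; have := le_lt_trans h hk; rewrite ltxx.
  have vK : u j / w * K <= 1 by rewrite mulrAC ler_pdivrMr// mul1r.
  have [e0 [T0 [e00 h]]] := hS v0 vK.
  have h' (e T : R) : 0 < e -> e <= e0 -> T0 <= T ->
     `|Sv b cp cm (u j / w) e T - As| <= d /\ `|Cv b cp cm (u j / w) e T - 0| <= d.
    by rewrite subr0; exact: h.
  have [l0 l00 H] := He_wave hb hcp hcm sQ chi01 (u0 j) w0 tol0 e00 h'.
  exists l0 => // lam hl x xQ _.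
  by have := H lam hl x xQ; rewrite mul0r addr0.
have L : evtl (fun lam => forall x, inQ x -> w * K <= u j ->
   `|He b cp cm (wave b chi lam w) (u j) x -
       ev chi x * (Bs * sin (ev (phase b lam w) x) + Bc * cos (ev (phase b lam w) x))|
          <= 2 * d * ev chi x + tol).
  have [hk|hk] := leP (w * K) (u j); last first.
    by exists 1 => // lam _ x _ h; have := le_lt_trans h hk; rewrite ltxx.
  have vK : K <= u j / w by rewrite ler_pdivlMr// mulrC.
  have [e0 [T0 [e00 h]]] := hL vK.
  have [l0 l00 H] := He_wave hb hcp hcm sQ chi01 (u0 j) w0 tol0 e00 h.
  by exists l0 => // lam hl x xQ _; exact: H.
apply: evtl_imp (evtl_and S L) => lam [h1 h2] x xQ; split => h; [exact: h1|exact: h2].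
Qed.
(* [F] is the sum of the waves of a tree of depth [m] grown from the cell [chi],
   [V] bounds its quadratic variation, [T] is the sum of the gains, [O] the sum of
   the leaves, and [g1], [g2] are the tilts already accumulated outside the cell. *)
Record built (m : nat) (chi g1 g2 : expr R) (s tol : R) (i J : nat)
    (F V T O : expr R) : Prop := Built {
  b_supp : forall x, ev chi x = 0 -> [/\ ev F x = 0, ev V x = 0, ev T x = 0 & ev O x = 0];
  b_V : forall x, 0 <= ev V x <= m%:R * ev chi x;
  b_T : forall x, ev T x <= m%:R * ev chi x;
  b_O : forall x, 0 <= ev O x <= ev chi x;
  b_g1 : forall x2 : R, 0 <= x2 <= 1 -> rowint (EMul g1 (tilt s F V)) x2 <= rowint g1 x2 + tol;
  b_g2 : forall x2 : R, 0 <= x2 <= 1 -> rowint (EMul g2 (tilt (- s) F V)) x2 <= rowint g2 x2 + tol;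
  b_EO : forall x2 : R, 0 <= x2 <= 1 -> (1 - kap) ^+ m * rowint chi x2 <= rowint O x2 + tol;
  b_ET : forall x2 : R, 0 <= x2 <= 1 ->
    m%:R / 4 * (1 - kap) ^+ m * rowint chi x2 <= rowint T x2 + tol;
  b_off : forall x, inQ x -> ev chi x = 0 -> forall j, (j <= J)%N ->
    `|He b cp cm F (u j) x| <= tol;
  b_on : forall x, inQ x -> 0 < ev O x -> exists2 j, (i <= j < i + 2 ^ m)%N &
    rho * ev T x - 4 * d * m%:R - tol <= He b cp cm F (u j) x - He b cp cm F (u J) x }.

Lemma u_mono i j : (i <= j)%N -> u i <= u j.
Proof.
elim: j => [|j IH]; first by rewrite leqn0 => /eqP ->.
rewrite leq_eqVlt => /orP[/eqP -> //|]; rewrite ltnS => /IH h; apply: le_trans h _.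
apply: le_trans (uK j); rewrite ler_peMr ?(ltW (u0 j))//.
by rewrite expr2; apply: mulr_ege1; exact: ltW.
Qed.

Lemma mul_tilt_ge0 g s F V x : 0 <= ev g x -> 0 <= ev (EMul g (tilt s F V)) x.
Proof. by move=> h; rewrite /= mulr_ge0// expR_ge0. Qed.

(** The induction is over all weights g1 and g2: the left subtree is built against the weight tilted
    by the root wave, and the right subtree against that weight tilted further by the left subtree.
    Thus each frequency is chosen after everything it has to be uncorrelated with. J stays the same
    in both subtrees, as one last index serves the whole tree. *)
Lemma build m : forall i J chi g1 g2 s tol, (i + 2 ^ m <= J.+1)%N -> suppQ chi ->
  (forall x, 0 <= ev chi x <= 1) -> (forall x, 0 <= ev g1 x) -> (forall x, 0 <= ev g2 x) ->
  `|s| <= 1 / 4 -> 0 < tol ->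
  exists F V T O, built m chi g1 g2 s tol i J F V T O.
Proof.
elim: m => [|m IH] i J chi g1 g2 s tol iJ sQ chi01 g10 g20 s4 tol0.
  pose Z := EMul (ECst 0) chi.
  have Z0 x : ev Z x = 0 by rewrite /= mul0r.
  have HZ v x : inQ x -> He b cp cm Z v x = 0 by move=> xQ; rewrite HeZ// mul0r.
  have EZ0 x2 : rowint Z x2 = 0 by rewrite rowintZ mul0r.
  have tl r g x2 : rowint (EMul g (tilt r Z Z)) x2 = rowint g x2.
    by apply: rowint_eq => x /=; rewrite !mul0r !mulr0 addr0 expR0 mulr1.
  exists Z, Z, Z, chi; split.
  - by move=> x h; rewrite !Z0 h.
  - by move=> x; rewrite Z0 mul0r lexx.
  - by move=> x; rewrite Z0 mul0r.
  - by move=> x; rewrite lexx andbT; case/andP: (chi01 x).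
  - by move=> x2 _; rewrite tl lerDl ltW.
  - by move=> x2 _; rewrite tl lerDl ltW.
  - by move=> x2 _; rewrite expr0 mul1r lerDl ltW.
  - by move=> x2 _; rewrite !mul0r EZ0 add0r ltW.
  - by move=> x xQ _ j _; rewrite HZ// normr0 ltW.
  - move=> x xQ _; exists i; first by rewrite leqnn expn0 addn1 ltnSn.
    by rewrite !HZ// Z0 !mulr0 !subr0 add0r oppr_le0 ltW.
(* One level spends up to 5 t pointwise and up to (3 + m) t on the gains. *)
pose t := tol / (8 * (m%:R + 1)).
have m0 : 0 <= m%:R :> R by [].
have t0 : 0 < t by rewrite divr_gt0// mulr_gt0// ltr_wpDl.
have tE : t * (8 * (m%:R + 1)) = tol by rewrite /t divfK// gt_eqF// mulr_gt0// ltr_wpDl.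
(* A factor K above the last index of the left half; the lacunarity K^2 leaves another factor K
   below the first index of the right half. *)
pose w := K * u (i + 2 ^ m).-1.
have K0 : 0 < K by apply: lt_trans K1.
have w0 : 0 < w by rewrite mulr_gt0.
have s4' : `|- s| <= 1 / 4 by rewrite normrN.
have [lam l0 Hlam] := evtl_and (evtl_and (tilt_evtl w chi01 g10 s4 t0) (tilt_evtl w chi01 g20 s4' t0))
  (evtl_and (evtl_and (split_evtl w chi01 t0) (gain_evtl w chi01 t0))
   (@evtl_all R J _ (fun j => wave_evtl j sQ chi01 t0 w0))).
move: (Hlam lam (lexx _)) => {Hlam} [[n1 n2] [[n3 n4] n5]].
set W := wave b chi lam w in n1 n2 n5.
pose cL := chL chi lam w; pose cR := chR chi lam w.
pose G1 := EMul g1 (tilt s W (EMul chi chi)); pose G2 := EMul g2 (tilt (- s) W (EMul chi chi)).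
have f01 (y : R) : 0 <= flat 0 y <= 1.
  by rewrite flat_ge0/=; apply: le_trans (flat_le 0 y) _; rewrite fact0.
have cL01 x : 0 <= ev cL x <= 1.
  rewrite /cL /=; have /andP[a1 a2] := chi01 x; have /andP[a3 a4] := f01 (eta^-1 * ev (zE lam w) x).
  by rewrite mulr_ge0//= mulr_ile1.
have cR01 x : 0 <= ev cR x <= 1.
  rewrite /cR /=; have /andP[a1 a2] := chi01 x; have /andP[a3 a4] := f01 (- eta^-1 * ev (zE lam w) x).
  by rewrite mulr_ge0//= mulr_ile1.
have sL : suppQ cL by move=> x hx; rewrite /= sQ// mul0r.
have sR : suppQ cR by move=> x hx; rewrite /= sQ// mul0r.
have G10 x : 0 <= ev G1 x by exact: mul_tilt_ge0.
have G20 x : 0 <= ev G2 x by exact: mul_tilt_ge0.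
have iL : (i + 2 ^ m <= J.+1)%N.
  by apply: leq_trans iJ; rewrite leq_add2l leq_exp2l.
have iR : (i + 2 ^ m + 2 ^ m <= J.+1)%N by move: iJ; rewrite expnS mul2n -addnn addnA.
have [FL [VL [TL [OL BL]]]] := IH i J cL G1 G2 s t iL sL cL01 G10 G20 s4 t0.
pose G1' := EMul G1 (tilt s FL VL); pose G2' := EMul G2 (tilt (- s) FL VL).
have G1'0 x : 0 <= ev G1' x by exact: mul_tilt_ge0.
have G2'0 x : 0 <= ev G2' x by exact: mul_tilt_ge0.
have [FR [VR [TR [OR BR]]]] := IH (i + 2 ^ m)%N J cR G1' G2' s t iR sR cR01 G1'0 G2'0 s4 t0.
pose F := EAdd (EAdd W FL) FR; pose V := EAdd (EAdd (EMul chi chi) VL) VR.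
pose T := EAdd (EAdd (gain chi lam w) TL) TR; pose O := EAdd OL OR.
have fs0 (y : R) : flat 0 y = 0 \/ flat 0 (- y) = 0.
  rewrite /flat; have [h|h] := ltP 0 y; last by left.
  by right; rewrite ifF// oppr_gt0; apply/negbTE; rewrite -leNgt ltW.
(* The children never overlap, so V and T grow by at most chi per level instead of doubling. *)
have disj x : ev cL x = 0 \/ ev cR x = 0.
  rewrite /cL /cR /=; case: (fs0 (eta^-1 * ev (zE lam w) x)) => h.
    by left; rewrite h mulr0.
  by right; rewrite mulNr h mulr0.
have cLle x : ev cL x <= ev chi x.
  rewrite /cL /=; have /andP[a1 a2] := chi01 x; have /andP[a3 a4] := f01 (eta^-1 * ev (zE lam w) x).
  by rewrite ler_piMr.
have cRle x : ev cR x <= ev chi x.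
  rewrite /cR /=; have /andP[a1 a2] := chi01 x; have /andP[a3 a4] := f01 (- eta^-1 * ev (zE lam w) x).
  by rewrite ler_piMr.
have chi0 x : ev chi x = 0 -> ev cL x = 0 /\ ev cR x = 0.
  by move=> h; rewrite /cL /cR /= h !mul0r.
have zabs x : `|ev (zE lam w) x| <= 1 by rewrite zE_ev; exact: zt_abs.
have mchi x : 0 <= m%:R * ev chi x by rewrite mulr_ge0//; case/andP: (chi01 x).
have two x (y1 y2 k : R) : 0 <= k -> y1 <= k * ev cL x -> y2 <= k * ev cR x ->
    (ev cL x = 0 -> y1 = 0) -> (ev cR x = 0 -> y2 = 0) -> y1 + y2 <= k * ev chi x.
  move=> k0 h1 h2 e1 e2; case: (disj x) => h.
    by rewrite e1// add0r; apply: le_trans h2 _; rewrite ler_wpM2l.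
  by rewrite e2// addr0; apply: le_trans h1 _; rewrite ler_wpM2l.
have [t3 t5 tm] := tol_arith t0 m0 tE.
have k01 : 0 <= 1 - kap by rewrite subr_ge0.
have P0 : 0 <= (1 - kap) ^+ m by exact: exprn_ge0.
have P1 : (1 - kap) ^+ m <= 1 by apply: exprn_ile1 => //; rewrite gerBl ltW.
have sFL : suppQ FL by move=> x hx; have [] := b_supp BL (sL x hx).
have sFR : suppQ FR by move=> x hx; have [] := b_supp BR (sR x hx).
have sW : suppQ W by move=> x hx; rewrite /W /= sQ// mul0r.
have sWL : suppQ (EAdd W FL).
  by move=> x hx; rewrite -[LHS]/(ev W x + ev FL x) sW// sFL// addr0.
have HF v x : inQ x -> He b cp cm F v x = He b cp cm W v x + He b cp cm FL v x + He b cp cm FR v x.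
  by move=> xQ; rewrite /F HeD// HeD.
have pm : (0 < i + 2 ^ m)%N by rewrite addn_gt0 expn_gt0 orbT.
have uL j : (j < i + 2 ^ m)%N -> u j * K <= w.
  move=> h; rewrite /w mulrC ler_pM2l//; apply: u_mono.
  by rewrite -ltnS prednK.
have uR j : (i + 2 ^ m <= j)%N -> w * K <= u j.
  move=> h; apply: le_trans (u_mono h).
  have := uK (i + 2 ^ m).-1; rewrite prednK// => h'; apply: le_trans h'.
  by rewrite /w mulrAC mulrC expr2.
exists F, V, T, O; split.
- move=> x h; have [hl hr] := chi0 x h.
  have [l1 l2 l3 l4] := b_supp BL hl; have [r1 r2 r3 r4] := b_supp BR hr.
  by split; rewrite /F /V /T /O /W /= ?h ?l1 ?l2 ?l3 ?l4 ?r1 ?r2 ?r3 ?r4 ?mul0r ?mulr0 ?addr0.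
- move=> x; have /andP[a1 a2] := chi01 x.
  have /andP[v1 v2] := b_V BL x; have /andP[v3 v4] := b_V BR x.
  have h : ev VL x + ev VR x <= m%:R * ev chi x.
    by apply: (two x) => // h; [have [] := b_supp BL h|have [] := b_supp BR h].
  rewrite /V /= !addr_ge0 ?mulr_ge0//= -addrA -natr1 mulrDl mul1r addrC.
  by apply: lerD => //; rewrite ler_piMr.
- move=> x; have /andP[a1 a2] := chi01 x.
  have h : ev TL x + ev TR x <= m%:R * ev chi x.
    apply: (two x) => //; [exact: b_T BL x|exact: b_T BR x|..].
      by move=> h; have [] := b_supp BL h.
    by move=> h; have [] := b_supp BR h.
  rewrite /T -[leLHS]/(ev (gain chi lam w) x + ev TL x + ev TR x).
  rewrite -addrA -[m.+1%:R]natr1 mulrDl mul1r addrC; apply: lerD => //.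
  rewrite /gain -[leLHS]/(1 / 2 * (ev chi x * (ev (zE lam w) x + ev (zE lam w) x * ev (zE lam w) x))).
  rewrite mulrCA ler_piMr//; have := zabs x; set z := ev _ _; rewrite ler_norml => /andP[z1 z2].
  exact: half_arith.
- move=> x; have /andP[v1 v2] := b_O BL x; have /andP[v3 v4] := b_O BR x.
  rewrite /O /= addr_ge0//=.
  rewrite -[leRHS]mul1r; apply: (two x) => //; rewrite ?mul1r//.
    by move=> h; have [] := b_supp BL h.
  by move=> h; have [] := b_supp BR h.
- move=> x2 hx2; rewrite (@rowint_eq _ (EMul G1' (tilt s FR VR))); last first.
    by move=> x; rewrite /= -!mulrA -!expRD; congr (_ * expR _); ring.
  apply: le_trans (compose3 (n1 x2 hx2) (b_g1 BL hx2) (b_g1 BR hx2)) _.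
  by rewrite lerD2l.
- move=> x2 hx2; rewrite (@rowint_eq _ (EMul G2' (tilt (- s) FR VR))); last first.
    by move=> x; rewrite /= -!mulrA -!expRD; congr (_ * expR _); ring.
  apply: le_trans (compose3 (n2 x2 hx2) (b_g2 BL hx2) (b_g2 BR hx2)) _.
  by rewrite lerD2l.
- move=> x2 hx2; rewrite exprS /O rowintD.
  apply: le_trans (mass_arith P0 P1 (ltW t0) (n3 x2 hx2) (b_EO BL hx2) (b_EO BR hx2)) _.
  by rewrite lerD2l.
- move=> x2 hx2; rewrite exprS /T !rowintD -natr1.
  have cE : 0 <= rowint chi x2 by apply: rowint_ge0 => x; case/andP: (chi01 x).
  apply: le_trans (gain_sum_arith m0 (ltW kap0) kap1 P0 P1 (ltW t0) cE (n3 x2 hx2) (n4 x2 hx2)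
    (b_ET BL hx2) (b_ET BR hx2)) _.
  by rewrite lerD2l.
- move=> x xQ h j jJ; have [hl hr] := chi0 x h.
  rewrite HF//; have [h1 h2] := n5 j jJ x xQ.
  have hw : `|He b cp cm W (u j) x| <= t.
    have [k|k] := ltnP j (i + 2 ^ m).
      by have := h1 (uL j k); rewrite h mul0r subr0 mulr0 add0r.
    by have := h2 (uR j k); rewrite h mul0r subr0 mulr0 add0r.
  apply: le_trans t3; apply: le_trans (ler_normD _ _) _; apply: lerD.
    by apply: le_trans (ler_normD _ _) _; apply: lerD; [exact: hw|exact: (b_off BL xQ hl jJ)].
  exact: (b_off BR xQ hr jJ).
- move=> x xQ Ox; rewrite /T -[m.+1%:R]natr1.
  have /andP[c0 c1] := chi01 x.
  (* J belongs to the right half or lies beyond it, so [u J] is always in the regime of large v. *)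
  have Jr : (i + 2 ^ m <= J)%N.
    rewrite -ltnS; apply: leq_trans iR; rewrite -addn1 leq_add2l expn_gt0//.
  have [_ wJ] := n5 J (leqnn _) x xQ; have {}wJ := wJ (uR J Jr).
  have gE : ev (EAdd (EAdd (gain chi lam w) TL) TR) x =
    1 / 2 * (ev chi x * (ev (zE lam w) x + ev (zE lam w) x * ev (zE lam w) x)) + ev TL x + ev TR x by [].
  rewrite gE; have := zabs x; rewrite ler_norml => /andP[z1 z2].
  have zEx := zE_ev lam w x.
  have /andP[oL _] := b_O BL x; have /andP[oR _] := b_O BR x.
  have [oL0|oL0] := ltP 0 (ev OL x).
    have cl0 : ev cL x != 0.
      by apply/eqP => h; have [_ _ _ h'] := b_supp BL h; move: oL0; rewrite h' ltxx.
    have cr0 : ev cR x = 0 by case: (disj x) => // h; rewrite h eqxx in cl0.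
    have [_ _ T0 _] := b_supp BR cr0.
    have [j jr hj] := b_on BL xQ oL0.
    have jm : (j < i + 2 ^ m)%N by case/andP: jr.
    have jJ : (j <= J)%N by apply: leq_trans Jr; exact: ltnW.
    have [wj _] := n5 j jJ x xQ; have {}wj := wj (uL j jm).
    exists j.
      case/andP: jr => -> /= h; apply: leq_trans h _.
      by rewrite leq_add2l leq_exp2l.
    have zp : 0 < ev (zE lam w) x.
      rewrite ltNge; apply/negP => h; move/eqP: cl0; apply.
      rewrite /cL -[LHS]/(ev chi x * flat 0 (eta^-1 * ev (zE lam w) x)) /flat ifF ?mulr0//.
      by apply/negbTE; rewrite -leNgt mulr_ge0_le0// invr_ge0 ltW.
    rewrite T0; rewrite zEx in zp z2 *.
    rewrite !HF//; exact: (on_left_arith rho0 c0 c1 (ltW d0) zp z2 (ltW t0) rp1 rp2 erefl wj wJ hj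
      (b_off BR xQ cr0 jJ) (b_off BR xQ cr0 (leqnn J)) t5).
  have oR0 : 0 < ev OR x.
    have : ev OL x = 0 by apply/eqP; rewrite eq_le oL0 oL.
    by move: Ox; rewrite /O /= => + h; rewrite h add0r.
  have cr0 : ev cR x != 0.
    by apply/eqP => h; have [_ _ _ h'] := b_supp BR h; move: oR0; rewrite h' ltxx.
  have cl0 : ev cL x = 0 by case: (disj x) => // h; rewrite h eqxx in cr0.
  have [_ _ T0 _] := b_supp BL cl0.
  have [j jr hj] := b_on BR xQ oR0.
  have jm : (i + 2 ^ m <= j)%N by case/andP: jr.
  have jJ : (j <= J)%N.
    by rewrite -ltnS; case/andP: jr => _ h; apply: leq_trans h iR.
  have [_ wj] := n5 j jJ x xQ; have {}wj := wj (uR j jm).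
  exists j.
    case/andP: jr => h1 h2; rewrite (leq_trans _ h1) ?leq_addr//=.
    by move: h2; rewrite expnS mul2n -addnn addnA.
  have zm : ev (zE lam w) x <= 0.
    rewrite leNgt; apply/negP => h; move/eqP: cr0; apply.
    rewrite /cR -[LHS]/(ev chi x * flat 0 (- eta^-1 * ev (zE lam w) x)) /flat ifF ?mulr0//.
    by apply/negbTE; rewrite -leNgt mulNr oppr_le0 mulr_ge0// ?invr_ge0 ltW.
  rewrite T0 !HF//.
  exact: (on_right_arith rho0 c0 c1 (ltW d0) zm z1 (ltW t0) wj wJ hj
      (b_off BL xQ cl0 jJ) (b_off BL xQ cl0 (leqnn J)) t5).
Qed.
End Tree.

(** * Norms from integrals along horizontal lines *)

Section Norms.
Variable R : realType.
Implicit Types (e f F Y : expr R) (p s : R).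
Local Notation mu := (@lebesgue_measure R).
Local Notation plane := (measurableTypeR R * measurableTypeR R)%type.

Lemma ev_measurable e : measurable_fun [set: plane] (ev e).
Proof.
elim: e => [c| | |e1 I1 e2 I2|e1 I1 e2 I2|e1 I1|e1 I1|e1 I1|n e1 I1] /=.
- exact: measurable_cst.
- exact: measurable_fst.
- exact: measurable_snd.
- exact: measurable_funD.
- exact: measurable_funM.
- apply: (measurableT_comp _ I1); apply: continuous_measurable_fun; exact: continuous_sin.
- apply: (measurableT_comp _ I1); apply: continuous_measurable_fun; exact: continuous_cos.
- apply: (measurableT_comp _ I1); apply: continuous_measurable_fun; exact: continuous_expR.
- apply: (measurableT_comp _ I1); apply: continuous_measurable_fun => t.
  exact: (dr_cont (dr_flat n t)).
Qed.

(** The maximal function is a supremum over an arbitrary set of parameters and need not come with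
    measurability; monotonicity is read off from the integral as a supremum over simple
    functions. *)
Lemma ge0_integral_mono d (T : measurableType d) (m : {measure set T -> \bar R})
  (f1 f2 : T -> \bar R) : (forall x, 0 <= f1 x)%E -> (forall x, f1 x <= f2 x)%E ->
  (\int[m]_x f1 x <= \int[m]_x f2 x)%E.
Proof.
move=> f10 f12; have f20 x : (0 <= f2 x)%E by exact: le_trans (f12 x).
rewrite !ge0_integralTE//; apply: le_ereal_sup => _ [h hf <-]; exists h => // x.
exact: le_trans (hf x) (f12 x).
Qed.

Lemma integral_rowint e (y : R) : (\int[mu]_(x in `[0%R, 1%R]) (ev e (x, y))%:E)%E = (rowint e y)%:E.
Proof.
have : mu.-integrable `[0, 1] (EFin \o (fun x1 => ev e (x1, y))).
  by apply: cont_integrable; exact: rowint_cts.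
move=> h; rewrite /rowint /itg /Rintegral fineK//; exact: integrable_fin_num.
Qed.

Lemma integral_const_itv (A B c : R) : A <= B ->
  (\int[mu]_(x in `[A, B]) c%:E)%E = (c * (B - A))%:E.
Proof.
move=> AB; rewrite -itg_cst// /itg /Rintegral fineK//; apply: integrable_fin_num => //.
by apply: cont_integrable => t _; exact: ct_cst.
Qed.

Lemma slice_measurable (g : R * R -> R) (y : R) : measurable_fun [set: plane] g ->
  measurable_fun [set: measurableTypeR R] (fun x => (g (x, y))%:E).
Proof. by move=> mg; apply/measurable_EFinP; exact: (measurable_fun_pair1 _ mg). Qed.

(** Tonelli: only the rows of the unit square contribute, and their total height is 1. *)
Lemma slice_upper (g : R * R -> R) e (c : R) : measurable_fun [set: plane] g -> (forall x, 0 <= g x) ->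
  (forall x, ~~ inQ x -> g x = 0) -> (forall x, g x <= ev e x) ->
  (forall y, 0 <= y <= 1 -> rowint e y <= c) ->
  (\int[@leb2 R]_x (g x)%:E <= c%:E)%E.
Proof.
move=> mg g0 gQ ge ec.
have mG : measurable_fun [set: plane] (EFin \o g) by exact/measurable_EFinP.
rewrite /leb2 (@fubini_tonelli2 _ _ _ _ R mu mu (fun x : plane => (g x)%:E) mG)//.
rewrite /fubini_G /=.
have S y : (\int[mu]_x (g (x, y))%:E <= (if y \in `[0%R, 1%R] then c else 0)%:E)%E.
  case: ifPn => [|]; rewrite in_itv /= => hy.
    have -> : (\int[mu]_x (g (x, y))%:E = \int[mu]_(x in `[0%R, 1%R]) (g (x, y))%:E)%E.
      rewrite [RHS]integral_mkcond; apply: eq_integral => x _; rewrite /patch mem_setE in_itv /=.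
      by case: ifPn => // hx; rewrite gQ//= /inQ /= negb_and hx.
    apply: (@le_trans _ _ (rowint e y)%:E); last by rewrite lee_fin ec.
    rewrite -integral_rowint; apply: ge0_le_integral => //=.
    + by move=> x _; rewrite lee_fin.
    + by apply: measurable_funTS; exact: slice_measurable.
    + by apply: measurable_funTS; exact: slice_measurable (ev_measurable e).
    + by move=> x _; rewrite lee_fin.
  rewrite (eq_integral (cst 0%E)) ?integral0// => x _.
  by rewrite gQ//= /inQ /= negb_and hy orbT.
apply: le_trans (_ : (\int[mu]_y (if y \in `[0%R, 1%R] then c else 0)%:E <= _)%E).
  by apply: ge0_integral_mono => // y; apply: integral_ge0 => x _; rewrite lee_fin.
have -> : (\int[mu]_y (if y \in `[0%R, 1%R] then c else 0)%:E = \int[mu]_(y in `[0%R, 1%R]) c%:E)%E.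
  rewrite [RHS]integral_mkcond; apply: eq_integral => y _; rewrite /patch mem_setE.
  by case: ifP.
by rewrite integral_const_itv// subr0 mulr1.
Qed.

Lemma slice_lower (g : R * R -> R) e (c : R) : measurable_fun [set: plane] g -> (forall x, 0 <= g x) ->
  (forall x, ev e x <= g x) -> (forall y, 1 / 4 <= y <= 3 / 4 -> c <= rowint e y) -> 0 <= c ->
  ((c / 2)%:E <= \int[@leb2 R]_x (g x)%:E)%E.
Proof.
move=> mg g0 ge ec c0.
have mG : measurable_fun [set: plane] (EFin \o g) by exact/measurable_EFinP.
rewrite /leb2 (@fubini_tonelli2 _ _ _ _ R mu mu (fun x : plane => (g x)%:E) mG)//.
rewrite /fubini_G /=.
have S y : ((if y \in `[(1 / 4)%R, (3 / 4)%R] then c else 0)%:E <= \int[mu]_x (g (x, y))%:E)%E.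
  case: ifPn => [|_]; last by apply: integral_ge0 => x _; rewrite lee_fin.
  rewrite in_itv /= => hy.
  apply: (@le_trans _ _ (\int[mu]_(x in `[0%R, 1%R]) (g (x, y))%:E)%E); last first.
    apply: ge0_subset_integral => //=.
      exact: slice_measurable.
    by move=> x _; rewrite lee_fin.
  (* The positive part of e, which may itself be negative. *)
  pose h x := (ev e (x, y) + `|ev e (x, y)|) / 2.
  have h0 x : 0 <= h x.
    by rewrite divr_ge0// -lerBlDl sub0r -normrN; exact: ler_norm.
  have hg x : h x <= g (x, y).
    rewrite /h; have [k|k] := leP 0 (ev e (x, y)).
      by rewrite ger0_norm// (_ : _ / 2 = ev e (x, y))//; field.
    by rewrite ltr0_norm// subrr mul0r.
  have eh x : ev e (x, y) <= h x.
    by rewrite /h ler_pdivlMr// mulr_natr mulr2n lerD2l ler_norm.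
  have ch : cts 0 1 h.
    move=> t ht; have k := @rowint_cts R e y t ht.
    by apply: ctM; [apply: ctD => //; exact: ct_norm|exact: ct_cst].
  apply: (@le_trans _ _ (itg 0 1 h)%:E).
    rewrite lee_fin; apply: le_trans (ec y hy) _.
    by apply: itg_le => //; exact: rowint_cts.
  have ih := cont_integrable ch.
  rewrite /itg /Rintegral fineK; last exact: integrable_fin_num.
  apply: ge0_le_integral => //=.
  + by move=> x _; rewrite lee_fin.
  + exact: measurable_int ih.
  + by apply: measurable_funTS; exact: slice_measurable.
  + by move=> x _; rewrite lee_fin.
apply: (@le_trans _ _ (\int[mu]_y (if y \in `[(1 / 4)%R, (3 / 4)%R] then c else 0)%:E)%E); last first.
  by apply: ge0_integral_mono => // y; case: ifP; rewrite lee_fin.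
have -> : (\int[mu]_y (if y \in `[(1 / 4)%R, (3 / 4)%R] then c else 0)%:E = \int[mu]_(y in `[(1 / 4)%R, (3 / 4)%R]) c%:E)%E.
  rewrite [RHS]integral_mkcond; apply: eq_integral => y _; rewrite /patch mem_setE.
  by case: ifP.
have h34 : 1 / 4 <= 3 / 4 :> R by lra.
rewrite integral_const_itv// lee_fin.
by rewrite le_eqVlt; apply/orP; left; apply/eqP; field.
Qed.

Lemma powR_expR (y p : R) n : 0 <= y -> 0 <= p -> p <= n%:R -> y `^ p <= n`!%:R * expR y.
Proof.
move=> y0 p0 pn; have f1 : 1 <= n`!%:R :> R by rewrite ler1n fact_gt0.
have [y1|y1] := leP y 1.
  apply: le_trans (_ : 1 * 1 <= _).
    rewrite mulr1; have <- : 1 `^ p = 1 :> R by rewrite powR1.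
    by apply: ge0_ler_powR => //; rewrite nnegrE.
  apply: ler_pM => //; apply: le_trans (expR_ge1Dx y); by rewrite lerDl.
apply: le_trans (expR_fact n y0); rewrite -powR_mulrn//.
by apply: ler_powR => //; exact: ltW.
Qed.

Lemma poweR_mono (q : R) (y z : \bar R) : 0 < q -> (0 <= y)%E -> (y <= z)%E -> (y `^ q <= z `^ q)%E.
Proof.
move=> q0 y0 yz; apply: gt0_ler_poweR => //; first exact: ltW.
  by rewrite in_itv /= y0 leey.
by rewrite in_itv /= (le_trans y0 yz) leey.
Qed.

Lemma powR_measurable e (p : R) : measurable_fun [set: plane] (fun x => `|ev e x| `^ p).
Proof.
apply: (measurableT_comp (@measurable_powR R p)).
by apply: (measurableT_comp (@normr_measurable R setT)); exact: ev_measurable.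
Qed.

(** Apply |y|^p <= n! (e^y + e^(-y)) to y = s F and scale by nu/s. *)
Lemma LpE_upper F p s nu B n : suppQ F -> 0 < p -> p <= n%:R -> 0 < s -> 0 <= nu ->
  (forall y, 0 <= y <= 1 -> rowint (EExp (EMul (ECst s) F)) y <= B) ->
  (forall y, 0 <= y <= 1 -> rowint (EExp (EMul (ECst (- s)) F)) y <= B) ->
  (nu / s) `^ p * n`!%:R * (2 * B) <= 1 ->
  (LpE p (fun x => (`|ev (EMul (ECst nu) F) x|)%:E) <= 1)%E.
Proof.
move=> sF p0 pn s0 nu0 B1 B2 hB; set G := EMul (ECst nu) F.
pose k := (nu / s) `^ p * n`!%:R.
have k0 : 0 <= k by rewrite mulr_ge0 ?powR_ge0.
pose e := EMul (ECst k) (EAdd (EExp (EMul (ECst s) F)) (EExp (EMul (ECst (- s)) F))).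
have h : (\int[@leb2 R]_x (`|ev G x| `^ p)%:E <= 1%:E)%E.
  apply: (@slice_upper _ e).
  - exact: powR_measurable.
  - by move=> x; exact: powR_ge0.
  - by move=> x hx; rewrite /G /= sF// mulr0 normr0 powR0// gt_eqF.
  - move=> x; rewrite /G /e /=; set z := ev F x.
    have -> : `|nu * z| = nu / s * `|s * z|.
      by rewrite !normrM (gtr0_norm s0) ger0_norm//; field; rewrite gt_eqF.
    rewrite powRM ?divr_ge0 ?(ltW s0)// /k -mulrA ler_wpM2l ?powR_ge0//.
    apply: le_trans (powR_expR (normr_ge0 _) (ltW p0) pn) _.
    rewrite ler_wpM2l// mulNr; have := expR_ge0 (s * z); have := expR_ge0 (- (s * z)).
    by case: (ger0P (s * z)) => _ *; rewrite ?lerDl ?lerDr.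
  - move=> y hy; rewrite /e rowintZ rowintD; apply: le_trans hB; rewrite ler_wpM2l//.
    by rewrite mulr_natl mulr2n; apply: lerD; [exact: B1|exact: B2].
rewrite /LpE; have -> : 1%E = (1 `^ p^-1)%E :> \bar R by rewrite poweR1r.
apply: poweR_mono; rewrite ?invr_gt0//; by apply: integral_ge0 => x _; exact: poweR_ge0.
Qed.

(** For y >= tau/2 the power y^p is at least (tau/2)^(p-1) (y - tau/2). This minorant is linear in
    Y, so row means of Y suffice, even where Y is negative. The rows used have total height 1/2,
    which costs 2^(-1/p) >= 1/2. *)
Lemma LpE_lower (g : R * R -> \bar R) Y p tau : 1 < p -> 0 < tau ->
  (forall x, 0 <= g x)%E -> (forall x, (ev Y x)%:E <= g x)%E ->
  (forall y, 1 / 4 <= y <= 3 / 4 -> tau <= rowint Y y) ->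
  ((tau / 4)%:E <= LpE p g)%E.
Proof.
move=> p1 t0 g0 Yg tE; have p0 : 0 < p by exact: lt_trans p1.
have t20 : 0 < tau / 2 by rewrite divr_gt0.
pose k := (tau / 2) `^ (p - 1).
have k0 : 0 < k by rewrite powR_gt0.
have kt : k * (tau / 2) = (tau / 2) `^ p.
  rewrite -[X in k * X](powRr1 (ltW t20)) -powRD ?subrK//.
  by rewrite (gt_eqF t20) implybT.
pose e := EMul (ECst k) (EAdd Y (ECst (- (tau / 2)))).
pose h x := (ev e x + `|ev e x|) / 2.
have eh x : ev e x <= h x.
  by rewrite /h ler_pdivlMr// mulr_natr mulr2n lerD2l ler_norm.
have h0 x : 0 <= h x by rewrite divr_ge0// -lerBlDl sub0r -normrN; exact: ler_norm.
have mh : measurable_fun [set: plane] h.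
  apply: measurable_funM => //; apply: measurable_funD; first exact: ev_measurable.
  by apply: (measurableT_comp (@normr_measurable R setT)); exact: ev_measurable.
have hg x : ((h x)%:E <= g x `^ p)%E.
  have [k1|k1] := leP (ev e x) 0.
    by rewrite /h ler0_norm// subrr mul0r poweR_ge0.
  have -> : h x = ev e x by rewrite /h gtr0_norm//; field.
  have Yt : tau / 2 < ev Y x by move: k1; rewrite /e /= pmulr_rgt0// subr_gt0.
  have Y0 : 0 < ev Y x by exact: lt_trans Yt.
  apply: (@le_trans _ _ ((ev Y x)%:E `^ p)%E); last by apply: poweR_mono => //; rewrite lee_fin ltW.
  rewrite poweR_EFin lee_fin /e /=.
  have -> : p = p - 1 + 1 by rewrite subrK.
  rewrite powRD ?(gt_eqF Y0) ?implybT// powRr1 ?(ltW Y0)//.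
  apply: ler_pM; rewrite ?(ltW k0)//; first by rewrite subr_ge0 ltW.
    by apply: ge0_ler_powR; rewrite ?nnegrE ?subr_ge0 ?(ltW t20) ?(ltW Y0) ?(ltW p1) ?(ltW Yt).
  by rewrite gerBl ltW.
have eE y : 1 / 4 <= y <= 3 / 4 -> (tau / 2) `^ p <= rowint e y.
  move=> hy; rewrite /e rowintZ rowintD -kt ler_pM2l// [X in _ + X](_ : _ = - (tau / 2)).
    by have := tE y hy; lra.
  by rewrite /rowint /= itg_cst// subr0 mulr1.
have H := slice_lower mh h0 eh eE (powR_ge0 _ _).
rewrite /LpE; apply: (@le_trans _ _ (((tau / 2) `^ p / 2)%:E `^ p^-1)%E); last first.
  apply: poweR_mono; rewrite ?invr_gt0// ?lee_fin ?divr_ge0 ?powR_ge0//.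
  rewrite /leb2 in H *; apply: le_trans H _; apply: ge0_integral_mono => x; rewrite ?lee_fin//.
rewrite poweR_EFin lee_fin powRM ?powR_ge0// -powRrM mulfV ?gt_eqF// powRr1 ?(ltW t20)//.
have -> : tau / 4 = tau / 2 * 2^-1 by field.
rewrite ler_pM2l// -[leLHS](powRr1 (_ : 0 <= 2^-1))//.
apply: ger_powR; first by rewrite invr_gt0 ltr0n invf_le1// ler1n.
by rewrite invf_le1// ltW.
Qed.
End Norms.

(** * The bump at the root of the tree *)

Section Bump.
Variable R : realType.
Implicit Types (e : expr R) (y : R).

(** The factor 32 makes each [flat] at least exp(-1/8) >= 7/8 on the middle half, so that [cutoff]
    exceeds (49/64)^2 > 1/2 on the middle square. *)
Definition cutoff1 e : expr R :=
  EMul (EFlat 0 (EMul (ECst 32) e))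
       (EFlat 0 (EMul (ECst 32) (EAdd (ECst 1) (EMul (ECst (-1)) e)))).
Definition cutoff : expr R := EMul (cutoff1 (EFst R)) (cutoff1 (ESnd R)).

Lemma flat01 y : 0 <= flat 0 y <= 1.
Proof. by rewrite flat_ge0 (flat_le 0 y). Qed.

Lemma flat_32 y : 1 / 4 <= y -> 7 / 8 <= flat 0 (32 * y).
Proof.
move=> h; have y0 : 0 < y by apply: lt_le_trans h; rewrite divr_gt0.
rewrite /flat mulr_gt0// expr0 mul1r; apply: le_trans (expR_ge1Dx _).
have : (32 * y)^-1 <= 8^-1 by rewrite lef_pV2 ?posrE ?mulr_gt0//; lra.
lra.
Qed.

Lemma cutoff1_01 e x : 0 <= ev (cutoff1 e) x <= 1.
Proof.
rewrite -[ev _ _]/(flat 0 (32 * ev e x) * flat 0 (32 * (1 + -1 * ev e x))).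
have /andP[h1 h2] := flat01 (32 * ev e x); have /andP[h3 h4] := flat01 (32 * (1 + -1 * ev e x)).
by rewrite mulr_ge0//= mulr_ile1.
Qed.

Lemma cutoff1_out e x : ~~ (0 <= ev e x <= 1) -> ev (cutoff1 e) x = 0.
Proof.
rewrite negb_and -!ltNge /= => /orP[h|h].
  by rewrite {1}/flat ifF ?mul0r//; apply/negbTE; rewrite -leNgt; lra.
by rewrite [X in _ * X]/flat ifF ?mulr0//; apply/negbTE; rewrite -leNgt; lra.
Qed.

Lemma cutoff1_ge e x : 1 / 4 <= ev e x <= 3 / 4 -> 49 / 64 <= ev (cutoff1 e) x.
Proof.
move=> /andP[h1 h2] /=.
have k1 := flat_32 h1.
have k2 : 7 / 8 <= flat 0 (32 * (1 + -1 * ev e x)) by apply: flat_32; lra.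
by apply: le_trans (ler_pM _ _ k1 k2); lra.
Qed.

Lemma cutoff_supp : suppQ cutoff.
Proof.
move=> x; rewrite /inQ negb_and => /orP[h|h]; rewrite /cutoff.
  by rewrite -[LHS]/(ev (cutoff1 (EFst R)) x * _) cutoff1_out ?mul0r.
by rewrite -[LHS]/(_ * ev (cutoff1 (ESnd R)) x) cutoff1_out ?mulr0.
Qed.

Lemma cutoff_01 x : 0 <= ev cutoff x <= 1.
Proof.
rewrite -[ev _ _]/(ev (cutoff1 (EFst R)) x * ev (cutoff1 (ESnd R)) x).
have /andP[h1 h2] := cutoff1_01 (EFst R) x; have /andP[h3 h4] := cutoff1_01 (ESnd R) x.
by rewrite mulr_ge0//= mulr_ile1.
Qed.

Lemma rowint_cst c y : rowint (ECst c) y = c.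
Proof. by rewrite /rowint /= itg_cst// subr0 mulr1. Qed.

Lemma rowint_cutoff y : 1 / 4 <= y <= 3 / 4 -> 1 / 4 <= rowint cutoff y.
Proof.
move=> hy; have c01 := @rowint_cts R cutoff y.
have c34 : cts (1 / 4) 1 (fun x => ev cutoff (x, y)).
  by move=> t _; exact: ct_dr (dr_line cutoff t y).
have c14 : cts (1 / 4) (3 / 4) (fun x => ev cutoff (x, y)).
  by move=> t _; exact: ct_dr (dr_line cutoff t y).
rewrite /rowint (@itg_split _ _ _ (1 / 4) _ _ c01); last by lra.
rewrite (@itg_split _ _ _ (3 / 4) _ _ c34); last by lra.
have pos (A B : R) : 0 <= itg A B (fun x => ev cutoff (x, y)).
  by apply: Rintegral_ge0 => t _; case/andP: (cutoff_01 (t, y)).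
have h : itg (1 / 4) (3 / 4) (fun=> 1 / 2 : R) <= itg (1 / 4) (3 / 4) (fun x => ev cutoff (x, y)).
  apply: itg_le => //; first by move=> t _; exact: ct_cst.
  move=> t ht; rewrite -[leRHS]/(ev (cutoff1 (EFst R)) (t, y) * ev (cutoff1 (ESnd R)) (t, y)).
  have k1 := @cutoff1_ge (EFst R) (t, y) ht; have k2 := @cutoff1_ge (ESnd R) (t, y) hy.
  by apply: le_trans (ler_pM _ _ k1 k2); lra.
move: h; rewrite itg_cst; last by lra.
have := pos 0 (1 / 4); have := pos (3 / 4) 1; lra.
Qed.
End Bump.

(** * Numerical inequalities for a single wave *)

Section Arithmetic.
Variable R : realType.
Implicit Types A As c e d t z : R.

Lemma thousandth_gt0 A : 0 < A -> 0 < A / 1000. Proof. by move=> A0; lra. Qed.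

Lemma single_arith (As c e d t : R) : 0 < As -> 1 / 4 <= c -> c / 4 <= e + 1 / 1000 ->
  d <= 1 / 1000 * As -> t = As / 1000 -> As / 20 <= As * e - (2 * d + t).
Proof.
move=> A0 h1 h2 h3 ->.
have : As * (1 / 16 - 1 / 1000) <= As * e by rewrite ler_pM2l//; lra.
move: (As * e) => *; lra.
Qed.

Lemma gain_sine_arith As c z h d t : 0 < As -> 0 <= c -> 0 <= d -> c <= 1 -> `|z| <= 1 ->
  `|h - c * (As * z)| <= 2 * d * c + t ->
  As * (1 / 2 * (c * (z + z * z))) - (2 * d + t) <= `|h|.
Proof.
move=> A0 a1 d0 c1 z1 hh.
have e1 : 1 / 2 * (c * (z + z * z)) <= `|c * z|.
  rewrite normrM (ger0_norm a1) mulrCA ler_wpM2l//.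
  have zz : z * z <= `|z|.
    by apply: le_trans (ler_norm _) _; rewrite normrM ler_piMr.
  have := ler_norm z; lra.
have e2 : As * (1 / 2 * (c * (z + z * z))) <= `|c * (As * z)|.
  by rewrite [c * (As * z)]mulrCA normrM (gtr0_norm A0) ler_pM2l.
have e3 : 2 * d * c <= 2 * d by rewrite ler_piMr// mulr_ge0.
have e4 : `|c * (As * z)| <= `|h| + `|h - c * (As * z)|.
  by rewrite -{1}[c * (As * z)](subKr h); exact: ler_normB.
move: (As * (1 / 2 * _)) (`|c * (As * z)|) (`|h|) (`|h - _|) (2 * d * c) e2 e3 e4 hh.
by clear=> *; lra.
Qed.

Lemma quad_le4 z : - (1 / 4) <= z -> z <= 1 / 4 -> 1 + z + z ^+ 2 <= 4.
Proof. by move=> z1 z2; nra. Qed.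

Lemma quarter_in (y : R) : 1 / 4 <= y <= 3 / 4 -> 0 <= y <= 1.
Proof. by move=> *; lra. Qed.
End Arithmetic.

(** * Lower bounds for the maximal operator *)

Section Bounds.
Variable R : realType.
Variables (b : R) (hb : 1 < b) (cp cm : R) (hcp : cp != 0) (hcm : cm != 0).
Variables (p : R) (hp1 : 1 < p).
Implicit Types (U : set R) (F Y : expr R).

Definition moment_degree : nat := (Num.truncn p).+1.
(* Normalises |y|^p <= n! (e^y + e^-y) when both exponential moments are at most 4. *)
Definition amplitude : R := (moment_degree`!%:R * 8) `^ (- p^-1).

Lemma amplitude_gt0 : 0 < amplitude.
Proof. by rewrite powR_gt0// mulr_gt0// ltr0n fact_gt0. Qed.

(** The test function is s [amplitude] F: the exponential moments bound its norm by 1, and Y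
    minorises the maximal function of F. Where Y <= 0 no point of U has to be exhibited, since the
    maximal function is nonnegative. *)
Lemma op_lower U F Y s tau : U !=set0 -> suppQ F -> 0 < s ->
  (forall y, 0 <= y <= 1 -> rowint (EExp (EMul (ECst s) F)) y <= 4) ->
  (forall y, 0 <= y <= 1 -> rowint (EExp (EMul (ECst (- s)) F)) y <= 4) ->
  (forall x, ev Y x <= 0 \/ inQ x /\ exists2 u, U u & ev Y x <= `|He b cp cm F u x|) ->
  0 < tau -> (forall y, 1 / 4 <= y <= 3 / 4 -> tau <= rowint Y y) ->
  ((s * amplitude * tau / 4)%:E <= opnormHU b cp cm U p)%E.
Proof.
move=> [u1 Uu1] sF s0 B1 B2 HY t0 EY; have c0 := amplitude_gt0.
have p0 : 0 < p by exact: lt_trans hp1.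
pose nu := s * amplitude; have nu0 : 0 < nu by rewrite mulr_gt0.
pose G := EMul (ECst nu) F.
have sG : suppQ G by move=> x hx; rewrite /G /= sF// mulr0.
have f0 : 0 < moment_degree`!%:R * 8 :> R by rewrite mulr_gt0// ltr0n fact_gt0.
apply: (@le_trans _ _ (LpE p (HU b cp cm U (ev G)))); last first.
  apply: ereal_sup_ubound; exists (ev G) => //; split.
    apply: ev_testfun; exists 1 => x h; apply: sG; apply/negP => /andP[/andP[a1 a2] /andP[a3 a4]].
    by move: h; rewrite !ger0_norm// !ltNge a2 a4 => -[].
  apply: (@LpE_upper R F p s nu 4 moment_degree sF p0 _ s0 (ltW nu0) B1 B2).
    by apply: ltW; exact: truncnS_gt.
  have -> : nu / s = amplitude by rewrite /nu; field; rewrite gt_eqF.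
  rewrite /amplitude -powRrM mulNr mulVf ?gt_eqF// powR_inv1 ?(ltW f0)// -mulrA.
  have -> : 2 * 4 = 8 :> R by ring.
  by rewrite mulVf// gt_eqF.
have HU0 x : (0 <= HU b cp cm U (ev G) x)%E.
  apply: (@le_trans _ _ (`|Hu b cp cm u1 (ev G) x|%:E)); first by rewrite lee_fin.
  by apply: ereal_sup_ubound; exists u1.
apply: (@LpE_lower R _ (EMul (ECst nu) Y)) => //.
- by rewrite mulr_gt0.
- move=> x; have [h|[xQ [u Uu hu]]] := HY x.
    by apply: le_trans (HU0 x); rewrite lee_fin /= mulr_ge0_le0// ltW.
  apply: (@le_trans _ _ (`|Hu b cp cm u (ev G) x|%:E)); last first.
    by apply: ereal_sup_ubound; exists u.
  rewrite lee_fin -/(He b cp cm G u x) HeZ// normrM (gtr0_norm nu0).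
  by rewrite -[leLHS]/(nu * ev Y x) ler_pM2l.
- by move=> y hy; rewrite rowintZ ler_pM2l// EY.
Qed.

(** A positive bound from one parameter, for sets meeting too few dyadic intervals to carry a tree.
    One wave with w = K u is in the regime of small v, where its response is close to As times a
    sine; as |F| <= 1, the exponential moments with s = 1/4 are immediate. *)
Lemma single_bound As K d : 0 < As -> 0 < K -> 0 < d -> d <= 1 / 1000 * As ->
  (forall v, 0 < v -> v * K <= 1 -> exists e0 T0 : R, 0 < e0 /\
     forall e T, 0 < e -> e <= e0 -> T0 <= T ->
       `|Sv b cp cm v e T - As| <= d /\ `|Cv b cp cm v e T| <= d) ->
  forall U u, U u -> 0 < u ->
  ((1 / 4 * amplitude * (As / 20) / 4)%:E <= opnormHU b cp cm U p)%E.
Proof.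
move=> A0 K0 d0 dA hS U u Uu u0.
pose w := u * K; have w0 : 0 < w by rewrite mulr_gt0.
have v0 : 0 < u / w by rewrite divr_gt0.
have vK : u / w * K <= 1 by rewrite /w invfM mulrA divff ?gt_eqF// mul1r mulVf// gt_eqF.
have [e0 [T0 [e00 SC]]] := hS _ v0 vK.
pose tol := As / 1000; have tol0 : 0 < tol := thousandth_gt0 A0.
have SC' e T : 0 < e -> e <= e0 -> T0 <= T ->
    `|Sv b cp cm (u / w) e T - As| <= d /\ `|Cv b cp cm (u / w) e T - 0| <= d.
  by rewrite subr0; exact: SC.
have cs := @cutoff_supp R; have c01 := @cutoff_01 R.
have [l0 l00 H] := He_wave hb hcp hcm cs c01 u0 w0 tol0 e00 SC'.
have hq : (1 : R) ^+ 2 + 0 ^+ 2 = 1 by ring.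
have t1 : 0 < 1 / 1000 :> R := thousandth_gt0 ltr01.
have [l1 l10 G] := gain_evtl b hq w c01 t1.
pose lam := Num.max l0 l1.
have {}H := H lam ltac:(by rewrite le_max lexx).
have {}G := G lam ltac:(by rewrite le_max lexx orbT).
pose F := wave b (cutoff R) lam w.
have FE x : ev F x = ev (cutoff R) x * cos (ev (phase b lam w) x) by [].
have sF : suppQ F by move=> x hx; rewrite FE cs// mul0r.
have F1 x : `|ev F x| <= 1.
  rewrite FE normrM; have /andP[a1 a2] := c01 x.
  by apply: mulr_ile1 => //; [rewrite ger0_norm|exact: abs_cos_le1].
pose Y := EAdd (EMul (ECst As) (gain b 1 0 (cutoff R) lam w)) (ECst (- (2 * d + tol))).
have B (s : R) y : `|s| <= 1 / 4 -> rowint (EExp (EMul (ECst s) F)) y <= 4.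
  move=> hs; rewrite -(rowint_cst 4 y); apply: rowint_le => x /=.
  have hz : `|s * ev F x| <= 1 / 4.
    by rewrite normrM; apply: le_trans hs; rewrite ler_piMr.
  apply: le_trans (expR_quad hz) _; move: hz; rewrite ler_norml => /andP[z1 z2].
  exact: quad_le4.
apply: (@op_lower U F Y) => //; try by rewrite divr_gt0.
- by exists u.
- by move=> y _; apply: B; rewrite ger0_norm.
- by move=> y _; apply: B; rewrite normrN ger0_norm.
- move=> x; have /andP[a1 a2] := c01 x.
  have td : 0 < 2 * d + tol by rewrite addr_gt0// mulr_gt0.
  rewrite -[ev Y x]/(As * (1 / 2 * (ev (cutoff R) x * (ev (zE b 1 0 lam w) x + ev (zE b 1 0 lam w) x * ev (zE b 1 0 lam w) x))) + - (2 * d + tol)).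
  have [xQ|xQ] := boolP (inQ x); last first.
    by left; rewrite cs// mul0r !mulr0 add0r oppr_le0 ltW.
  right; split => //; exists u => //.
  have := H x xQ; rewrite mul0r addr0 -/F.
  rewrite zE_ev; set th := ev (phase _ _ _) x.
  have -> : zt 1 0 th = sin th by rewrite /zt mul1r mul0r subr0.
  move=> hh; exact: (gain_sine_arith A0 a1 (ltW d0) a2 (abs_sin_le1 th) hh).
- move=> y hy; rewrite /Y rowintD rowintZ rowint_cst; apply: (single_arith A0 (rowint_cutoff hy)) => //.
  by apply: G; exact: quarter_in.
Qed.
End Bounds.

(** * Numerical inequalities for the whole tree *)

Section TreeArithmetic.
Variable R : realType.
Implicit Types M P c eT eO d tol rho : R.

Lemma tree_mass_arith M P c eT eO d tol rho : 1 <= M -> 49 / 50 <= P -> 1 / 4 <= c ->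
  M / 4 * P * c <= eT + tol -> P * c <= eO + tol -> 0 < rho -> d <= 1 / 1000 * rho ->
  tol <= 1 / 1000 -> tol <= rho / 1000 ->
  rho * M / 50 <= 1 / 2 * (rho * (eT + M * (eO + -1 * c)) + - (4 * d * M + tol)).
Proof.
move=> M1 P1 c1 h1 h2 r0 dr t1 t2.
have M0 : 0 < M by lra.
have q1 : 49 / 50 * c <= P * c by apply: ler_wpM2r; lra.
have e1 : M / 4 * P * c = 1 / 4 * (M * (P * c)) by field.
rewrite e1 in h1.
have h3 : M * (49 / 50 * c) <= M * (P * c) by rewrite ler_pM2l.
have h4 : M * (P * c) <= M * (eO + tol) by rewrite ler_pM2l.
have h5 : M * tol <= M * (1 / 1000) by rewrite ler_pM2l.
have h6 : M * (1 / 4) <= M * c by rewrite ler_pM2l.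
have X : M * (54 / 1000) <= eT + M * (eO + -1 * c).
  have -> : M * (eO + -1 * c) = M * eO - M * c by ring.
  rewrite mulrDr in h4; rewrite mulrCA in h3.
  by move: h1 h3 h4 h5 h6; move: (M * eO) (M * tol) (M * c) (M * (P * c)) => *; lra.
have h7 : rho * (M * (54 / 1000)) <= rho * (eT + M * (eO + -1 * c)) by rewrite ler_pM2l.
have h8 : d * M <= 1 / 1000 * rho * M by rewrite ler_pM2r.
have h9 : rho * 1 <= rho * M by rewrite ler_pM2l.
have -> : 4 * d * M = 4 * (d * M) by ring.
move: h7 h8 h9 t2; rewrite -[1 / 1000 * rho * M]mulrA [rho * (M * _)]mulrA mulr1.
by move: (rho * (_ + _)) (d * M) (rho * M) => *; lra.
Qed.

(** A difference of two values is at most twice the larger modulus, whence the factor 1/2; the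
    penalty M (O - c) is not positive. *)
Lemma on_arith M T O c d tol rho hj hJ : 0 <= M -> 0 < rho -> O <= c ->
  rho * T - 4 * d * M - tol <= hj - hJ ->
  1 / 2 * (rho * (T + M * (O + -1 * c)) + - (4 * d * M + tol)) <= Num.max `|hj| `|hJ|.
Proof.
move=> M0 r0 Oc h.
have h1 : rho * (T + M * (O + -1 * c)) <= rho * T.
  by rewrite ler_pM2l// gerDl mulr_ge0_le0//; lra.
have h2 : hj <= Num.max `|hj| `|hJ| by rewrite le_max ler_norm.
have h3 : - hJ <= Num.max `|hj| `|hJ| by rewrite le_max orbC -normrN ler_norm.
move: h1 h2 h3 h; move: (rho * _) (rho * T) (4 * d * M) (Num.max _ _) => *; lra.
Qed.

(** Where no leaf lives, the penalty -M c outweighs every gain collected before the mass was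
    lost. *)
Lemma off_arith M T O c d tol rho : 0 <= M -> 0 < rho -> 0 < d -> 0 < tol -> T <= M * c -> O = 0 ->
  1 / 2 * (rho * (T + M * (O + -1 * c)) + - (4 * d * M + tol)) <= 0.
Proof.
move=> M0 r0 d0 t0 h ->.
have h1 : rho * (T + M * (0 + -1 * c)) <= 0.
  by rewrite pmulr_rle0// add0r mulN1r mulrN subr_le0.
have h2 : 0 <= 4 * d * M by rewrite mulr_ge0// mulr_ge0// ltW.
move: h1 h2; move: (rho * _) (4 * d * M) => *; lra.
Qed.
Lemma fifty_ge1 M : 1 <= M -> 1 <= 50 * M. Proof. by move=> h; lra. Qed.

Lemma expR_le2 (y : R) : y <= 1 / 16 -> expR y <= 2.
Proof.
move=> h; apply: le_trans (_ : expR (1 / 16) <= _); first by rewrite ler_expR.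
have z : `|1 / 16| <= 1 / 4 :> R by rewrite ger0_norm; lra.
by apply: le_trans (expR_quad z) _; lra.
Qed.

Lemma twice_le4 tol : tol <= 1 / 1000 -> 2 * (1 + tol) <= 4. Proof. by move=> h; lra. Qed.

Lemma complement_fiftieth : 1 - 1 / 50 = 49 / 50 :> R. Proof. by field. Qed.
End TreeArithmetic.

(** * The bound obtained from a tree *)

Section TreeBound.
Variable R : realType.
Variables (b : R) (hb : 1 < b) (cp cm : R) (hcp : cp != 0) (hcm : cm != 0).
Variables (p : R) (hp1 : 1 < p).
Variables (As Bs Bc K d rho p1 p2 : R).
Hypotheses (d0 : 0 < d) (K1 : 1 < K) (rho0 : 0 < rho) (hp : p1 ^+ 2 + p2 ^+ 2 = 1)
  (rp1 : rho * p1 = As - Bs) (rp2 : rho * p2 = Bc) (drho : d <= 1 / 1000 * rho).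
Hypothesis hS : forall v, 0 < v -> v * K <= 1 -> exists e0 T0 : R, 0 < e0 /\
     forall e T, 0 < e -> e <= e0 -> T0 <= T ->
       `|Sv b cp cm v e T - As| <= d /\ `|Cv b cp cm v e T| <= d.
Hypothesis hL : forall v, K <= v -> exists e0 T0 : R, 0 < e0 /\
     forall e T, 0 < e -> e <= e0 -> T0 <= T ->
       `|Sv b cp cm v e T - Bs| <= d /\ `|Cv b cp cm v e T - Bc| <= d.

Lemma tree_bound (U : set R) (u : nat -> R) m : (0 < m)%N -> (forall j, 0 < u j) ->
  (forall j, u j * K ^+ 2 <= u j.+1) -> (forall j, (j < 2 ^ m)%N -> U (u j)) ->
  ((amplitude p * rho / 800 * Num.sqrt m%:R)%:E <= opnormHU b cp cm U p)%E.
Proof.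
move=> m0 u0 uK Uu; set M : R := m%:R.
have M1 : 1 <= M by rewrite /M ler1n.
have M0 : 0 < M by apply: lt_le_trans M1.
pose q := Num.sqrt M; have q0 : 0 < q by rewrite sqrtr_gt0.
have qq : q ^+ 2 = M by rewrite sqr_sqrtr// ltW.
have q1 : 1 <= q by rewrite -(@sqrtr1 R) ler_sqrt// ltW.
(* By Bernoulli, (1 - kap)^m >= 1 - m kap = 49/50. *)
pose kap := (50 * M)^-1; have kap0 : 0 < kap by rewrite invr_gt0 mulr_gt0.
have kM : M * kap = 1 / 50 by rewrite /kap; field; rewrite gt_eqF.
have kap1 : kap <= 1.
  by rewrite invf_le1 ?mulr_gt0//; exact: fifty_ge1.
have [eta [M' [nn [Kf [Bf [eta0 Mk dKf KfB hloss]]]]]] := split_loss hp kap0 kap1.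
(* V <= M, so s^2 V <= 1/16: removing the tilt costs at most e^(1/16) <= 2. Since s is of order
   M^(-1/2), a row mean of order M leaves a bound of order sqrt M. *)
pose s := (4 * q)^-1; have s0 : 0 < s by rewrite invr_gt0 mulr_gt0.
have s4 : `|s| <= 1 / 4.
  by rewrite gtr0_norm// div1r lef_pV2 ?posrE ?mulr_gt0// ler_peMr.
have sM : s ^+ 2 * M = 1 / 16 by rewrite /s -qq; field; rewrite gt_eqF.
pose tol := Num.min (1 / 1000) (rho / 1000).
have tol0 : 0 < tol by rewrite lt_min (thousandth_gt0 ltr01) thousandth_gt0.
have [tol1 tol2] : tol <= 1 / 1000 /\ tol <= rho / 1000 by split; rewrite ge_min lexx ?orbT.
have c01 := @cutoff_01 R; have cs := @cutoff_supp R.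
pose J := (2 ^ m).-1; have J1 : J.+1 = (2 ^ m)%N by rewrite prednK// expn_gt0.
have iJ : (0 + 2 ^ m <= J.+1)%N by rewrite J1.
have g01 x : 0 <= ev (ECst (1 : R)) x by exact: ler01.
have [F [V [T [Om BT]]]] := build hb hcp hcm d0 K1 rho0 hp rp1 rp2 hS hL kap0 kap1 eta0 Mk
  dKf KfB hloss u0 uK iJ cs c01 g01 g01 s4 tol0.
(* The estimate from below holds only on the leaves. Adding M (O - chi) makes Y nonpositive
   elsewhere, and costs in mean only about a fiftieth of M times the mass of chi. *)
pose Y := EMul (ECst (1 / 2)) (EAdd (EMul (ECst rho) (EAdd T (EMul (ECst M)
   (EAdd Om (EMul (ECst (-1)) (cutoff R)))))) (ECst (- (4 * d * M + tol)))).
have YE x : ev Y x = 1 / 2 * (rho * (ev T x + M * (ev Om x + -1 * ev (cutoff R) x))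
   + - (4 * d * M + tol)) by [].
have tiltB s' y : s' ^+ 2 = s ^+ 2 ->
   rowint (EMul (ECst 1) (tilt s' F V)) y <= rowint (ECst 1) y + tol -> rowint (EExp (EMul (ECst s') F)) y <= 4.
  move=> ss h; apply: le_trans (_ : 2 * rowint (EMul (ECst 1) (tilt s' F V)) y <= _); last first.
    apply: le_trans (_ : 2 * (rowint (ECst 1) y + tol) <= _); first by rewrite ler_pM2l.
    by rewrite rowint_cst; exact: twice_le4.
  rewrite -rowintZ; apply: rowint_le => x.
  rewrite -[leLHS]/(expR (s' * ev F x)).
  rewrite -[leRHS]/(2 * (1 * expR (s' * ev F x + - s' ^+ 2 * ev V x))) mul1r ss.
  rewrite mulNr; set v := s ^+ 2 * _; rewrite -{1}[s' * ev F x](subrK v) expRD mulrC.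
  rewrite ler_pM2r ?expR_gt0//; apply: expR_le2.
  rewrite -sM ler_wpM2l ?sqr_ge0//; have /andP[_ h1] := b_V BT x.
  by apply: le_trans h1 _; rewrite ler_piMr ?(ltW M0)//; case/andP: (c01 x).
have -> : amplitude p * rho / 800 * q = s * amplitude p * (rho * M / 50) / 4.
  by rewrite /s -qq; field; rewrite gt_eqF.
apply: (@op_lower R b hb cp cm p hp1 U F Y) => //.
- by exists (u 0%N); apply: Uu; rewrite expn_gt0.
- by move=> x hx; have [] := b_supp BT (cs x hx).
- by move=> y hy; apply: tiltB => //; exact: b_g1 BT _ hy.
- by move=> y hy; apply: tiltB; [rewrite sqrrN|exact: b_g2 BT _ hy].
- move=> x; rewrite YE; have /andP[Om0 Om1] := b_O BT x.
  have [Ox|Ox] := ltP 0 (ev Om x); last first.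
    left; apply: off_arith => //; [exact: b_T BT x|].
    by apply/eqP; rewrite eq_le Ox Om0.
  have xQ : inQ x.
    by apply/negPn/negP => h; have [_ _ _ h'] := b_supp BT (cs x h); rewrite h' ltxx in Ox.
  right; split => //; have [j jm hj] := b_on BT xQ Ox.
  have := on_arith (ltW M0) rho0 Om1 hj; rewrite le_max => /orP[h|h].
    by exists (u j) => //; apply: Uu; case/andP: jm.
  by exists (u J) => //; apply: Uu; rewrite -J1.
- by rewrite divr_gt0// mulr_gt0.
- move=> y hy; have hy' := quarter_in hy.
  rewrite /Y rowintZ rowintD rowintZ rowintD rowintZ rowintD rowintZ rowint_cst.
  have kP : 49 / 50 <= (1 - kap) ^+ m.
    have := @bernoulli R kap m; rewrite kap1 (ltW kap0) -/M kM complement_fiftieth; exact.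
  exact: (tree_mass_arith M1 kP (rowint_cutoff hy) (b_ET BT hy') (b_EO BT hy') rho0 drho tol1 tol2).
Qed.
End TreeBound.

From mathcomp Require Import finmap.

(** * Counting dyadic intervals *)

Section Lacunary.
Variable R : realType.
Implicit Types (U : set R).

Lemma div800_gt0 (y : R) : 0 < y -> 0 < y / 800. Proof. by move=> h; lra. Qed.

(** Take every L-th element of the sorted list: consecutive distinct integers differ by at least
    1. *)
Lemma separated_points (A : {fset int}) (M L : nat) : (0 < L)%N -> (M * L <= #|` A|)%N ->
  exists t : nat -> int, (forall j, (j < M)%N -> t j \in A) /\
    (forall j, (j.+1 < M)%N -> t j + L%:Z <= t j.+1).
Proof.
move=> L0 h; pose s := sort <=%O (enum_fset A).
have ss : size s = #|` A| by rewrite size_sort.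
have st : sorted <%O s by rewrite sort_lt_sorted fset_uniq.
have gap i k : (i + k < size s)%N -> nth 0 s i + k%:Z <= nth 0 s (i + k).
  elim: k => [|k IH]; first by rewrite !addn0 addr0.
  rewrite addnS => hk; have {}IH := IH (ltnW hk).
  apply: le_trans (_ : nth 0 s (i + k) + 1 <= _); first by rewrite -addn1 PoszD addrA lerD2r.
  by rewrite lezD1 lt_sorted_ltn_nth ?inE// ltnW.
have inM j : (j < M)%N -> (j * L < size s)%N.
  by move=> jM; rewrite ss; apply: leq_trans h; rewrite ltn_mul2r L0 jM.
exists (fun j => nth 0 s (j * L)); split.
  move=> j /inM hj; have : nth 0 s (j * L) \in s by apply: mem_nth.
  by rewrite mem_sort.
by move=> j /inM; rewrite mulSn addnC => /gap.
Qed.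

(** Exponents l + 1 apart are required because a point may sit at the top of its dyadic interval and
    the next one at the bottom: the ratio is then still 2^l. *)
Lemma lacunary U (A : {fset int}) (K : R) (l M : nat) : 1 < K -> K ^+ 2 <= 2 ^+ l ->
  [set` A] `<=` dyadic_set U -> (0 < M)%N -> (M * l.+1 <= #|` A|)%N ->
  exists u : nat -> R, [/\ forall j, 0 < u j, forall j, u j * K ^+ 2 <= u j.+1 &
    forall j, (j < M)%N -> U (u j)].
Proof.
move=> K1 Kl AU M0 h; have [t [tA tL]] := separated_points (ltn0Sn l) h.
have /boolp.choice[v hv] : forall n : int, exists y : R,
    n \in A -> U y /\ 2 `^ n%:~R <= y <= 2 `^ (n + 1)%:~R.
  move=> n; have [nA|_] := boolP (n \in A); last by exists 0.
  by have [y Uy hy] := AU n nA; exists y.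
have K0 : 0 < K ^+ 2 by rewrite exprn_gt0// (lt_trans _ K1).
have tm j : t (minn j M.-1) \in A.
  by apply: tA; apply: leq_ltn_trans (geq_minr _ _) _; rewrite prednK.
have v0 n : n \in A -> 0 < v n.
  by move=> /hv[_ /andP[k _]]; apply: lt_le_trans k; rewrite powR_gt0.
(* After the last of the M points the sequence continues geometrically, so that lacunarity holds for
   all indices; these further values need not lie in U. *)
exists (fun j => v (t (minn j M.-1)) * (K ^+ 2) ^+ (j - M.-1)); split.
- by move=> j; apply: mulr_gt0; [exact: v0|exact: exprn_gt0].
- move=> j; rewrite -[leLHS]/(v (t (minn j M.-1)) * (K ^+ 2) ^+ (j - M.-1) * K ^+ 2) -[leRHS]/(v (t (minn j.+1 M.-1)) * (K ^+ 2) ^+ (j.+1 - M.-1)).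
  have [jM|jM] := ltnP j M.-1; last first.
    by rewrite (minn_idPr (leqW jM)) subSn// [in leRHS]exprSr mulrA.
  have jM' : (j.+1 < M)%N by rewrite -(prednK M0) ltnS.
  rewrite (minn_idPl jM).
  have -> : (j - M.-1 = 0)%N by apply/eqP; rewrite subn_eq0 ltnW.
  have -> : (j.+1 - M.-1 = 0)%N by apply/eqP; rewrite subn_eq0.
  rewrite expr0 !mulr1.
  have [_ /andP[_ k1]] := hv _ (tA j (ltnW jM')).
  have [_ /andP[k2 _]] := hv _ (tA j.+1 jM').
  apply: le_trans k2.
  apply: le_trans (_ : 2 `^ (t j + 1)%:~R * 2 ^+ l <= _).
    apply: ler_pM => //; apply: ltW => //; exact: v0 (tA j (ltnW jM')).
  rewrite -powR_mulrn// -powRD; last by apply/implyP => _; rewrite pnatr_eq0.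
  apply: ler_powR; first by rewrite ler1n.
  have -> : (t j + 1)%:~R + l%:R = (t j + l.+1%:Z)%:~R :> R.
    by rewrite -addn1 addnC PoszD addrA [RHS]intrD.
  by rewrite ler_int; exact: tL.
- move=> j jM; have jM' : (j <= M.-1)%N by rewrite -ltnS prednK.
  rewrite /= (minn_idPl jM'); have -> : (j - M.-1 = 0)%N by apply/eqP; rewrite subn_eq0.
  by rewrite expr0 mulr1; have [] := hv _ (tA j jM).
Qed.
End Lacunary.

(** * Comparison with the logarithm *)

Section LogArithmetic.
Variable R : realType.

Lemma sqrt_log_small (n L : nat) (c c2 A : R) : (n < L.*2)%N -> 0 < c ->
  ln L.*2%:R <= A ^+ 2 -> 0 <= A -> c * A <= c2 -> c * Num.sqrt (ln (1 + n%:R)) <= c2.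
Proof.
move=> nL c0 hA A0 h; apply: le_trans h; rewrite ler_pM2l//.
rewrite -[leRHS]ger0_norm// -sqrtr_sqr ler_wsqrtr//; apply: le_trans hA.
by rewrite [1 + _]addrC natr1 ler_ln ?posrE ?ltr0n ?ler_nat//; exact: leq_ltn_trans nL.
Qed.

Lemma ln2_le1 : ln 2 <= 1 :> R.
Proof. by rewrite -[leRHS]expRK ler_ln ?posrE ?expR_gt0//; have := expR_ge1Dx (1 : R); lra. Qed.

(** Here 1 + n <= 2 L 2^m, so the logarithm is at most ln(2L) + m ln 2, hence at most (ln(2L) + 2) m
    because m >= 1. *)
Lemma sqrt_log_large (n L m : nat) (c c1 A : R) : (0 < m)%N -> (0 < L)%N -> (n < L * 2 ^ m.+1)%N ->
  0 < c -> ln L.*2%:R + 2 <= A ^+ 2 -> 0 <= A -> c * A <= c1 ->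
  c * Num.sqrt (ln (1 + n%:R)) <= c1 * Num.sqrt m%:R.
Proof.
move=> m0 L0 nL c0 hA A0 h.
apply: le_trans (_ : c * A * Num.sqrt m%:R <= _); last by rewrite ler_wpM2r// sqrtr_ge0.
rewrite -mulrA ler_pM2l//.
rewrite -[A]ger0_norm// -sqrtr_sqr -sqrtrM ?sqr_ge0// ler_wsqrtr//.
have m1 : 1 <= m%:R :> R by rewrite ler1n.
have L2 : 1 <= L.*2%:R :> R by rewrite ler1n -mul2n muln_gt0.
have l0 : 0 <= ln L.*2%:R :> R by rewrite ln_ge0.
apply: le_trans (_ : (ln L.*2%:R + 2) * m%:R <= _); last by rewrite ler_wpM2r.
apply: le_trans (_ : ln L.*2%:R + m%:R * ln 2 <= _).
  have -> : m%:R * ln 2 = ln (2 ^+ m) :> R by rewrite lnXn// mulr_natl.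
  rewrite -lnM ?posrE ?exprn_gt0 ?(lt_le_trans ltr01 L2)//.
  rewrite -natrX -natrM [1 + _]addrC natr1 ler_ln ?posrE ?ltr0n ?muln_gt0 ?expn_gt0 ?double_gt0 ?L0//.
  by rewrite ler_nat; move: nL; rewrite expnS mulnA muln2.
have h1 : m%:R * ln 2 <= m%:R * 1 :> R by rewrite ler_wpM2l// ln2_le1.
have h2 : ln L.*2%:R * 1 <= ln L.*2%:R * m%:R :> R by rewrite ler_wpM2l.
move: h1 h2; rewrite !mulr1 mulrDl; move: (m%:R * ln 2) (ln L.*2%:R) (ln L.*2%:R * m%:R) => x y z h1 h2; lra.
Qed.

End LogArithmetic.

(** * Assembling the bounds *)

Section Final.
Variable R : realType.
Variables (b : R) (hb : 1 < b) (cp cm : R) (hcp : cp != 0) (hcm : cm != 0).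
Variables (p : R) (hp1 : 1 < p).
Implicit Types (U : set R).

Lemma tree_and_single_bounds : exists c1 c2 K : R, [/\ 0 < c1, 0 < c2, 1 < K,
  forall U u, U u -> 0 < u -> (c2%:E <= opnormHU b cp cm U p)%E &
  forall U (u : nat -> R) m, (0 < m)%N -> (forall j, 0 < u j) ->
    (forall j, u j * K ^+ 2 <= u j.+1) -> (forall j, (j < 2 ^ m)%N -> U (u j)) ->
    ((c1 * Num.sqrt m%:R)%:E <= opnormHU b cp cm U p)%E].
Proof.
have t0 : 0 < 1 / 1000 :> R := thousandth_gt0 ltr01.
have [As [Bs [Bc [K [d [[d0 K1 As0 dAB dA] [hS hL]]]]]]] := multiplier hb hcp hcm t0.
have AB : 0 < As - Bs by rewrite -(pmulr_rgt0 _ t0); exact: lt_le_trans dAB.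
pose rho := Num.sqrt ((As - Bs) ^+ 2 + Bc ^+ 2).
have r2 : rho ^+ 2 = (As - Bs) ^+ 2 + Bc ^+ 2 by rewrite sqr_sqrtr// addr_ge0// sqr_ge0.
have ABr : As - Bs <= rho.
  rewrite -(@ler_pXn2r _ 2) ?nnegrE ?sqrtr_ge0 ?(ltW AB)//.
  by rewrite r2 lerDl sqr_ge0.
have rho0 : 0 < rho by exact: lt_le_trans ABr.
have hq : ((As - Bs) / rho) ^+ 2 + (Bc / rho) ^+ 2 = 1.
  by rewrite !exprMn -mulrDl -r2 -exprMn mulfV ?expr1n// gt_eqF.
have drho : d <= 1 / 1000 * rho by apply: le_trans dAB _; rewrite ler_pM2l.
have s0 := amplitude_gt0 p.
exists (amplitude p * rho / 800), (1 / 4 * amplitude p * (As / 20) / 4), K; split.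
- by apply: div800_gt0; exact: mulr_gt0.
- by rewrite !(mulr_gt0, invr_gt0).
- exact: K1.
- by move=> U u Uu u0; exact: (single_bound hb hcp hcm hp1 As0 (lt_trans ltr01 K1) d0 dA hS Uu u0).
- move=> U u m m0 u0 uK Uu.
  apply: (tree_bound hb hcp hcm hp1 d0 K1 rho0 hq _ _ drho hS hL m0 u0 uK Uu).
    by rewrite mulrC divfK// gt_eqF.
  by rewrite mulrC divfK// gt_eqF.
Qed.
End Final.

Theorem theorem8p1 (R : realType) (b cp cm : R) (hb : 1 < b)
    (hcp : cp != 0) (hcm : cm != 0) (p : R) (hp1 : 1 < p) :
  exists2 c : R, 0 < c &
    forall U : set R, U !=set0 -> U `<=` [set x | 0 < x] ->
      (sqrt_log_times c (frakN U) <= opnormHU b cp cm U p)%E.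
Proof.
have [c1 [c2 [K [c10 c20 K1 single tree]]]] := tree_and_single_bounds hb hcp hcm hp1.
have [l Kl] : exists l, K ^+ 2 <= 2 ^+ l.
  exists (Num.truncn (K ^+ 2)).+1; apply: ltW; apply: lt_le_trans (truncnS_gt _) _.
  by rewrite -natrX ler_nat ltnW// ltn_expl.
pose L := l.+1.
(* This A serves both regimes: few dyadic intervals, where the logarithm is at most ln(2L), and
   many, where it is at most A^2 m. *)
pose A := Num.sqrt (ln L.*2%:R + 2) : R.
have L2 : 0 <= ln L.*2%:R :> R by rewrite ln_ge0// ler1n.
have A2 : A ^+ 2 = ln L.*2%:R + 2 by rewrite sqr_sqrtr// addr_ge0.
have A0 : 0 < A by rewrite sqrtr_gt0 ltr_wpDl.
pose c := Num.min c1 c2 / A.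
have c0 : 0 < c by rewrite divr_gt0// lt_min c10.
have cA : c * A = Num.min c1 c2 by rewrite divfK// gt_eqF.
exists c => // U [u0 Uu0] Upos.
have many (B : {fset int}) m : (0 < m)%N -> [set` B] `<=` dyadic_set U ->
    (2 ^ m * L <= #|` B|)%N -> ((c1 * Num.sqrt m%:R)%:E <= opnormHU b cp cm U p)%E.
  move=> m0 BU hB; have M0 : (0 < 2 ^ m)%N by rewrite expn_gt0.
  have [u [u1 uK uU]] := lacunary K1 Kl BU M0 hB.
  exact: tree u m m0 u1 uK uU.
rewrite /frakN; case: pselect => [fin|inf] /=.
  set n := #|` _|; have nE : n = #|` fset_set (dyadic_set U)| by [].
  rewrite /sqrt_log_times; have [nL|nL] := ltnP n L.*2.
    apply: le_trans (single U u0 Uu0 (Upos _ Uu0)); rewrite lee_fin.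
    apply: (@sqrt_log_small R n L c c2 A) => //; [by rewrite A2 lerDl|exact: ltW|].
    by rewrite cA ge_min lexx orbT.
  (* At least two points survive the thinning by L, so the depth m is positive. *)
  have q2 : (2 <= n %/ L)%N by rewrite leq_divRL// mul2n.
  pose m := trunc_log 2 (n %/ L).
  have m0 : (0 < m)%N by rewrite trunc_log_gt0.
  have /andP[m1 m2] := trunc_log_bounds (erefl : (1 < 2)%N) (ltnW q2).
  apply: le_trans (many (fset_set (dyadic_set U)) m m0 _ _); last 2 first.
  - by rewrite fset_setK.
  - by rewrite -nE -leq_divRL.
  rewrite lee_fin; apply: (@sqrt_log_large R n L m c c1 A) => //.
  - by rewrite mulnC -ltn_divLR.
  - by rewrite A2.
  - exact: ltW.
  - by rewrite cA ge_min lexx.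
(* With infinitely many dyadic intervals trees of every depth exist, and the norm must be
   infinite. *)
have big m : (0 < m)%N -> ((c1 * Num.sqrt m%:R)%:E <= opnormHU b cp cm U p)%E.
  move=> m0; have [B BU hB] := infinite_set_fset (2 ^ m * L) inf.
  exact: many B m m0 BU hB.
rewrite leye_eq; case: (opnormHU _ _ _ _ _) big => [r|//|] big; last by have := big 1%N isT.
pose m := (Num.truncn ((r / c1) ^+ 2)).+1.
have := big m isT; rewrite lee_fin leNgt => /negP[].
rewrite mulrC -ltr_pdivrMr//; apply: le_lt_trans (ler_norm _) _.
by rewrite -sqrtr_sqr ltr_sqrt// truncnS_gt.
Qed.
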